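(* (Fundamental theorem for chains in a flow) Suppose $J\in\hat{\mathcal B}_k^r(U)$ is a differential chain with compact support in $U$, $V\in\mathcal V^r(U)$ is a vector field, and $\omega\in\mathcal B_k^{r+1}(U)$ is a differential form, where $U$ is open in $\mathbb R^n$. Let $J_t$ $(0\le t<t_0)$ be the evolving chain determined by $J_0=J$ and the flow of $V$, and let $0\le a\le b<t_0$. Then $$\int_{J_b}\omega-\int_{J_a}\omega=\int_{\{J_t\}_a^b}L_V\omega .$$
   Context: Chains and forms in an open set $U\subseteq\mathbb R^n$ (the same definitions apply to open sets in other Euclidean spaces). Fix an inner product on $\mathbb R^n$, extended to $k$-vectors by $\langle u_1\wedge\dots\wedge u_k,v_1\wedge\dots\wedge v_k\rangle=\det(\langle u_i,v_j\rangle)$. A simple $k$-vector has mass $\|\alpha\|=\sqrt{\langle\alpha,\alpha\rangle}$; a general one has mass $\|\alpha\|=\inf\{\sum\|\alpha_j\|:\alpha=\sum\alpha_j,\ \alpha_j\text{ simple}\}$. $\mathcal A_k(U)$ is the space of Dirac $k$-chains in $U$: finite formal sums $\sum(p_i;\alpha_i)$, $p_i\in U$, $\alpha_i\in\Lambda_k(\mathbb R^n)$. With $T_u(p;\alpha)=(p+u;\alpha)$ and $\sigma=u_1\circ\dots\circ u_j$ a symmetric product of vectors, put $\|\sigma\|=\|u_1\|\cdots\|u_j\|$ and $\Delta_\sigma(p;\alpha)=(T_{u_1}-I)\cdots(T_{u_j}-I)(p;\alpha)$ (for $j=0$: $(p;\alpha)$, $\|\sigma\|=1$); this has order $j$ and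 is inside $U$ if the convex hull of its support is contained in $U$. $\|A\|_{B^{r,U}}=\inf\{\sum_i\|\sigma_i\|\|\alpha_i\|:A=\sum_i\Delta_{\sigma_i}(p_i;\alpha_i)$ (finite sum), all terms inside $U$, orders $\le r\}$; $\hat{\mathcal B}_k^r(U)$ is the completion of $\mathcal A_k(U)$ in this norm; ${}'\mathcal B_k(U)=\varinjlim_r\hat{\mathcal B}_k^r(U)$ (locally convex inductive limit, linking maps induced by the identity). A $k$-form on $U$ is a linear functional $\omega$ on $\mathcal A_k(U)$; $\|\omega\|_{B^{r,U}}=\max_{0\le j\le r}\sup\{|\omega(\Delta_\sigma(p;\alpha))|:\sigma\text{ of order }j,\ \Delta_\sigma(p;\alpha)\text{ inside }U,\ \|\sigma\|\|\alpha\|=1\}$; $\mathcal B_k^r(U)$ is the space of $k$-forms with this norm finite. $\int_J\omega=\lim\omega(A_i)$ for $J\in\hat{\mathcal B}_k^r(U)$, $\omega\in\mathcal B_k^r(U)$, where $A_i\in\mathcal A_k(U)$ converge to $J$ in the $B^{r,U}$ norm. Support: $K\in{}'\mathcal B_k(\mathbb R^n)$ is accessible in $X$ if for every open $W\supseteq X$ there are Dirac chains supported in $W$ converging to $K$; $\mathrm{supp}(K)$ is the smallest closed set in which $K$ is accessible. The support of a chain in $U$ is that of its image in ${}'\mathcal B_k(\mathbb R^n)$; the chain has compact support in $U$ if this is a compact subset of $U$. Maps and vector fields: for $r\ge1$, $\mathcal M^r(U,\mathbb R^m)$ is the space of $C^r$ maps $F:U\to\mathbb R^m$ such that the directional derivatives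 of the coordinate functions of $F$ lie in $\mathcal B_0^{r-1}(U)$. $\mathcal V^r(U)$ is the subspace of $\mathcal M^r(U,\mathbb R^n)$ of maps with bounded image. For $V\in\mathcal V^r(U)$, $V_t$ is the time-$t$ map of the flow of $V$, and $L_V=i_Vd+d\,i_V$ is the Lie derivative on forms. Operators: pushforward is $F_*(p;v_1\wedge\dots\wedge v_k)=(F(p);DF_p(v_1)\wedge\dots\wedge DF_p(v_k))$ on simple elements, extended linearly to Dirac chains and by continuity to differential chains. For a vector $v$, $E_v^\dagger$ is the continuous operator on differential chains determined by $E_v^\dagger(q;v_1\wedge\dots\wedge v_m)=\sum_{i=1}^m(-1)^{i+1}\langle v,v_i\rangle(q;v_1\wedge\cdots\widehat{v_i}\cdots\wedge v_m)$. The Cartesian wedge product of Dirac chains in open sets $U_1,U_2$ is $(p;\alpha)\times(q;\beta)=((p,q);\iota_{1*}\alpha\wedge\iota_{2*}\beta)$, where $\iota_1,\iota_2$ include the factors in the product space; it extends bilinearly and by continuity to differential chains. $\widetilde{(a,b)}$ is the $1$-chain in $\mathbb R$ representing the interval $(a,b)$, i.e. $\int_{\widetilde{(a,b)}}\eta=\int_a^b\eta$ (Riemann integral) for all $\eta\in\mathcal B_1^1(\mathbb R)$. Evolving chains: let $J_0\in\hat{\mathcal B}_k^r(U)$ have compact support in $U$ and $V\in\mathcal V^r(U)$. For each $p\in U$, $V_t(p)$ is well defined in $U$ for small $t$; since $J_0$ has compact support there is $t_0>0$ such that the pushforward $V_{t*}$ is defined on $J_0$ for all $0\le t<t_0$.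 Put $J_t=V_{t*}J_0$. Let $\theta:U\times[0,t_0)\to U$, $\theta(p,t)=V_t(p)$, and let $e_{n+1}$ be the unit vector of the last (time) factor of $\mathbb R^{n+1}=\mathbb R^n\times\mathbb R$. For $0\le a\le b<t_0$ define $$\{J_t\}_a^b=\theta_*E_{e_{n+1}}^\dagger\big(J_0\times\widetilde{(a,b)}\big)\in\hat{\mathcal B}_k^r(U).$$
   Formalization: The right side carries a factor (-1)^k, since with the given conventions the printed identity fails for odd k; it is also assumed that L_Vω lies in B_k^r(U) and that the pushforwards V_{t*}J and θ_* defining J_t and {J_t}_a^b exist at level r, which V in V^r does not ensure for k≥1. *)

(* Defs.v *)
From HB Require Import structures.
From mathcomp Require Import all_boot all_order all_algebra finmap.
From mathcomp Require Import all_classical all_reals all_analysis.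

Set Implicit Arguments.
Unset Strict Implicit.
Unset Printing Implicit Defensive.

Import Order.TTheory GRing.Theory Num.Theory.
Import numFieldNormedType.Exports.

Local Open Scope classical_set_scope.
Local Open Scope ring_scope.
Local Open Scope quotient_scope.

Record seminorm (R : realType) (V : lmodType R) := Seminorm {
  snorm :> V -> R ;
  snorm_triangle : forall x y, snorm (x + y) <= snorm x + snorm y ;
  snormZ : forall a x, snorm (a *: x) = `|a| * snorm x }.

Section SeminormTheory.
Context {R : realType} {V : lmodType R}.
Variable N : seminorm V.

Lemma snorm0 : N 0 = 0.
Proof. by rewrite -(scale0r (0 : V)) snormZ normr0 mul0r. Qed.

Lemma snormN x : N (- x) = N x.
Proof. by rewrite -scaleN1r snormZ normrN1 mul1r. Qed.

Lemma snorm_ge0 x : 0 <= N x.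
Proof.
have := snorm_triangle N x (- x).
by rewrite subrr snorm0 snormN -mulr2n pmulrn_lge0.
Qed.

Definition cauchy_seq : {pred (nat -> V)} := fun s =>
  `[< forall e, 0 < e ->
      exists m, forall i j, (m <= i)%N -> (m <= j)%N -> N (s i - s j) < e >].

Lemma cauchy_seq_submod_closed : submod_closed cauchy_seq.
Proof.
split=> [|a s t /asboolP cs /asboolP ct]; apply/asboolP => e e0.
  by exists 0%N => i j _ _; rewrite subrr snorm0.
have a0 : 0 < `|a| + 1 by rewrite ltr_wpDl.
have [m1 Hm1] := cs (e / 2 / (`|a| + 1)) (divr_gt0 (divr_gt0 e0 (ltr0Sn _ 1)) a0).
have [m2 Hm2] := ct (e / 2) (divr_gt0 e0 (ltr0Sn _ 1)).
exists (maxn m1 m2) => i j; rewrite !geq_max => /andP[i1 i2] /andP[j1 j2].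
have -> : (a *: s + t) i - (a *: s + t) j = a *: (s i - s j) + (t i - t j).
  by rewrite scalerBr opprD addrACA.
apply: le_lt_trans (snorm_triangle _ _ _) _.
rewrite snormZ [ltRHS](splitr e); apply: ler_ltD; last exact: Hm2.
apply: (@le_trans _ _ ((`|a| + 1) * N (s i - s j))).
  by apply: ler_wpM2r; rewrite ?snorm_ge0// lerDl.
by rewrite mulrC -ler_pdivlMr// ltW// Hm1.
Qed.
HB.instance Definition _ :=
  GRing.isSubmodClosed.Build R (nat -> V) cauchy_seq cauchy_seq_submod_closed.

Record cauchy_type := Cauchy { cauchy_val :> nat -> V ; _ : cauchy_val \in cauchy_seq }.
HB.instance Definition _ := [isSub for cauchy_val].
HB.instance Definition _ := [Choice of cauchy_type by <:].
HB.instance Definition _ := [SubChoice_isSubLmodule of cauchy_type by <:].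

Definition null_seq : {pred cauchy_type} := fun s =>
  `[< N (s i) @[i --> \oo] --> (0 : R) >].

Lemma null_seq_submod_closed : submod_closed null_seq.
Proof.
split=> [|a s t /asboolP ns /asboolP nt]; apply/asboolP.
  by under eq_fun do rewrite snorm0; exact: cvg_cst.
apply: (@squeeze_cvgr _ _ _ _ (cst 0) (fun i => `|a| * N (s i) + N (t i))).
- apply: nearW => i /=; rewrite snorm_ge0/= -snormZ; exact: snorm_triangle.
- exact: cvg_cst.
- rewrite -[X in _ --> X]addr0 -[X in _ --> X + _](mulr0 `|a|).
  by apply: cvgD nt; apply: cvgM ns; exact: cvg_cst.
Qed.
HB.instance Definition _ :=
  GRing.isSubmodClosed.Build R cauchy_type null_seq null_seq_submod_closed.

(* Cauchy sequences modulo null sequences, for an arbitrary seminorm. *)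
Definition completion := Quotient.quot null_seq.
HB.instance Definition _ := GRing.Zmodule.on completion.

Definition completion_scale (a : R) (J : completion) : completion :=
  \pi_(Quotient.quot null_seq) (a *: (repr J : cauchy_type)).

Let pi_eq (s t : cauchy_type) : s - t \in null_seq ->
  \pi_(Quotient.quot null_seq) s = \pi_(Quotient.quot null_seq) t.
Proof. by move=> st; apply/eqP; rewrite -Quotient.idealrBE. Qed.

Let pi_repr (s : cauchy_type) :
  repr (\pi_(Quotient.quot null_seq) s) - s \in null_seq.
Proof. by rewrite Quotient.idealrBE reprK. Qed.

Let cscale_pi a (s : cauchy_type) :
  completion_scale a (\pi_(Quotient.quot null_seq) s) = \pi_(Quotient.quot null_seq) (a *: s).
Proof. by apply: pi_eq; rewrite -scalerBr rpredZ// pi_repr. Qed.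

Let pi_add (s t : cauchy_type) :
  \pi_(Quotient.quot null_seq) s + \pi_(Quotient.quot null_seq) t
  = \pi_(Quotient.quot null_seq) (s + t).
Proof. by apply: esym; exact: Quotient.pi_add. Qed.

Let cscaleA a b (J : completion) :
  completion_scale a (completion_scale b J) = completion_scale (a * b) J.
Proof. by rewrite [completion_scale b J]/completion_scale cscale_pi scalerA. Qed.

Let cscale1 : left_id 1 completion_scale.
Proof. by move=> J; rewrite /completion_scale scale1r reprK. Qed.

Let cscaleDr : right_distributive completion_scale +%R.
Proof.
move=> a J K; rewrite -[J]reprK -[K]reprK.
by rewrite [X in completion_scale a X]pi_add !cscale_pi scalerDr [RHS]pi_add.
Qed.

Let cscaleDl J : {morph completion_scale^~ J : a b / a + b}.
Proof. by move=> a b; rewrite /completion_scale scalerDl [RHS]pi_add. Qed.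

HB.instance Definition _ := GRing.Zmodule_isLmodule.Build R completion
  cscaleA cscale1 cscaleDr cscaleDl.

Lemma cst_cauchy (x : V) : cst x \in cauchy_seq.
Proof. by apply/asboolP => e e0; exists 0%N => i j _ _; rewrite subrr snorm0. Qed.

Definition cembed (x : V) : completion :=
  \pi_(Quotient.quot null_seq) (Cauchy (cst_cauchy x)).

(* The choice of the representative is irrelevant: two of them differ by a
   sequence whose seminorm tends to 0. *)
Definition cnorm (J : completion) : R :=
  lim (N ((repr J : cauchy_type) i) @[i --> \oo]).

Definition converges_to (A : nat -> V) (J : completion) :=
  cnorm (cembed (A i) - J) @[i --> \oo] --> (0 : R).

End SeminormTheory.

Section MultiVectors.
Context {R : realType}.

(* Strictly increasing multi-indices I : [0, k[ -> [0, n[; a k-vector is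
   given by its coordinates in the basis e_(I 0) /\ ... /\ e_(I (k-1)). *)
Definition multi (k n : nat) :=
  {f : {ffun 'I_k -> 'I_n} |
    [forall i : 'I_k, forall j : 'I_k, (i < j)%N ==> (f i < f j)%N]}.

Definition kvec (k n : nat) := {ffun multi k n -> R^o}.

Definition basis_rows k n (I : multi k n) : 'M[R]_(k, n) :=
  \matrix_(i, j) (val I i == j)%:R.

(* v_1 /\ ... /\ v_k for the rows v_i of M: its coordinates are the k x k minors. *)
Definition wedge k n (M : 'M[R]_(k, n)) : kvec k n :=
  [ffun I : multi k n => \det (colsub (val I) M)].

(* Linear extension from simple vectors: if phi is multilinear and alternating in
   the rows of its argument, klin phi is the linear map that sends
   v_1 /\ ... /\ v_k to phi (v_1, ..., v_k). *)
Definition klin k n (W : lmodType R) (phi : 'M[R]_(k, n) -> W) (al : kvec k n)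
  : W := \sum_(I : multi k n) (al I : R) *: phi (basis_rows I).

Lemma klin_is_linear k n (W : lmodType R) (phi : 'M[R]_(k, n) -> W) :
  linear (klin phi).
Proof.
move=> a al be; rewrite /klin scaler_sumr -big_split/=; apply: eq_bigr => I _.
by rewrite !ffunE scalerDl scalerA.
Qed.

(* An inner product on R^n is given by its Gram matrix in the canonical basis. *)
Definition inner_product n (G : 'M[R]_n) :=
  G^T = G /\ forall v : 'rV[R]_n, v != 0 -> 0 < (v *m G *m v^T) 0 0.

Definition vdot n (G : 'M[R]_n) (u v : 'rV[R]_n) : R := (u *m G *m v^T) 0 0.

Definition vnorm n (G : 'M[R]_n) (u : 'rV[R]_n) : R := Num.sqrt (vdot G u u).

(* The bilinear extension of <u_1 /\ ... /\ u_k, v_1 /\ ... /\ v_k> = det <u_i, v_j>. *)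
Definition kdot k n (G : 'M[R]_n) (al be : kvec k n) : R :=
  \sum_(I : multi k n) \sum_(J : multi k n)
    al I * be J * \det (basis_rows I *m G *m (basis_rows J)^T).

(* The scalar c matters for k = 0 only, where every scalar has to be simple while
   the empty wedge product is 1. *)
Definition simple k n (al : kvec k n) :=
  exists c (M : 'M[R]_(k, n)), al = c *: wedge M.

Definition mass_set k n (G : 'M[R]_n) (al : kvec k n) : set R :=
  [set x | exists s : seq (kvec k n),
    [/\ {in s, forall be, simple be}, al = \sum_(be <- s) be &
        x = \sum_(be <- s) Num.sqrt (kdot G be be)]].

Definition mass k n (G : 'M[R]_n) (al : kvec k n) : R := inf (mass_set G al).

Lemma kdotZ k n (G : 'M[R]_n) c (al : kvec k n) :
  kdot G (c *: al) (c *: al) = c ^+ 2 * kdot G al al.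
Proof.
rewrite /kdot mulr_sumr; apply: eq_bigr => I _; rewrite mulr_sumr.
by apply: eq_bigr => J _; rewrite !ffunE /= /GRing.scale/= mulrACA -expr2 !mulrA.
Qed.

Lemma mass_set_lbound k n (G : 'M[R]_n) (al : kvec k n) : lbound (mass_set G al) 0.
Proof. by move=> _ [s [_ _ ->]]; apply: sumr_ge0 => be _; rewrite sqrtr_ge0. Qed.

Lemma mass_ge0 k n (G : 'M[R]_n) (al : kvec k n) : 0 <= mass G al.
Proof.
have [e|/set0P ne] := eqVneq (mass_set G al) set0; first by rewrite /mass e inf0.
exact: lb_le_inf ne (@mass_set_lbound _ _ _ _).
Qed.

Lemma mass_setZ k n (G : 'M[R]_n) c (al : kvec k n) x :
  mass_set G al x -> mass_set G (c *: al) (`|c| * x).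
Proof.
move=> [s [ss -> ->]]; exists (map (fun be => c *: be) s); split.
- move=> _ /mapP[be /ss[d [M ->]] ->]; exists (c * d), M.
  by rewrite scalerA.
- by rewrite big_map scaler_sumr.
- rewrite big_map mulr_sumr; apply: eq_bigr => be _.
  by rewrite kdotZ sqrtrM ?sqr_ge0// sqrtr_sqr.
Qed.

Lemma ge_inf_mem (E : set R) x : has_lbound E -> E x -> inf E <= x.
Proof. by move=> lE; exact: ge_inf. Qed.

Lemma massZ_le k n (G : 'M[R]_n) c (al : kvec k n) :
  mass G (c *: al) <= `|c| * mass G al.
Proof.
have lb be : has_lbound (mass_set G be) by exists 0; exact: mass_set_lbound.
have [->|c0] := eqVneq c 0.
  rewrite normr0 mul0r /mass; apply: ge_inf_mem; first exact: lb.
  by exists [::]; split=> //; rewrite ?big_nil// scale0r.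
have [e|/set0P ne] := eqVneq (mass_set G al) set0.
  suff e' : mass_set G (c *: al) = set0 :> set R by rewrite /mass e e' inf0 mulr0.
  rewrite -subset0 => x /(mass_setZ c^-1).
  by rewrite scalerA mulVf// scale1r e.
rewrite mulrC -ler_pdivrMr ?normr_gt0//; apply: lb_le_inf => // x xal.
by rewrite ler_pdivrMr ?normr_gt0// mulrC /mass; apply: ge_inf_mem; [exact: lb|exact: mass_setZ].
Qed.

End MultiVectors.
Arguments kvec : clear implicits.

Section DiracChains.
Context {R : realType} {n : nat}.

Definition supp k (A : 'rV[R]_n -> kvec R k n) : set 'rV[R]_n :=
  [set p | A p != 0].

Definition dchain_fun k (U : set 'rV[R]_n) : {pred ('rV[R]_n -> kvec R k n)} :=
  fun A => `[< finite_set (supp A) /\ supp A `<=` U >].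

Lemma dchain_fun_submod_closed k U : submod_closed (@dchain_fun k U).
Proof.
split=> [|a A B /asboolP[Af AU] /asboolP[Bf BU]]; apply/asboolP.
  suff -> : supp (0 : 'rV[R]_n -> kvec R k n) = set0 by split.
  by rewrite -subset0 => p; rewrite /supp/= eqxx.
have ABs : supp (a *: A + B) `<=` supp A `|` supp B.
  move=> p; rewrite /supp/=; apply: contraPP => /not_orP[/negP + /negP].
  rewrite !negbK => /eqP Ap /eqP Bp; apply/negP; rewrite negbK.
  have -> : (a *: A + B) p = a *: A p + B p by [].
  by rewrite Ap Bp scaler0 addr0.
split; first by apply: sub_finite_set ABs _; rewrite finite_setU.
by move=> p /ABs[/AU|/BU].
Qed.
HB.instance Definition _ k U := GRing.isSubmodClosed.Build R _ (@dchain_fun k U)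
  (@dchain_fun_submod_closed k U).

(* The Dirac k-chains in U. A finite formal sum of the (p_i; al_i) is the finitely
   supported function that maps p to the sum of the al_i with p_i = p. *)
Record dchain (k : nat) (U : set 'rV[R]_n) := DChain {
  dval :> 'rV[R]_n -> kvec R k n ; _ : dval \in @dchain_fun k U }.
HB.instance Definition _ k U := [isSub for @dval k U].
HB.instance Definition _ k U := [Choice of dchain k U by <:].
HB.instance Definition _ k U := [SubChoice_isSubLmodule of dchain k U by <:].

Definition fpoint k (p : 'rV[R]_n) (al : kvec R k n) : 'rV[R]_n -> kvec R k n :=
  fun q => if q == p then al else 0.

(* (p; al) as a chain in U; 0 if p is not in U and al is not 0. *)
Definition dpoint k U (p : 'rV[R]_n) (al : kvec R k n) : dchain k U :=
  insubd 0 (fpoint p al).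

Definition dincl k U U' (A : dchain k U) : dchain k U' := insubd 0 (dval A).

(* The linear map on chains with (p; v_1 /\ ... /\ v_k) |-> phi p (v_1, ..., v_k). *)
Definition lin_ext k U (W : lmodType R) (phi : 'rV[R]_n -> 'M[R]_(k, n) -> W)
    (A : dchain k U) : W :=
  \sum_(p \in supp A) klin (phi p) (A p).

Lemma dchain_finite k U (A : dchain k U) : finite_set (supp A).
Proof. by case: A => A /= /asboolP[]. Qed.

Lemma lin_ext_widen k U (W : lmodType R) (phi : 'rV[R]_n -> 'M[R]_(k, n) -> W)
    (A : dchain k U) (D : set 'rV[R]_n) : supp A `<=` D ->
  lin_ext phi A = \sum_(p \in D) klin (phi p) (A p).
Proof.
move=> AD; apply: fsbig_widen => // p [_ /negP]; rewrite negbK => /eqP /= ->.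
by rewrite /klin big1// => I _; rewrite ffunE scale0r.
Qed.

Lemma lin_ext_is_linear k U (W : lmodType R) (phi : 'rV[R]_n -> 'M[R]_(k, n) -> W) :
  linear (@lin_ext k U W phi).
Proof.
move=> a A B; set D := supp (a *: A + B : dchain k U) `|` (supp A `|` supp B).
have Df : finite_set D by rewrite !finite_setU; do !split; exact: dchain_finite.
rewrite !(@lin_ext_widen _ _ _ _ _ D); do ?by move=> p; rewrite /D/=; tauto.
rewrite !fsbig_finite//= scaler_sumr -big_split/=; apply: eq_bigr => p _.
by rewrite -klin_is_linear.
Qed.
HB.instance Definition _ k U (W : lmodType R) phi := GRing.isLinear.Build R (dchain k U) W *:%R
  (@lin_ext k U W phi) (@lin_ext_is_linear k U W phi).

(* (u_1 ... u_j, p, al), which stands for Delta_(u_1 o ... o u_j) (p; al). *)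
Definition dterm (k : nat) := (seq 'rV[R]_n * 'rV[R]_n * kvec R k n)%type.

(* (T_u A) q = A (q - u). *)
Definition Delta k (t : dterm k) : 'rV[R]_n -> kvec R k n :=
  foldr (fun u A q => A (q - u) - A q) (fpoint t.1.2 t.2) t.1.1.

Definition dorder k (t : dterm k) : nat := size t.1.1.

Definition hull (S : set 'rV[R]_n) : set 'rV[R]_n :=
  [set x | exists (m : nat) (w : 'I_m -> R) (s : 'I_m -> 'rV[R]_n),
    [/\ forall i, 0 <= w i, forall i, S (s i), \sum_i w i = 1 &
        x = \sum_i w i *: s i]].

Definition inside k (U : set 'rV[R]_n) (t : dterm k) := hull (supp (Delta t)) `<=` U.

Variable G : 'M[R]_n.

Definition cost k (t : dterm k) : R :=
  (\prod_(u <- t.1.1) vnorm G u) * mass G t.2.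

Definition bnorm_set (r k : nat) (U : set 'rV[R]_n) (A : dchain k U) : set R :=
  [set x | exists s : seq (dterm k),
    [/\ {in s, forall t, inside U t /\ (dorder t <= r)%N},
        dval A = \sum_(t <- s) Delta t & x = \sum_(t <- s) cost t]].

Definition bnorm_fun r k U (A : dchain k U) : R := inf (bnorm_set r A).

Lemma cost_ge0 k (t : dterm k) : 0 <= cost t.
Proof.
by rewrite mulr_ge0 ?mass_ge0// prodr_ge0// => u _; exact: sqrtr_ge0.
Qed.

Lemma bnorm_set_lbound r k U (A : dchain k U) : has_lbound (bnorm_set r A).
Proof. by exists 0 => _ [s [_ _ ->]]; apply: sumr_ge0 => t _; exact: cost_ge0. Qed.

Lemma bnorm_set_neq0 r k U (A : dchain k U) : bnorm_set r A !=set0.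
Proof.
have Af := dchain_finite A; have AU : supp A `<=` U by case: A {Af} => A /= /asboolP[].
pose s := [seq ([::], p, A p) : dterm k | p <- fset_set (supp A)].
exists (\sum_(t <- s) cost t), s; split=> //.
- move=> _ /mapP[p pA ->]; split=> // x [m [w [q [w0 qs w1 ->]]]].
  have qp i : q i = p.
    by move: (qs i); rewrite /supp/= /Delta/= /fpoint; case: (q i =P p) => // _; rewrite eqxx.
  under eq_bigr do rewrite qp.
  rewrite -scaler_suml w1 scale1r; apply: AU.
  by move: pA; rewrite in_fset_set// inE.
- apply/funext => q; rewrite fct_sumE big_map /= /Delta/= /fpoint.
  have [qA|qA] := boolP (q \in fset_set (supp A)).
    rewrite (bigD1_seq q) ?finmap.fset_uniq//=.
    rewrite big1 ?addr0 => [|p]; first by rewrite eqxx.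
    by rewrite eq_sym => /negbTE ->.
  rewrite big1_seq => [|p /= pA].
    by apply/eqP; move: qA; rewrite in_fset_set// notin_setE => /negP; rewrite negbK.
  by case: eqP => // qp; rewrite -qp (negbTE qA) in pA.
Qed.

Lemma bnorm_triangle r k U (A B : dchain k U) :
  bnorm_fun r (A + B) <= bnorm_fun r A + bnorm_fun r B.
Proof.
rewrite /bnorm_fun -lerBlDr; apply: lb_le_inf; first exact: bnorm_set_neq0.
move=> x [s [sU As ->]]; rewrite lerBlDr [leRHS]addrC -lerBlDr.
apply: lb_le_inf; first exact: bnorm_set_neq0.
move=> y [t [tU Bt ->]]; rewrite lerBlDr [leRHS]addrC.
apply: ge_inf_mem; first exact: bnorm_set_lbound.
exists (s ++ t); split; last by rewrite big_cat.
- by move=> z; rewrite mem_cat => /orP[/sU|/tU].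
- by rewrite big_cat/= -As -Bt.
Qed.

Lemma DeltaZ k a (t : dterm k) : Delta (t.1, a *: t.2) = a *: Delta t.
Proof.
case: t => -[s p] al; rewrite /Delta/=; elim: s => [|u s IH]/=.
  by apply/funext => q; rewrite /fpoint/= -[RHS]/(a *: _); case: ifP => // _; rewrite scaler0.
by rewrite IH; apply/funext => q /=; rewrite -[RHS]/(a *: (_ - _)) scalerBr.
Qed.

Lemma bnormZ_le r k U a (A : dchain k U) :
  bnorm_fun r (a *: A) <= `|a| * bnorm_fun r A.
Proof.
have [->|a0] := eqVneq a 0.
  rewrite normr0 mul0r scale0r; apply: ge_inf_mem; first exact: bnorm_set_lbound.
  by exists [::]; split; rewrite ?big_nil.
rewrite mulrC -ler_pdivrMr ?normr_gt0//.
apply: lb_le_inf; first exact: bnorm_set_neq0.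
move=> _ [s [sU As ->]]; rewrite ler_pdivrMr ?normr_gt0// mulrC mulr_sumr.
pose sa := [seq (t.1, a *: t.2) | t <- s].
apply: (@le_trans _ _ (\sum_(t <- sa) cost t)).
  apply: ge_inf_mem; first exact: bnorm_set_lbound.
  exists sa; split=> //.
  - move=> _ /mapP[t /sU[tU tr] ->]; split=> //; rewrite /inside DeltaZ.
    apply: subset_trans tU => x [m [w [q [w0 qs w1 ->]]]]; exists m, w, q; split=> // i.
    move: (qs i); rewrite /supp/= -[(a *: Delta t) _]/(a *: (Delta t _)).
    by rewrite scaler_eq0 negb_or => /andP[].
  - rewrite big_map -[dval (a *: A)]/(a *: dval A) As scaler_sumr.
    by apply: eq_bigr => t _; rewrite DeltaZ.
rewrite big_map; apply: ler_sum => t _; rewrite /cost/= mulrCA ler_wpM2l ?massZ_le//.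
by rewrite prodr_ge0// => u _; exact: sqrtr_ge0.
Qed.

Lemma bnormZ r k U a (A : dchain k U) : bnorm_fun r (a *: A) = `|a| * bnorm_fun r A.
Proof.
apply/eqP; rewrite eq_le bnormZ_le/=.
have [->|a0] := eqVneq a 0.
  rewrite normr0 mul0r; apply: lb_le_inf; first exact: bnorm_set_neq0.
  by move=> _ [s [_ _ ->]]; apply: sumr_ge0 => t _; exact: cost_ge0.
rewrite mulrC -ler_pdivlMr ?normr_gt0// mulrC -normfV.
by rewrite -{1}[A]scale1r -(mulVf a0) -scalerA bnormZ_le.
Qed.

Definition bnorm r k U : seminorm (dchain k U) :=
  Seminorm (@bnorm_triangle r k U) (@bnormZ r k U).

End DiracChains.

Section Extension.
Context {R : realType} {V V' : lmodType R}.

(* The value at J of the extension of T by continuity, for T continuous (if T is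
   not, no K qualifies and the value is 0). *)
Definition cont_ext (N : seminorm V) (N' : seminorm V') (T : V -> completion N')
    (J : completion N) : completion N' :=
  xget 0 [set K | forall A : nat -> V, converges_to A J ->
                    cnorm (T (A i) - K) @[i --> \oo] --> (0 : R)].

End Extension.

Section ChainsForms.
Context {R : realType} {n : nat}.
Variable G : 'M[R]_n.

Definition bhat (r k : nat) (U : set 'rV[R]_n) := completion (bnorm G r k U).

Definition kform (k : nat) (U : set 'rV[R]_n) := {linear dchain k U -> R^o}.

(* The maximum starts from 0, to the effect that an empty supremum is 0. *)
Definition form_norm (r k : nat) (U : set 'rV[R]_n) (om : kform k U) : \bar R :=
  \big[maxe/0%E]_(j < r.+1)
    ereal_sup [set y | exists (t : dterm k) (A : dchain k U),
      [/\ dorder t = j, inside U t, dval A = Delta t, cost G t = 1 &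
          y = `|om A|%:E]].

Definition bform (r k : nat) (U : set 'rV[R]_n) (om : kform k U) :=
  (form_norm r om < +oo)%E.

Definition bint (r k : nat) (U : set 'rV[R]_n) (J : bhat r k U) (om : kform k U) : R :=
  xget 0 [set x | forall A : nat -> dchain k U, converges_to A J ->
                    om (A i) @[i --> \oo] --> x].

(* link and to_Rn are the maps induced by the identity on Dirac chains. *)
Definition link (r k : nat) (U : set 'rV[R]_n) : bhat r k U -> bhat r.+1 k U :=
  cont_ext (fun A => cembed (bnorm G r.+1 k U) A).

Definition to_Rn (r k : nat) (U : set 'rV[R]_n) : bhat r k U -> bhat r k [set: 'rV[R]_n] :=
  cont_ext (fun A => cembed (bnorm G r k [set: 'rV[R]_n]) (dincl _ A)).

(* The inductive limit over s of the spaces bhat s k R^n carries the finest locally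
   convex topology that makes the maps from these spaces continuous. It is defined
   by the seminorms on the limit whose restriction to every step s is continuous,
   that is, by the families q of continuous seminorms compatible with the links. *)
Definition indlim_seminorm (k : nat)
    (q : forall s, seminorm (bhat s k [set: 'rV[R]_n])) :=
  (forall s, exists C, forall K, q s K <= C * cnorm K) /\
  (forall s K, q s.+1 (link K) = q s K).

(* Convergence of Dirac chains in the inductive limit, to an element of step r. *)
Definition indlim_cvg (r k : nat) (A : nat -> dchain k [set: 'rV[R]_n])
    (K : bhat r k [set: 'rV[R]_n]) :=
  forall q, indlim_seminorm q ->
    q r (cembed (bnorm G r k [set: 'rV[R]_n]) (A i) - K) @[i --> \oo] --> (0 : R).

Definition accessible (r k : nat) (X : set 'rV[R]_n) (K : bhat r k [set: 'rV[R]_n]) :=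
  forall W, open W -> X `<=` W ->
    exists A : nat -> dchain k [set: 'rV[R]_n],
      (forall i, supp (A i) `<=` W) /\ indlim_cvg A K.

Definition is_support (r k : nat) (S : set 'rV[R]_n) (K : bhat r k [set: 'rV[R]_n]) :=
  [/\ closed S, accessible S K &
      forall S', closed S' -> accessible S' K -> S `<=` S'].

Definition compact_support (r k : nat) (U : set 'rV[R]_n) (J : bhat r k U) :=
  exists S, [/\ is_support S (to_Rn J), compact S & S `<=` U].

End ChainsForms.

Section Maps.
Context {R : realType} {n : nat}.
Implicit Types U : set 'rV[R]_n.

(* Maps on U are total functions; their values outside the open set U are irrelevant. *)
Fixpoint Cr m (r : nat) U (F : 'rV[R]_n -> 'rV[R]_m) : Prop :=
  match r with
  | 0 => forall p, U p -> {for p, continuous F}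
  | r'.+1 => (forall p, U p -> differentiable F p) /\
             forall v, Cr r' U (fun p => 'D_v F p)
  end.

(* A 0-form is a function on U. *)
Definition fun_form U (f : 'rV[R]_n -> R) : kform 0 U :=
  lin_ext (W := R^o) (fun p _ => f p).

Definition Mr (G : 'M[R]_n) m (r : nat) U (F : 'rV[R]_n -> 'rV[R]_m) :=
  Cr r U F /\
  forall v (i : 'I_m), bform G r.-1 (fun_form U (fun p => 'D_v F p 0 i)).

Definition vector_field (G : 'M[R]_n) (r : nat) U (V : 'rV[R]_n -> 'rV[R]_n) :=
  Mr G r U V /\ exists C, forall p, U p -> `|V p| <= C.

Definition feval k U (om : kform k U) (p : 'rV[R]_n) (M : 'M[R]_(k, n)) : R :=
  om (dpoint U p (wedge M)).

(* d om (v_0 /\ ... /\ v_k) = sum_i (-1)^i D_(v_i) (om (v_0 /\ ... v_i omitted ... /\ v_k)). *)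
Definition ext_d k U (om : kform k U) : kform k.+1 U :=
  lin_ext (W := R^o) (fun p (M : 'M[R]_(k.+1, n)) =>
    \sum_(i < k.+1) (-1) ^+ i *
      'D_(row i M) (fun q => feval om q (row' i M) : R^o) p).

Definition int_prod (V : 'rV[R]_n -> 'rV[R]_n) k U (om : kform k.+1 U) : kform k U :=
  lin_ext (W := R^o) (fun p (M : 'M[R]_(k, n)) => feval om p (col_mx (V p) M)).

(* i_V d + d i_V, where i_V vanishes on 0-forms. *)
Definition lie (V : 'rV[R]_n -> 'rV[R]_n) k U : kform k U -> kform k U :=
  match k with
  | 0 => fun om => int_prod V (ext_d om)
  | k'.+1 => fun om => int_prod V (ext_d om) \+ ext_d (int_prod V om)
  end.

(* The integral curve through p lives on an open interval that contains both times
   0 and t, so that all its derivatives are two-sided. *)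
Definition solution (V : 'rV[R]_n -> 'rV[R]_n) U (t : R) (p : 'rV[R]_n)
    (gam : R -> 'rV[R]_n) :=
  exists al be : R,
    [/\ al < Num.min 0 t, Num.max 0 t < be, gam 0 = p &
        forall s, al < s < be -> U (gam s) /\ is_derive s (1 : R) gam (V (gam s))].

Definition flow_dom (V : 'rV[R]_n -> 'rV[R]_n) U (t : R) : set 'rV[R]_n :=
  [set p | exists gam, solution V U t p gam].

(* V_t (p), for p in flow_dom V U t. *)
Definition flow (V : 'rV[R]_n -> 'rV[R]_n) U (t : R) (p : 'rV[R]_n) : 'rV[R]_n :=
  xget p [set x | exists gam, solution V U t p gam /\ x = gam t].

End Maps.

Section Operators.
Context {R : realType}.

Definition push_dirac n m k (U : set 'rV[R]_n) (U' : set 'rV[R]_m)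
    (F : 'rV[R]_n -> 'rV[R]_m) : dchain k U -> dchain k U' :=
  lin_ext (fun p (M : 'M[R]_(k, n)) =>
    dpoint U' (F p) (wedge (\matrix_(i < k) 'd F p (row i M)))).

(* The chains A_i are supported in one compact subset of D. *)
Definition carried n k (U D : set 'rV[R]_n) (A : nat -> dchain k U) :=
  exists C, [/\ compact C, C `<=` D & forall i, supp (A i) `<=` C].

(* Pushforward by a map F with domain D, D a subset of U, of a chain J in U that is
   carried by a compact part of D: F_* is extended by continuity from the Dirac
   chains in D, so that K = F_* J if F_* A_i converges to K for every sequence of
   Dirac chains A_i, carried by a compact subset of D, that converges to J. The
   first clause (such a sequence exists) makes K unique. *)
Definition is_push n m (G : 'M[R]_n) (G' : 'M[R]_m) r k
    (U D : set 'rV[R]_n) (U' : set 'rV[R]_m) (F : 'rV[R]_n -> 'rV[R]_m)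
    (J : bhat G r k U) (K : bhat G' r k U') :=
  (exists A : nat -> dchain k U, carried D A /\ converges_to A J) /\
  forall A : nat -> dchain k U, carried D A -> converges_to A J ->
    converges_to (fun i => push_dirac U' F (A i)) K.

Definition push n m (G : 'M[R]_n) (G' : 'M[R]_m) r k
    (U D : set 'rV[R]_n) (U' : set 'rV[R]_m) (F : 'rV[R]_n -> 'rV[R]_m)
    (J : bhat G r k U) : bhat G' r k U' :=
  xget 0 [set K | is_push D F J K].

Definition push_defined n m (G : 'M[R]_n) (G' : 'M[R]_m) r k
    (U D : set 'rV[R]_n) (U' : set 'rV[R]_m) (F : 'rV[R]_n -> 'rV[R]_m)
    (J : bhat G r k U) :=
  exists K : bhat G' r k U', is_push D F J K.

Definition Edag_dirac n (G : 'M[R]_n) k (U : set 'rV[R]_n) (v : 'rV[R]_n) :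
    dchain k.+1 U -> dchain k U :=
  lin_ext (fun p (M : 'M[R]_(k.+1, n)) =>
    \sum_(i < k.+1) ((-1) ^+ i * vdot G v (row i M)) *: dpoint U p (wedge (row' i M))).

Definition Edag n (G : 'M[R]_n) r k (U : set 'rV[R]_n) (v : 'rV[R]_n) :
    bhat G r k.+1 U -> bhat G r k U :=
  cont_ext (fun A => cembed (bnorm G r k U) (Edag_dirac G v A)).

(* Products of spaces: R^n1 x R^n2 is the space of rows of length n1 + n2. *)
Definition setprod n1 n2 (U1 : set 'rV[R]_n1) (U2 : set 'rV[R]_n2) : set 'rV[R]_(n1 + n2) :=
  [set z | U1 (lsubmx z) /\ U2 (rsubmx z)].

Definition gram_prod n1 n2 (G1 : 'M[R]_n1) (G2 : 'M[R]_n2) : 'M[R]_(n1 + n2) :=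
  block_mx G1 0 0 G2.

(* The degree m is kept apart from k + l, with which it is not always convertible. *)
Definition cart_dirac n1 n2 k l m (e : (k + l)%N = m)
    (U1 : set 'rV[R]_n1) (U2 : set 'rV[R]_n2)
    (A : dchain k U1) (B : dchain l U2) : dchain m (setprod U1 U2) :=
  lin_ext (fun p (M : 'M[R]_(k, n1)) =>
    lin_ext (fun q (N : 'M[R]_(l, n2)) =>
      dpoint (setprod U1 U2) (row_mx p q)
        (wedge (castmx (e, erefl) (col_mx (row_mx M 0) (row_mx 0 N))))) B) A.

(* Extension by continuity in the second variable and then in the first one. The
   level q of the result is explicit; q = r is possible if K is the chain of an
   interval (s = 1, 0 < r) because A |-> A x K is then bounded in the norm of level r. *)
Definition cart n1 n2 (G1 : 'M[R]_n1) (G2 : 'M[R]_n2) k l m (e : (k + l)%N = m)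
    (r s q : nat) (U1 : set 'rV[R]_n1) (U2 : set 'rV[R]_n2)
    (J : bhat G1 r k U1) (K : bhat G2 s l U2)
  : bhat (gram_prod G1 G2) q m (setprod U1 U2) :=
  cont_ext (fun A : dchain k U1 =>
    cont_ext (fun B : dchain l U2 =>
      cembed (bnorm (gram_prod G1 G2) q m (setprod U1 U2)) (cart_dirac e A B)) K) J.

(* The integrands are Lipschitz functions of t, so that their Lebesgue integral is the
   Riemann integral. *)
Definition interval_chain (a b : R) : bhat (1%:M : 'M[R]_1) 1 1 [set: 'rV[R]_1] :=
  xget 0 [set K | forall eta : kform 1 [set: 'rV[R]_1], bform 1%:M 1 eta ->
    bint K eta = Rintegral lebesgue_measure `[a, b] (fun t => feval eta t%:M 1%:M)].

End Operators.

Section Evolution.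
Context {R : realType} {n : nat}.
Variables (G : 'M[R]_n) (r k : nat) (U : set 'rV[R]_n).
Variables (V : 'rV[R]_n -> 'rV[R]_n) (J : bhat G r k U).

Definition evolving (t : R) : bhat G r k U :=
  push G (flow_dom V U t) U (flow V U t) J.

Definition time (z : 'rV[R]_(n + 1)) : R := rsubmx z 0 0.

Definition theta (z : 'rV[R]_(n + 1)) : 'rV[R]_n := flow V U (time z) (lsubmx z).

(* The points (p, t) of U x [0, t0[ at which V_t (p) is defined. *)
Definition theta_dom (t0 : R) : set 'rV[R]_(n + 1) :=
  [set z | 0 <= time z < t0 /\ flow_dom V U (time z) (lsubmx z)].

Definition e_time : 'rV[R]_(n + 1) := row_mx 0 1%:M.

(* E_(e_(n+1)) (J x (a, b)), a k-chain in U x R. *)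
Definition cylinder (a b : R) : bhat (gram_prod G 1%:M) r k (setprod U [set: 'rV[R]_1]) :=
  Edag e_time (cart (addn1 k) r J (interval_chain a b)).

Definition swept (t0 a b : R) : bhat G r k U :=
  push G (theta_dom t0) U theta (cylinder a b).

(* The pushforwards that occur in J_t and in the swept chain are defined. For 0 < k
   this is a condition on V as well as on J: the derivative of V_t need not have
   bounded differences of order r, and then F_* is not continuous at level r. *)
Definition evolution_defined (t0 : R) :=
  (forall t, 0 <= t < t0 -> push_defined G (flow_dom V U t) U (flow V U t) J) /\
  (forall a b, 0 <= a -> a <= b -> b < t0 ->
     push_defined G (theta_dom t0) U theta (cylinder a b)).

End Evolution.

(* Main.v *)
Require Import Defs.
From HB Require Import structures.
From mathcomp Require Import all_boot all_order all_fingroup all_algebra finmap.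
From mathcomp Require Import all_classical all_reals all_analysis.
From mathcomp Require Import ring lra zify.

Set Implicit Arguments.
Unset Strict Implicit.
Unset Printing Implicit Defensive.

Import Order.TTheory GRing.Theory Num.Theory.
Import numFieldNormedType.Exports.

Local Open Scope classical_set_scope.
Local Open Scope ring_scope.
Local Open Scope quotient_scope.

Local Notation repr := generic_quotient.repr.

(** For a Dirac chain A whose points can follow the flow up to the time b, the theorem is
    the fundamental theorem of calculus for the function t |-> om (V_t* A); the general case
    is a limit of this one.

    The function is a finite sum of terms om (gam t; B Y(t)), where gam is an integral curve,
    the k-vector is the wedge product of the rows of B Y(t), and Y solves the first variation
    equation Y' = Y (DV o gam). Indeed Y(t) is the derivative of V_t at the starting point of
    gam ([flow_smooth]). The coefficients of om are differentiable because its differences of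
    order 2 are bounded: increments are then additive up to second order, and the additive part
    is a dyadic limit, as in the theorem of Hyers ([almost_additive], [coef_differentiable]).
    The product rule for a form paired with a moving k-vector yields the expression of L_V om
    by Cartan's formula ([lie_wedge]), so that the derivative of om (V_t* A) is
    (L_V om) (V_t* A) ([is_derive_push]). As this is continuous in t, om (V_b* A) - om (V_a* A)
    is the limit of Riemann sums of (L_V om) (V_t* A).

    These Riemann sums are, up to the sign (-1)^k, the values of L_V om on the chains that
    theta pushes forward from E (A x P_m), where E contracts the direction of time and P_m is
    the sum of 2^m point masses on the line, of weight (b - a) / 2^m, at the left ends of the
    dyadic subdivision of [a, b] ([push_slice], [form_sweep]). The chains P_m converge to the
    chain of the interval ([riemann_chain_converges]): halving the step moves half of the mass
    by half a step, so that they form a Cauchy sequence in the norm of level 1, and the limit is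
    the right one because forms separate chains, by the theorem of Hahn and Banach
    ([chain_eq_of_bint]). The map A |-> A x P_m is bounded uniformly in m
    ([cart_riemann_bound]). Hence, if A_i converges to J and m_i grows fast enough, then
    E (A_i x P_(m_i)) converges to the chain that the swept chain is the image of
    ([cylinder_converges]).

    The hypothesis that J_b is defined provides such A_i, supported in one compact set C of
    points that flow up to the time b. The chains E (A_i x P_(m_i)) are supported in the compact
    set C x [a, b], in the domain of theta, so that their images converge to the swept chain. If
    m_i is moreover so large that the Riemann sum for A_i is within 1 / (i + 1) of
    om (V_b* A_i) - om (V_a* A_i), then both sides of the theorem are limits of one sequence. *)

(** * Completions of seminormed spaces *)

Lemma cvg0P (R : realType) (u : nat -> R) : (forall i, 0 <= u i) ->
  (u i @[i --> \oo] --> (0 : R)) <->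
  (forall e, 0 < e -> exists m, forall i, (m <= i)%N -> u i < e).
Proof.
move=> u0; split=> [/cvgrPdist_lt uc e e0|H].
  have [m _ Hm] := uc e e0; exists m => i mi.
  by have := Hm i mi; rewrite /= sub0r normrN ger0_norm.
apply/cvgrPdist_lt => e e0; have [m Hm] := H e e0; exists m => // i /= mi.
by rewrite sub0r normrN ger0_norm//; exact: Hm.
Qed.

Lemma real_cauchy_cvg (R : realType) (u : nat -> R) :
  (forall e, 0 < e -> exists m, forall i j, (m <= i)%N -> (m <= j)%N -> `|u i - u j| < e) ->
  cvg (u i @[i --> \oo]).
Proof.
move=> H; apply/cauchy_cvgP/cauchy_exP => e e0; have [m Hm] := H e e0.
by exists (u m), m => // j mj; rewrite /ball/= Hm.
Qed.

Lemma cvgn_ex (R : realType) (u : nat -> R) : cvg (u i @[i --> \oo]) ->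
  exists l : R, u i @[i --> \oo] --> l.
Proof. by move=> /cvg_ex[l ul]; exists l. Qed.

Lemma cvg0_le (R : realType) (u v : nat -> R) : (forall i, 0 <= u i <= v i) ->
  v i @[i --> \oo] --> (0 : R) -> u i @[i --> \oo] --> (0 : R).
Proof.
move=> uv v0; apply: (@squeeze_cvgr _ _ _ _ (cst 0) v) => //; last exact: cvg_cst.
exact: nearW.
Qed.

Lemma cvgn_le (R : realType) (u v : nat -> R) l l' :
  u i @[i --> \oo] --> l -> v i @[i --> \oo] --> l' ->
  (\forall i \near \oo, u i <= v i) -> l <= l'.
Proof. exact: ler_cvg_to. Qed.

Lemma cvgn_cst (R : realType) (l : R) (u : nat -> R) : (forall i, u i = l) ->
  u i @[i --> \oo] --> l.
Proof. by move=> /funext ->; exact: cvg_cst. Qed.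

Lemma snormB_sym (R : realType) (V : lmodType R) (N : seminorm V) x y :
  N (x - y) = N (y - x).
Proof. by rewrite -snormN opprB. Qed.

Lemma snorm_dist (R : realType) (V : lmodType R) (N : seminorm V) x y :
  `|N x - N y| <= N (x - y).
Proof.
rewrite ler_norml; apply/andP; split.
  rewrite lerNl opprB lerBlDr snormB_sym.
  by rewrite -{1}(subrK x y); exact: snorm_triangle.
by rewrite lerBlDr -{1}(subrK y x); exact: snorm_triangle.
Qed.

Lemma snorm_sum (R : realType) (V : lmodType R) (N : seminorm V) (I : Type) (s : seq I) (x : I -> V) :
  N (\sum_(i <- s) x i) <= \sum_(i <- s) N (x i).
Proof.
elim: s => [|i s IH]; first by rewrite !big_nil snorm0.
by rewrite !big_cons; apply: le_trans (snorm_triangle _ _ _) _; rewrite lerD2l.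
Qed.

Section Completion.
Context {R : realType} {V : lmodType R} (N : seminorm V).
Local Notation compl := (completion N).
Definition cpi (s : cauchy_type N) : compl := \pi_(Quotient.quot (null_seq (N := N))) s.

Lemma cpi_reprK (J : compl) : cpi (repr J) = J. Proof. exact: reprK. Qed.

Lemma cpi_eq (s t : cauchy_type N) : s - t \in @null_seq _ _ N -> cpi s = cpi t.
Proof. by move=> st; apply/eqP; rewrite -Quotient.idealrBE. Qed.

Lemma cpi_repr (s : cauchy_type N) :
  (fun i => N (repr (cpi s) i - s i)) i @[i --> \oo] --> (0 : R).
Proof.
have : repr (cpi s) - s \in @null_seq _ _ N by rewrite Quotient.idealrBE reprK.
by move/asboolP.
Qed.

Lemma cpiD (s t : cauchy_type N) : cpi s + cpi t = cpi (s + t) :> compl.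
Proof. by apply: esym; exact: Quotient.pi_add. Qed.

Lemma cpiZ a (s : cauchy_type N) : a *: (cpi s : compl) = cpi (a *: s) :> compl.
Proof.
rewrite -[LHS]/(completion_scale _ _) /completion_scale; apply: cpi_eq.
by rewrite -scalerBr rpredZ// Quotient.idealrBE reprK.
Qed.

Lemma cpiB (s t : cauchy_type N) : cpi s - cpi t = cpi (s - t) :> compl.
Proof. by rewrite -scaleN1r cpiZ cpiD scaleN1r. Qed.

Lemma cauchyP (s : cauchy_type N) e : 0 < e ->
  exists m, forall i j, (m <= i)%N -> (m <= j)%N -> N (s i - s j) < e.
Proof. by case: s => s /= /asboolP; exact. Qed.

Lemma cauchy_norm_cvg (s : cauchy_type N) : cvg (N (s i) @[i --> \oo]).
Proof.
apply: real_cauchy_cvg => e e0.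
have [m Hm] := cauchyP s e0; exists m => i j im jm.
by apply: le_lt_trans (snorm_dist _ _ _) _; exact: Hm.
Qed.

(** Two representatives of a point of the completion have norms with the same limit,
    so that the norm can be read off from any of them. *)
Lemma cnorm_cvg (s : cauchy_type N) : N (s i) @[i --> \oo] --> cnorm (cpi s : compl).
Proof.
have c : N (repr (cpi s) i) @[i --> \oo] --> cnorm (cpi s) by exact: cauchy_norm_cvg.
rewrite -[X in _ --> X]addr0.
have -> : (fun i => N (s i)) = (fun i => N (repr (cpi s) i) + (N (s i) - N (repr (cpi s) i))).
  by apply/funext => i; rewrite addrC subrK.
apply: cvgD => //.
apply/cvgr0Pnorm_lt => e e0.
have [m Hm] := (cvg0P (fun i => snorm_ge0 _ _)).1 (cpi_repr s) _ e0.
exists m => // i /= im; apply: le_lt_trans (snorm_dist _ _ _) _.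
by rewrite snormB_sym; exact: Hm.
Qed.

Lemma cnorm_lim (s : cauchy_type N) l : N (s i) @[i --> \oo] --> l ->
  cnorm (cpi s : compl) = l.
Proof. by move=> sl; apply: (cvg_unique _ (cnorm_cvg (s := s)) sl). Qed.

Lemma cnorm_triangle (J K : compl) : cnorm (J + K) <= cnorm J + cnorm K.
Proof.
rewrite -[J]cpi_reprK -[K]cpi_reprK cpiD; set s := repr J; set t := repr K.
apply: (@cvgn_le _ (fun i => N ((s + t) i)) (fun i => N (s i) + N (t i))).
- exact: cnorm_cvg.
- by apply: cvgD; exact: cnorm_cvg.
- by apply: nearW => i; exact: snorm_triangle.
Qed.

Lemma cnormZ a (J : compl) : cnorm (a *: J) = `|a| * cnorm J.
Proof.
rewrite -[J]cpi_reprK cpiZ; apply: cnorm_lim.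
have -> : (fun i => N ((a *: repr J) i)) = (fun i => `|a| * N (repr J i)).
  by apply/funext => i; rewrite -snormZ.
by apply: cvgM; [exact: cvg_cst|exact: cnorm_cvg].
Qed.

(** The norm of the completion, itself packed as a seminorm: the generic facts about
    seminorms then apply to it. *)
Definition cseminorm : seminorm compl := Seminorm cnorm_triangle cnormZ.

Lemma cnorm_ge0 (J : compl) : 0 <= cnorm J.
Proof. exact: (snorm_ge0 cseminorm). Qed.

Lemma cnormN (J : compl) : cnorm (- J) = cnorm J.
Proof. exact: (snormN cseminorm). Qed.

Lemma cnormB_sym (J K : compl) : cnorm (J - K) = cnorm (K - J).
Proof. exact: (snormB_sym cseminorm). Qed.

Lemma cnorm_eq0 (J : compl) : cnorm J = 0 -> J = 0.
Proof.
move=> J0; rewrite -[J]cpi_reprK -[RHS](subrr (cpi 0 : compl)) cpiB subrr.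
apply: cpi_eq; rewrite subr0; apply/asboolP.
by rewrite -J0 -{2}[J]cpi_reprK; exact: cnorm_cvg.
Qed.

Lemma cnorm_le0 (J K : compl) : (forall e, 0 < e -> cnorm (J - K) <= e) -> J = K.
Proof.
move=> H; apply/eqP; rewrite -subr_eq0; apply/eqP; apply: cnorm_eq0.
apply/eqP; rewrite eq_le cnorm_ge0 andbT; apply/ler_addgt0Pl => e e0.
by rewrite addr0; exact: H.
Qed.

Lemma cembedD x y : cembed N (x + y) = cembed N x + cembed N y.
Proof. by rewrite /cembed cpiD; congr (cpi _); apply/val_inj. Qed.

Lemma cembedZ a x : cembed N (a *: x) = a *: cembed N x.
Proof. by rewrite /cembed cpiZ; congr (cpi _); apply/val_inj. Qed.

Lemma cembedB x y : cembed N (x - y) = cembed N x - cembed N y.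
Proof. by rewrite cembedD -scaleN1r cembedZ scaleN1r. Qed.

Lemma cnorm_cembed x : cnorm (cembed N x) = N x.
Proof. by apply: (cnorm_lim (s := Cauchy (cst_cauchy N x))); exact: cvgn_cst. Qed.

Lemma converges_repr (J : compl) : converges_to (repr J) J.
Proof.
apply/cvg0P => [i|e e0]; first exact: cnorm_ge0.
have [m Hm] := cauchyP (repr J) (divr_gt0 e0 (ltr0Sn _ 1)).
exists m => i mi; apply: (@le_lt_trans _ _ (e / 2)); last first.
  by lra.
rewrite -{2}[J]cpi_reprK /cembed cpiB.
apply: (@cvgn_le _ (fun j => N ((Cauchy (cst_cauchy N (repr J i)) - repr J) j))
   (cst (e / 2))).
- exact: cnorm_cvg.
- exact: cvgn_cst.
- by exists m => // j mj; apply: ltW; exact: Hm.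
Qed.

Lemma converges_dist A (J : compl) : converges_to A J ->
  forall e, 0 < e -> exists m, forall i, (m <= i)%N -> cnorm (cembed N (A i) - J) < e.
Proof. by move=> /cvg0P; apply => i; exact: cnorm_ge0. Qed.

Lemma cnormB_le (J K L : compl) : cnorm (J - K) <= cnorm (J - L) + cnorm (L - K).
Proof.
by rewrite -{1}(subrK L J) -addrA; exact: cnorm_triangle.
Qed.

Lemma converges_cauchy A (J : compl) : converges_to A J ->
  forall e, 0 < e -> exists m, forall i j, (m <= i)%N -> (m <= j)%N -> N (A i - A j) < e.
Proof.
move=> AJ e e0; have [m H] := converges_dist AJ (divr_gt0 e0 (ltr0Sn _ 1)).
exists m => i j im jm; rewrite -cnorm_cembed cembedB.
apply: le_lt_trans (cnormB_le _ _ J) _; rewrite (splitr e).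
by apply: ltrD; [exact: H|rewrite cnormB_sym; exact: H].
Qed.

Lemma cauchy_converges A :
  (forall e, 0 < e -> exists m, forall i j, (m <= i)%N -> (m <= j)%N -> N (A i - A j) < e) ->
  exists J : compl, converges_to A J.
Proof.
move=> Ac; have Ac' : A \in @cauchy_seq _ _ N by apply/asboolP.
pose s := Cauchy Ac'; exists (cpi s).
have r0 := converges_repr (cpi s); have rs := cpi_repr s.
apply: cvg0_le (_ : (fun i => N (repr (cpi s) i - s i)
                     + cnorm (cembed N (repr (cpi s) i) - cpi s)) i @[i --> \oo] --> (0 : R)).
  move=> i; rewrite cnorm_ge0/= -cnorm_cembed cembedB [X in _ <= X + _]cnormB_sym.
  exact: cnormB_le.
by rewrite -[X in _ --> X]addr0; apply: cvgD.
Qed.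

(** A Cauchy sequence in the completion is shadowed by a sequence of the space itself. *)
Lemma completion_complete (K : nat -> compl) :
  (forall e, 0 < e -> exists m, forall i j, (m <= i)%N -> (m <= j)%N -> cnorm (K i - K j) < e) ->
  exists L : compl, (fun i => cnorm (K i - L)) i @[i --> \oo] --> (0 : R).
Proof.
move=> Kc.
have /choice[A HA] i : exists a, cnorm (cembed N a - K i) < i.+1%:R^-1.
  have i0 : 0 < (i.+1%:R^-1 : R) by rewrite invr_gt0.
  have [m H] := converges_dist (converges_repr (K i)) i0.
  by exists (repr (K i) m); exact: H.
have A0 : (fun i => cnorm (cembed N (A i) - K i)) i @[i --> \oo] --> (0 : R).
  apply: cvg0_le (@cvg_harmonic R) => i; rewrite cnorm_ge0/=.
  exact: ltW (HA i).
have [|L AL] := @cauchy_converges A.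
  move=> e e0; have e3 : 0 < e / 3 by rewrite divr_gt0.
  have [m1 H1] := Kc _ e3.
  have [m2 H2] := (cvg0P (fun i => cnorm_ge0 _)).1 A0 _ e3.
  exists (maxn m1 m2) => i j; rewrite !geq_max => /andP[i1 i2] /andP[j1 j2].
  rewrite -cnorm_cembed cembedB; apply: le_lt_trans (cnormB_le _ _ (K i)) _.
  have -> : e = e / 3 + (e / 3 + e / 3) by field.
  apply: ltrD; first exact: H2.
  apply: le_lt_trans (cnormB_le _ _ (K j)) _.
  by apply: ltrD; [exact: H1|rewrite cnormB_sym; exact: H2].
exists L; apply: cvg0_le (_ : (fun i => cnorm (cembed N (A i) - K i)
                     + cnorm (cembed N (A i) - L)) i @[i --> \oo] --> (0 : R)).
  by move=> i; rewrite cnorm_ge0/= [X in _ <= X + _]cnormB_sym; exact: cnormB_le.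
by rewrite -[X in _ --> X]addr0; apply: cvgD.
Qed.

End Completion.

Section BoundedExtension.
Context {R : realType} {V V' : lmodType R} (N : seminorm V) (N' : seminorm V').

Section Operator.
Variables (T : V -> completion N') (C : R).
Hypothesis TB : forall x y, T (x - y) = T x - T y.
Hypothesis Tbd : forall x, cnorm (T x) <= C * N x.

(* The estimates divide by the constant, while C may be 0 or negative. *)
Let C' := Num.max C 1.
Let C'0 : 0 < C'. Proof. by rewrite lt_max ltr01 orbT. Qed.
Let Tbd' x : cnorm (T x) <= C' * N x.
Proof. by apply: le_trans (Tbd x) _; rewrite ler_wpM2r ?snorm_ge0// le_max lexx. Qed.

(** Boundedness makes T (A i) a Cauchy sequence whose limit is the same for all the
    sequences that converge to J, so that the choice in the definition of the extension
    succeeds. *)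
Lemma cont_extP (J : completion N) A : converges_to A J ->
  (fun i => cnorm (T (A i) - cont_ext T J)) i @[i --> \oo] --> (0 : R).
Proof.
suff [L HL] : exists L, forall A, converges_to A J ->
    (fun i => cnorm (T (A i) - L)) i @[i --> \oo] --> (0 : R).
  by move=> AJ; rewrite /cont_ext; apply: (xgetPex 0 (P := [set K | forall A, converges_to A J ->
      cnorm (T (A i) - K) @[i --> \oo] --> (0 : R)])) AJ; exists L.
have rJ := converges_repr J.
have [|L HL] := @completion_complete _ _ N' (fun i => T (repr J i)).
  move=> e e0; have [m H] := converges_cauchy rJ (divr_gt0 e0 C'0).
  exists m => i j im jm; rewrite -TB; apply: le_lt_trans (Tbd' _) _.
  by rewrite mulrC -ltr_pdivlMr// H.
exists L => {}A AJ.
apply: cvg0_le (_ : (fun i => C' * (cnorm (cembed N (A i) - J)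
   + cnorm (cembed N (repr J i) - J)) + cnorm (T (repr J i) - L)) i @[i --> \oo] --> (0 : R)).
  move=> i; rewrite cnorm_ge0/=; apply: le_trans (cnormB_le _ _ (T (repr J i))) _.
  rewrite lerD2r -TB; apply: le_trans (Tbd' _) _; rewrite ler_pM2l//.
  rewrite -cnorm_cembed cembedB [X in _ <= _ + X]cnormB_sym.
  exact: cnormB_le.
rewrite -[X in _ --> X]addr0 -[X in _ --> X + _](mulr0 C').
apply: cvgD => //; apply: cvgM; first exact: cvg_cst.
by rewrite -[X in _ --> X]addr0; apply: cvgD.
Qed.

End Operator.

(** The analogue for functionals, whose values lie in a space that is complete already. *)
Lemma bounded_functional_limit (f : V -> R) C (J : completion N) :
  (forall x y, f (x - y) = f x - f y) -> (forall x, `|f x| <= C * N x) ->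
  exists l : R, forall A, converges_to A J -> f (A i) @[i --> \oo] --> l.
Proof.
move=> fB fC; pose C' := Num.max C 1.
have C'0 : 0 < C' by rewrite lt_max ltr01 orbT.
have fC' x : `|f x| <= C' * N x.
  by apply: le_trans (fC x) _; rewrite ler_wpM2r ?snorm_ge0// le_max lexx.
have rJ := converges_repr J.
have [l c] : exists l : R, f (repr J i) @[i --> \oo] --> l.
  apply: cvgn_ex; apply: real_cauchy_cvg => e e0.
  have [m H] := converges_cauchy rJ (divr_gt0 e0 C'0).
  exists m => i j im jm; rewrite -fB.
  apply: le_lt_trans (fC' _) _.
  by rewrite mulrC -ltr_pdivlMr// H.
exists l => A AJ.
rewrite -[X in _ --> X]addr0.
have -> : (fun i => f (A i)) = (fun i => f (repr J i) + (f (A i) - f (repr J i))).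
  by apply/funext => i; rewrite addrC subrK.
apply: cvgD => //; apply: norm_cvg0.
apply: cvg0_le (_ : (fun i => C' * (cnorm (cembed N (A i) - J)
   + cnorm (cembed N (repr J i) - J))) i @[i --> \oo] --> (0 : R)).
  move=> i; rewrite normr_ge0/= -fB; apply: le_trans (fC' _) _; rewrite ler_pM2l//.
  rewrite -cnorm_cembed cembedB [X in _ <= _ + X]cnormB_sym.
  exact: cnormB_le.
rewrite -(mulr0 C'); apply: cvgM; first exact: cvg_cst.
by rewrite -[X in _ --> X]addr0; apply: cvgD.
Qed.

End BoundedExtension.

(** * The theorem of Hahn and Banach *)

Section HahnBanach.
Context {R : realType} {V : lmodType R} (p : seminorm V).
Local Notation graph := (set (V * R^o)).

(** A functional on a subspace is represented by its graph, so that Zorn's lemma can be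
    applied to inclusion. *)
Definition dominated_graph (S : graph) :=
  (forall a s t, S s -> S t -> S (a *: s + t)) /\ (forall s, S s -> s.2 <= p s.1).

Lemma dominated_graphZ (S : graph) s a : dominated_graph S -> S s -> S (a *: s).
Proof.
move=> [Sl _] Ss; have S0 : S 0.
  by have -> : 0 = -1 *: s + s; [rewrite scaleN1r addrC subrr|exact: Sl].
by rewrite -[_ *: s]addr0; exact: Sl.
Qed.

(** The difference of two values at x is a value at 0, and therefore at most p 0 = 0. *)
Lemma dominated_graph_fun (S : graph) x c c' : dominated_graph S ->
  S (x, c) -> S (x, c') -> c = c'.
Proof.
move=> SD; have [Sl Sp] := SD.
have le d d' : S (x, d) -> S (x, d') -> d <= d'.
  move=> Sd Sd'; have := Sp _ (Sl (-1) _ _ Sd' Sd).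
  by rewrite /= !scaleN1r [X in p X]addrC subrr snorm0 addrC subr_le0.
by move=> Sc Sc'; apply/eqP; rewrite eq_le !le.
Qed.

(** The value at a new vector may be any number between the suprema and the infima
    that the domination imposes. *)
Lemma dominated_graph_extend (S : graph) x : dominated_graph S -> S !=set0 ->
  exists c, dominated_graph [set u : V * R^o | exists s t, S s /\ u = s + t *: (x, c : R^o)].
Proof.
move=> SD [s0 Ss0]; have [Sl Sp] := SD.
pose E := [set z | exists2 s, S s & z = s.2 - p (s.1 - x)].
have Eub s : S s -> ubound E (p (s.1 + x) - s.2).
  move=> Ss _ [s' Ss' ->]; rewrite lerBrDr addrAC lerBlDr.
  have := Sp _ (Sl 1 _ _ Ss' Ss); rewrite !scale1r => /le_trans; apply.
  apply: le_trans (snorm_triangle p _ _).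
  by rewrite (_ : _ + _ + (_ - _) = s'.1 + s.1)// [RHS]addrC addrACA subrr addr0 addrC.
have E0 : E !=set0 by exists (s0.2 - p (s0.1 - x)), s0.
have Esup : has_sup E by split=> //; exists (p (s0.1 + x) - s0.2); exact: Eub.
pose c := sup E; exists c; split.
  move=> a _ _ [s [t [Ss ->]]] [s' [t' [Ss' ->]]].
  exists (a *: s + s'), (a * t + t'); split; first exact: Sl.
  by rewrite scalerDr scalerDl scalerA addrACA.
move=> _ [s [t [Ss ->]]] /=.
have lo s' : S s' -> s'.2 - c <= p (s'.1 - x).
  by move=> Ss'; rewrite lerBlDr addrC -lerBlDr; apply: ub_le_sup; [case: Esup|exists s'].
have hi s' : S s' -> s'.2 + c <= p (s'.1 + x).
  by move=> Ss'; rewrite addrC -lerBrDr; apply: ge_sup => //; exact: Eub.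
have [t0|t0|->] := ltgtP t 0; last by rewrite !scale0r !addr0; exact: Sp.
- have := lo _ (dominated_graphZ (- t)^-1 SD Ss); rewrite /= => H.
  have t0' : 0 < - t by rewrite oppr_gt0.
  have e y : p y = (- t)^-1 * p (- t *: y).
    by rewrite snormZ ger0_norm ?ltW// mulrA mulVf ?gt_eqF// mul1r.
  rewrite e scalerBr scalerA divff ?gt_eqF// scale1r scaleNr opprK in H.
  move: H; rewrite -(ler_pM2l t0') mulrA divff ?gt_eqF// mul1r ; apply: le_trans.
  by rewrite /GRing.scale/= mulrBr mulrA divff ?gt_eqF// mul1r mulNr opprK.
- have := hi _ (dominated_graphZ t^-1 SD Ss); rewrite /= => H.
  have e y : p y = t^-1 * p (t *: y).
    by rewrite snormZ ger0_norm ?ltW// mulrA mulVf ?gt_eqF// mul1r.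
  rewrite e scalerDr scalerA divff ?gt_eqF// scale1r in H.
  move: H; rewrite -(ler_pM2l t0) mulrA divff ?gt_eqF// mul1r; apply: le_trans.
  by rewrite /GRing.scale/= mulrDr mulrA divff ?gt_eqF// mul1r.
Qed.

(** Hahn-Banach: a maximal dominated graph that contains the line spanned by [x0] is
    the graph of a functional on the whole space. *)
Lemma hahn_banach_norming (x0 : V) :
  exists f : {linear V -> R^o}, f x0 = p x0 /\ forall x, `|f x| <= p x.
Proof.
pose S0 : graph := [set u | exists a, u = a *: (x0, p x0 : R^o)].
have S0D : dominated_graph S0.
  split=> [a _ _ [b ->] [b' ->]|_ [a ->]].
    by exists (a * b + b'); rewrite scalerDl scalerA.
  by rewrite /= snormZ ler_wpM2r ?snorm_ge0// ler_norm.
(* The empty graph is admitted because it is the union of the empty family. *)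
pose P (S : graph) := dominated_graph S /\ (S0 `<=` S \/ S = set0).
have [F FP Ftot|A [[AD AS] Amax]] := @Zorn_bigcup _ P.
  split; last first.
    have [[X FX]|FN] := pselect (exists2 X, F X & S0 `<=` X).
      by move=> XS; left=> u /XS uX; exists X.
    right; rewrite -subset0 => u [X FX Xu]; have [_ [SX|X0]] := FP _ FX.
      by apply: FN; exists X.
    by rewrite X0 in Xu.
  split=> [a s t [X FX Xs] [Y FY Yt]|s [X FX Xs]]; last by have [[_ H] _] := FP _ FX; exact: H.
  have [XY|YX] := Ftot _ _ FX FY.
    by exists Y => //; have [[H _] _] := FP _ FY; apply: H => //; exact: XY.
  by exists X => //; have [[H _] _] := FP _ FX; apply: H => //; exact: YX.
have S00 : S0 0 by exists 0; rewrite scale0r.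
have {}AS : S0 `<=` A.
  case: AS => // A0; exfalso; apply: (Amax S0); last by split=> //; left.
  by rewrite A0; split=> [|/(_ _ S00)]; [exact: sub0set|].
have Atot x : exists c : R^o, A (x, c).
  apply: contrapT => Ax; have [c cD] := dominated_graph_extend x AD (ex_intro _ 0 (AS _ S00)).
  apply: (Amax _ _ (conj cD _)); last first.
    by left=> u /AS uA; exists u, 0; rewrite scale0r addr0.
  split; first by move=> u uA; exists u, 0; rewrite scale0r addr0.
  move=> /(_ (x, c)) H; apply: Ax; exists c; apply: H.
  by exists 0, 1; rewrite scale1r add0r; split=> //; exact: AS.
have /choice[f fA] := Atot.
have f_lin : linear f.
  move=> a x y; apply: (dominated_graph_fun AD (fA _)).
  by have [Al _] := AD; exact: (Al a _ _ (fA x) (fA y)).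
pose fl := GRing.isLinear.Build R V R^o *:%R f f_lin.
pose g : {linear V -> R^o} := HB.pack f fl.
have [Al Ap] := AD.
exists g; split=> [|x].
  by apply: (dominated_graph_fun AD (fA x0)); apply: AS; exists 1; rewrite scale1r.
rewrite ler_norml; apply/andP; split; last exact: (Ap _ (fA x)).
rewrite lerNl -(snormN p x) -[X in X <= _]/(- g x) -linearN.
exact: (Ap _ (fA (- x))).
Qed.

End HahnBanach.

(** * Alternating maps and k-vectors *)

Section Alternating.
Context {R : realType}.

Lemma linear0_of (V W : lmodType R) (f : V -> W) : linear f -> f 0 = 0.
Proof. by move=> fl; have := fl (-1) 0 0; rewrite scaler0 addr0 scaleN1r addNr. Qed.

Lemma linearZ_of (V W : lmodType R) (f : V -> W) a x : linear f -> f (a *: x) = a *: f x.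
Proof. by move=> fl; rewrite -[a *: x]addr0 fl linear0_of// addr0. Qed.

Lemma linearD_of (V W : lmodType R) (f : V -> W) x y : linear f -> f (x + y) = f x + f y.
Proof. by move=> fl; rewrite -{1}[x]scale1r fl scale1r. Qed.

Lemma linearB_of (V W : lmodType R) (f : V -> W) x y : linear f -> f (x - y) = f x - f y.
Proof. by move=> fl; rewrite addrC -scaleN1r fl scaleN1r addrC. Qed.

Lemma linear_sum_of (V W : lmodType R) (f : V -> W) (T : Type) (s : seq T) (x : T -> V) :
  linear f -> f (\sum_(t <- s) x t) = \sum_(t <- s) f (x t).
Proof.
move=> fl; elim: s => [|t s IH]; first by rewrite !big_nil linear0_of.
by rewrite !big_cons linearD_of// IH.
Qed.

Definition setrow k n (M : 'M[R]_(k, n)) i (x : 'rV[R]_n) : 'M[R]_(k, n) :=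
  \matrix_(a, b) if a == i then x 0 b else M a b.

Definition alternating k n (W : lmodType R) (phi : 'M[R]_(k, n) -> W) :=
  (forall M i a x y, phi (setrow M i (a *: x + y)) =
     a *: phi (setrow M i x) + phi (setrow M i y)) /\
  (forall (M : 'M[R]_(k, n)) i j, i != j -> row i M = row j M -> phi M = 0).

Lemma row_setrow k n (M : 'M[R]_(k, n)) i x j :
  row j (setrow M i x) = if j == i then x else row j M.
Proof. by apply/rowP => b; rewrite !mxE; case: eqP => // _; rewrite mxE. Qed.

Lemma setrow_row k n (M : 'M[R]_(k, n)) i : setrow M i (row i M) = M.
Proof. by apply/row_matrixP => j; rewrite row_setrow; case: eqP => // ->. Qed.

Lemma row'_setrow k n (M : 'M[R]_(k, n)) i x : row' i (setrow M i x) = row' i M.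
Proof. by apply/matrixP => a b; rewrite !mxE eq_sym (negbTE (neq_lift _ _)). Qed.

Lemma multi_lt k n (I : multi k n) (i j : 'I_k) : (i < j)%N -> (val I i < val I j)%N.
Proof. by move=> ij; have /forallP/(_ i)/forallP/(_ j)/implyP := valP I; exact. Qed.

Lemma multi_inj k n (I : multi k n) : injective (val I).
Proof.
move=> i j Iij; apply/val_inj; have [ij|ji|//] := ltngtP i j.
  by have := multi_lt I ij; rewrite Iij ltnn.
by have := multi_lt I ji; rewrite Iij ltnn.
Qed.

Lemma increasing_id k (g : 'I_k -> 'I_k) :
  (forall i j : 'I_k, (i < j)%N -> (g i < g j)%N) -> forall i, g i = i.
Proof.
move=> gI; have ge m : forall i : 'I_k, val i = m -> (m <= g i)%N.
  elim: m => // m IH i /= im; have mk : (m < k)%N by have := ltn_ord i; lia.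
  by apply: leq_ltn_trans (IH (Ordinal mk) erefl) _; apply: gI; rewrite /= im.
have le m : forall i : 'I_k, (k - i = m.+1)%N -> (g i <= i)%N.
  elim: m => [|m IH] i im.
    have := ltn_ord (g i); have := ltn_ord i; lia.
  have ik : (i.+1 < k)%N by lia.
  have := gI i (Ordinal ik) (ltnSn _); have /= := IH (Ordinal ik); lia.
move=> i; apply/val_inj/eqP; rewrite eqn_leq ge// andbT.
by apply: (le (k - i).-1); have := ltn_ord i; lia.
Qed.

Lemma multi_sub_eq k n (I J : multi k n) :
  (forall i, exists j, val I i = val J j) -> I = J.
Proof.
move=> /choice[g Ig]; apply/val_inj/ffunP => i.
rewrite Ig; congr (_ _); apply: increasing_id => a b ab.
have := multi_lt I ab; rewrite !Ig; have [//|ba|/val_inj gab] := ltngtP (g a) (g b).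
  by have := multi_lt J ba; lia.
by rewrite gab ltnn.
Qed.

(** If J is not I, then some I i is not among the J j, and the minor has a zero row. *)
Lemma wedge_basis k n (I : multi k n) :
  wedge (basis_rows I) = [ffun J => (J == I)%:R] :> kvec R k n.
Proof.
apply/ffunP => J; rewrite !ffunE; have [->|JI] := eqVneq J I.
  rewrite (_ : colsub _ _ = 1%:M) ?det1//; apply/matrixP => i j; rewrite !mxE.
  by rewrite (inj_eq (@multi_inj _ _ I)).
have [i Hi] : exists i, forall j, val I i != val J j.
  apply: contrapT => H; move/eqP: JI; apply; apply/esym/multi_sub_eq => i.
  apply: contrapT => Hj; apply: H; exists i => j; apply/eqP => Iij.
  by apply: Hj; exists j.
rewrite (expand_det_row _ i) big1// => j _.
by rewrite !mxE (negbTE (Hi j)) mul0r.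
Qed.

Lemma kvec_basis k n (al : kvec R k n) :
  al = \sum_(I : multi k n) (al I : R) *: (wedge (basis_rows I) : kvec R k n).
Proof.
apply/ffunP => J; rewrite sum_ffunE (bigD1 J)//= big1 ?addr0 => [|I IJ].
  by rewrite ffunE wedge_basis ffunE eqxx scaler1 // /GRing.scale/= mulr1.
by rewrite ffunE wedge_basis ffunE eq_sym (negbTE IJ) scaler0.
Qed.

Lemma klin_basis k n (W : lmodType R) (phi : 'M[R]_(k, n) -> W) (I : multi k n) :
  klin phi (wedge (basis_rows I)) = phi (basis_rows I).
Proof.
rewrite /klin (bigD1 I)//= big1 ?addr0 => [|J JI].
  by rewrite wedge_basis ffunE eqxx scale1r.
by rewrite wedge_basis ffunE (negbTE JI) scale0r.
Qed.

Lemma det_setrow_linear k (M : 'M[R]_k) i a x y :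
  \det (setrow M i (a *: x + y)) = a * \det (setrow M i x) + \det (setrow M i y).
Proof.
rewrite (@determinant_multilinear _ _ _ (setrow M i x) (setrow M i y) i a 1) ?mul1r//;
  rewrite ?row'_setrow// !row_setrow eqxx.
by rewrite scale1r.
Qed.

Lemma colsub_setrow k n m (f : 'I_m -> 'I_n) (M : 'M[R]_(k, n)) i x :
  colsub f (setrow M i x) = setrow (colsub f M) i (colsub f x).
Proof. by apply/matrixP => a b; rewrite !mxE. Qed.

Lemma det_alternating k : alternating (fun M : 'M[R]_k => \det M : R^o).
Proof.
split=> [M i a x y|M i j ij Mij]; first exact: det_setrow_linear.
by apply: (determinant_alternate ij) => b; move/rowP/(_ b): Mij; rewrite !mxE.
Qed.

Lemma alternating_colsub k n m (W : lmodType R) (f : 'I_m -> 'I_n)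
    (phi : 'M[R]_(k, m) -> W) : alternating phi ->
  alternating (fun M : 'M[R]_(k, n) => phi (colsub f M)).
Proof.
move=> [pl pa]; split=> [M i a x y|M i j ij Mij].
  by rewrite !colsub_setrow -pl; congr (phi (setrow _ _ _)); apply/rowP => b; rewrite !mxE.
by apply: (pa _ i j ij); apply/rowP => b; move/rowP/(_ (f b)): Mij; rewrite !mxE.
Qed.

Lemma alternating_linear k n (W W' : lmodType R) (f : W -> W') (phi : 'M[R]_(k, n) -> W) :
  linear f -> alternating phi -> alternating (fun M => f (phi M)).
Proof.
move=> fl [pl pa]; split=> [M i a x y|M i j ij Mij]; first by rewrite pl fl.
by rewrite (pa _ _ _ ij Mij) linear0_of.
Qed.

Lemma alternating_sum k n (W : lmodType R) (T : Type) (s : seq T) (P : pred T)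
    (phi : T -> 'M[R]_(k, n) -> W) : (forall t, alternating (phi t)) ->
  alternating (fun M => \sum_(t <- s | P t) phi t M).
Proof.
move=> pa; split=> [M i a x y|M i j ij Mij].
  rewrite scaler_sumr -big_split/=; apply: eq_bigr => t _.
  by have [pl _] := pa t; rewrite pl.
by apply: big1 => t _; have [_ H] := pa t; exact: (H _ _ _ ij Mij).
Qed.

Lemma alternating_wedge k n : alternating (@wedge R k n).
Proof.
split=> [M i a x y|M i j ij Mij]; apply/ffunP => J; rewrite !ffunE.
  by have [H _] := alternating_colsub (val J) (@det_alternating k); rewrite H.
by have [_ H] := alternating_colsub (val J) (@det_alternating k); rewrite (H _ _ _ ij Mij).
Qed.

Lemma alternating_col_mx k n (W : lmodType R) (v : 'rV[R]_n)
    (phi : 'M[R]_(1 + k, n) -> W) : alternating phi ->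
  alternating (fun M : 'M[R]_(k, n) => phi (col_mx v M)).
Proof.
move=> [pl pa]; have cs (M : 'M[R]_(k, n)) i x :
    col_mx v (setrow M i x) = setrow (col_mx v M) (rshift 1 i) x.
  apply/matrixP => a b; rewrite !mxE; case: splitP => j aj; rewrite ?mxE.
    by rewrite -val_eqE/= aj; case: eqP => // ji; have := ltn_ord j; lia.
  by rewrite -!val_eqE/= aj eqn_add2l.
split=> [M i a x y|M i j ij Mij]; first by rewrite !cs.
apply: (pa _ (rshift 1 i) (rshift 1 j)); first by rewrite (inj_eq (@rshift_inj _ _)).
by rewrite !rowKd.
Qed.

(** The alternating sum over the rows that defines the exterior derivative is, for
    each pair of coordinates, a determinant with one more column. *)
Lemma alternating_insert k n (j : 'I_n) (J : multi k n) :
  alternating (fun N : 'M[R]_(k.+1, n) =>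
    \sum_(i < k.+1) (-1) ^+ i * N i j * (wedge (row' i N) J : R) : R^o).
Proof.
pose f (a : 'I_k.+1) := if unlift ord0 a is Some b then val J b else j.
have -> : (fun N : 'M[R]_(k.+1, n) =>
    \sum_(i < k.+1) (-1) ^+ i * N i j * (wedge (row' i N) J : R) : R^o)
  = (fun N => \det (colsub f N) : R^o).
  apply/funext => N; rewrite (expand_det_col _ ord0); apply: eq_bigr => i _.
  rewrite /cofactor addn0 mulrCA mulrA !mxE/= {1}/f unlift_none ffunE.
  congr (_ * \det _); apply/matrixP => a b; rewrite !mxE; congr (N _ _).
  by rewrite /f liftK.
exact: alternating_colsub (@det_alternating _).
Qed.

(** Moving the row i to the top takes i transpositions. *)
Lemma wedge_setrow k n (M : 'M[R]_(k.+1, n)) i (x : 'rV[R]_n) :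
  wedge (col_mx x (row' i M) : 'M[R]_(1 + k, n)) = (-1) ^+ i *: wedge (setrow M i x)
  :> kvec R k.+1 n.
Proof.
apply/ffunP => J; rewrite !ffunE /= (expand_det_row _ ord0) (expand_det_row _ i).
rewrite scaler_sumr; apply: eq_bigr => j _; rewrite /cofactor !mxE eqxx /GRing.scale/=.
case: splitP => [a _|a]; last by move=> /eqP; rewrite /= eq_sym; have := ltn_ord a; lia.
rewrite (ord1 a) [RHS]mulrCA; congr (_ * _).
rewrite [in RHS]exprD -[in RHS]mulrA [RHS]mulrA -expr2 sqrr_sign mul1r add0n.
congr (_ * \det _); apply/matrixP => c d; rewrite !mxE.
rewrite (negbTE (_ : lift i c != i)) 1?eq_sym ?neq_lift//.
case: splitP => [e|e]; first by rewrite /= /bump/=; have := ltn_ord e; lia.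
rewrite /= /bump/= !add1n => -[/ord_inj ->]; by rewrite mxE.
Qed.

Section Expansion.
Context {k n : nat} {W : lmodType R} (phi : 'M[R]_(k, n) -> W).
Hypothesis phiA : alternating phi.

Let phil := proj1 phiA.

(** Expand phi at the matrix whose rows i and j are both the sum of these two rows. *)
Lemma alternating_swap M (i j : 'I_k) : i != j -> phi M = 0 -> phi (xrow i j M) = 0.
Proof.
move=> ij M0; have [_ pa] := phiA.
have phiD N a x y : phi (setrow N a (x + y)) = phi (setrow N a x) + phi (setrow N a y).
  by rewrite -[x]scale1r phil !scale1r.
pose S x y := setrow (setrow M i x) j y.
have SS x : phi (S x x) = 0.
  by apply: (pa _ i j ij); rewrite !row_setrow !eqxx (negbTE ij).
have SC x y : S x y = setrow (setrow M j y) i x.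
  apply/row_matrixP => a; rewrite !row_setrow.
  by have [->|//] := eqVneq a j; rewrite eq_sym (negbTE ij).
have SD x x' y : phi (S (x + x') y) = phi (S x y) + phi (S x' y).
  by rewrite !SC phiD.
have := SS (row i M + row j M); rewrite SD /S !phiD -/(S _ _) -/(S _ _) -/(S _ _) -/(S _ _).
rewrite !SS add0r addr0.
have -> : S (row i M) (row j M) = M.
  by rewrite /S setrow_row setrow_row.
rewrite M0 add0r => <-; congr phi; apply/row_matrixP => a.
rewrite !row_setrow; apply/rowP => b; rewrite !mxE.
have [->|aj] := eqVneq a j; first by rewrite tpermR mxE.
have [->|ai] := eqVneq a i; first by rewrite tpermL mxE.
by rewrite tpermD ?mxE// eq_sym.
Qed.

Lemma alternating_perm M (s : 'S_k) : phi M = 0 -> phi (row_perm s M) = 0.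
Proof.
move=> M0; have [ts -> tsP] := prod_tpermP s.
elim: ts tsP => [|t ts IH] /=; first by rewrite big_nil row_perm1.
move=> /andP[t12 tsP]; rewrite big_cons row_permM.
by apply: alternating_swap => //; exact: IH.
Qed.

Lemma sort_injective (f : 'I_k -> 'I_n) : injective f ->
  exists (s : 'S_k) (I : multi k n), forall i, f (s i) = val I i.
Proof.
move=> fI; pose t : k.-tuple 'I_n := [tuple f i | i < k].
pose le := (fun a b : 'I_n => (a <= b)%N).
have /tuple_permP[s ts] : perm_eq (sort le t) t by rewrite perm_sort.
have lts i : nth (f i) (sort le t) i = f (s i).
  by rewrite ts -tnth_nth tnth_mktuple tnth_mktuple.
have us : uniq (sort le t) by rewrite sort_uniq; apply/tuple_uniqP => i j; rewrite !tnth_mktuple; exact: fI.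
have ss : sorted le (sort le t) by apply: sort_sorted => a b; exact: leq_total.
have szs : size (sort le t) = k by rewrite size_sort size_tuple.
pose F := [ffun i => f (s i)].
have FP : [forall i : 'I_k, forall j : 'I_k, (i < j)%N ==> (F i < F j)%N].
  apply/forallP => i; apply/forallP => j; apply/implyP => ij; rewrite !ffunE -!lts.
  rewrite (set_nth_default (f i) (f j)) ?szs//.
  have le_tr : transitive le by move=> a b c; exact: leq_trans.
  have := sorted_leq_nth le_tr (fun a => leqnn _) (f i) ss.
  move=> /(_ i j); rewrite !inE szs !ltn_ord => /(_ isT isT (ltnW ij)).
  rewrite /le leq_eqVlt => /orP[/eqP/val_inj /eqP|//].
  by rewrite nth_uniq ?szs// => /eqP ij'; rewrite ij' ltnn in ij.
by exists s, (Sub F FP) => i; rewrite SubK ffunE.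
Qed.

(** By multilinearity the values at matrices of basis vectors determine phi; these vectors
    either have a repetition or can be sorted into increasing order. *)
Lemma alternating_eq0 : (forall I, phi (basis_rows I) = 0) -> forall M, phi M = 0.
Proof.
move=> phi0; pose E (f : 'I_k -> 'I_n) : 'M[R]_(k, n) := \matrix_(i, j) (f i == j)%:R.
have E0 f : phi (E f) = 0.
  have [fI|] := pselect (injective f).
    have [s [I sI]] := sort_injective fI.
    have <- : row_perm s^-1 (basis_rows I) = E f.
      by apply/matrixP => i j; rewrite !mxE -sI permKV.
    exact: alternating_perm.
  move=> /existsNP[i /existsNP[j /not_implyP[fij /eqP ij]]].
  have [_ pa] := phiA; apply: (pa _ i j ij).
  by apply/rowP => b; rewrite !mxE fij.
(* By induction on d: the rows from d on are basis vectors already. *)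
have H d : forall M, (forall i : 'I_k, (d <= i)%N -> exists j, row i M = delta_mx 0 j) ->
    phi M = 0.
  elim: d => [|d IH] M dM.
    have /choice[f fM] i : exists j, row i M = delta_mx 0 j by exact: dM.
    rewrite (_ : M = E f)//; apply/row_matrixP => i; rewrite fM.
    by apply/rowP => b; rewrite !mxE eqxx eq_sym.
  have [dk|kd] := ltnP d k; last first.
    by apply: IH => i; have := ltn_ord i; lia.
  pose i := Ordinal dk; rewrite -(setrow_row M i) (row_sum_delta (row i M)).
  elim: (index_enum _) => [|j s IHs].
    by rewrite big_nil; have := phil M i (-1) 0 0; rewrite scaler0 addr0 scaleN1r addNr.
  rewrite big_cons phil IHs addr0 (IH (setrow M i (delta_mx 0 j))) ?scaler0// => a da.
  rewrite row_setrow; have [_|ai] := eqVneq a i; first by exists j.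
  by apply: dM; rewrite ltn_neqAle da andbT eq_sym.
by move=> M; apply: (H k M) => i; have := ltn_ord i; lia.
Qed.

End Expansion.

(** Both sides are alternating in [M] and agree on rows of the canonical basis. *)
Lemma klin_wedge k n (W : lmodType R) (phi : 'M[R]_(k, n) -> W) (M : 'M[R]_(k, n)) :
  alternating phi -> klin phi (wedge M) = phi M.
Proof.
move=> phiA; apply/eqP; rewrite -subr_eq0; apply/eqP.
apply: (@alternating_eq0 _ _ _ (fun M => klin phi (wedge M) - phi M)) => [|I]; last first.
  by rewrite klin_basis subrr.
have [kl ka] := alternating_linear (klin_is_linear phi) (@alternating_wedge k n).
have [pl pa] := phiA.
split=> [N i a x y|N i j ij Nij]; last by rewrite (ka _ _ _ ij Nij) (pa _ _ _ ij Nij) subrr.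
by rewrite kl pl opprD addrACA -scalerBr.
Qed.

End Alternating.

(** * Comparison of norms in finite dimension *)

Section MatrixNorm.
Context {R : realType}.

Lemma ler_coord_norm m n (M : 'M[R]_(m, n)) i j : `|M i j| <= `|M|.
Proof.
rewrite -[leRHS]/(mx_norm M) mx_normrE.
exact: (le_bigmax _ (fun ij => `|M ij.1 ij.2|) (i, j)).
Qed.

Lemma norm_coordP m n (M : 'M[R]_(m, n)) c : 0 <= c ->
  (forall i j, `|M i j| <= c) -> `|M| <= c.
Proof.
move=> c0 H; rewrite -[leLHS]/(mx_norm M) mx_normrE.
by apply/bigmax_leP; split=> // -[i j] _; exact: H.
Qed.

Lemma norm_mulmx m n p (A : 'M[R]_(m, n)) (B : 'M[R]_(n, p)) :
  `|A *m B| <= n%:R * `|A| * `|B|.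
Proof.
apply: norm_coordP => [|i j]; first by rewrite !mulr_ge0.
rewrite mxE; apply: le_trans (ler_norm_sum _ _ _) _.
rewrite -mulrA mulr_natl -[X in _ *+ X]card_ord -sumr_const.
by apply: ler_sum => l _; rewrite normrM ler_pM// ler_coord_norm.
Qed.

End MatrixNorm.

Section InnerProduct.
Context {R : realType}.

(** Cholesky: splitting off the first coordinate leaves the Schur complement, which is
    again positive definite. *)
Lemma inner_product_factor n (G : 'M[R]_n) : inner_product G ->
  exists2 S : 'M[R]_n, S \in unitmx & G = S *m S^T.
Proof.
elim: n G => [|n IH] G [Gsym Gpos].
  by exists 1%:M; [exact: unitmx1|apply/matrixP => -[]].
rewrite -[n.+1]/(1 + n)%N in G Gsym Gpos *.
pose g := G 0 0; pose w := ursubmx G; pose H := drsubmx G.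
have wT : dlsubmx G = w^T by rewrite /w -{1}Gsym -trmx_ursub.
have GE : G = block_mx g%:M w w^T H.
  by rewrite -[LHS]submxK wT; congr block_mx; apply/matrixP => i j;
     rewrite !ord1 !mxE eqxx mulr1n; congr (G _ _); apply/val_inj.
have HT : H^T = H by rewrite /H -[in RHS]Gsym -trmx_drsub.
have qE x (v : 'rV[R]_n) : (row_mx x%:M v *m G *m (row_mx x%:M v)^T) 0 0
    = x ^+ 2 * g + 2 * x * (w *m v^T) 0 0 + (v *m H *m v^T) 0 0.
  rewrite GE mul_row_block tr_row_mx mul_row_col !mulmxDl mxE [X in X + _]mxE [X in _ + X]mxE.
  rewrite tr_scalar_mx -!scalar_mxM.
  have -> : (x%:M *m w *m v^T) 0 0 = x * (w *m v^T) 0 0.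
    by rewrite mul_scalar_mx -scalemxAl mxE.
  have -> : (v *m w^T *m x%:M) 0 0 = x * (w *m v^T) 0 0.
    by rewrite mul_mx_scalar mxE -[v in LHS]trmxK -trmx_mul mxE.
  by rewrite mxE mulr1n; ring.
have g0 : 0 < g.
  have v0 : row_mx (1%:M : 'M[R]_1) (0 : 'rV[R]_n) != 0.
    rewrite row_mx_eq0 negb_and; apply/orP; left.
    by apply/eqP => /matrixP/(_ 0 0)/eqP; rewrite !mxE eqxx oner_eq0.
  by have := Gpos _ v0; rewrite qE trmx0 mulmx0 !mul0mx !mxE; rewrite expr1n mul1r mulr0 !addr0.
pose s := Num.sqrt g; have s0 : 0 < s by rewrite sqrtr_gt0.
have ss : s * s = g by rewrite -expr2 sqr_sqrtr ?ltW.
pose u := s^-1 *: w.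
have uu : u^T *m u = g^-1 *: (w^T *m w).
  have -> : u^T = s^-1 *: w^T by apply/matrixP => i j; rewrite !mxE.
  by rewrite /u -scalemxAl -scalemxAr scalerA -ss invfM.
have [|S' S'u HS'] := IH (H - u^T *m u).
  split; first by rewrite linearB/= HT trmx_mul trmxK.
  move=> v v0; have rv0 : row_mx (- (g^-1 * (w *m v^T) 0 0))%:M v != 0.
    by apply: contra v0 => /eqP/eqP; rewrite row_mx_eq0 => /andP[].
  have -> : (v *m (H - u^T *m u) *m v^T) 0 0
      = (v *m H *m v^T) 0 0 - g^-1 * ((w *m v^T) 0 0 * (w *m v^T) 0 0).
    rewrite mulmxBr mulmxBl mxE [X in _ + X]mxE uu -scalemxAr -scalemxAl [X in _ - X]mxE.
    rewrite mulmxA -(mulmxA (v *m w^T)) [X in _ - _ * X]mxE big_ord1; congr (_ - _ * (_ * _)).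
    by rewrite -[v in LHS]trmxK -trmx_mul mxE.
  have := Gpos _ rv0; rewrite qE => h; apply: lt_le_trans h _.
  rewrite le_eqVlt; apply/orP; left; apply/eqP.
  by field; rewrite gt_eqF.
exists (block_mx s%:M 0 u^T S').
  rewrite unitmxE det_lblock det_scalar1 unitrM -unitmxE S'u andbT.
  by rewrite unitfE gt_eqF.
rewrite GE tr_block_mx mulmx_block !trmx0 tr_scalar_mx trmxK !mulmx0 !mul0mx !addr0.
have uT : u^T = s^-1 *: w^T by apply/matrixP => i j; rewrite !mxE.
rewrite -HS' [u^T *m u + _]addrC subrK -scalar_mxM ss mul_scalar_mx mul_mx_scalar uT !scalerA.
by rewrite divff ?gt_eqF// !scale1r.
Qed.

Lemma inner_product1 n : inner_product (1%:M : 'M[R]_n).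
Proof.
split=> [|v v0]; first exact: trmx1.
rewrite mulmx1 mxE; under eq_bigr do rewrite mxE -expr2.
rewrite lt_neqAle sumr_ge0 ?andbT => [|i _]; last exact: sqr_ge0.
apply: contra v0; rewrite eq_sym psumr_eq0 => [/allP v0|i _]; last exact: sqr_ge0.
by apply/eqP/rowP => i; rewrite mxE; apply/eqP; rewrite -sqrf_eq0; apply: (implyP (v0 i (mem_index_enum i))).
Qed.

Lemma vdot_prod n1 n2 (G1 : 'M[R]_n1) (G2 : 'M[R]_n2) x1 x2 y1 y2 :
  vdot (gram_prod G1 G2) (row_mx x1 x2) (row_mx y1 y2) = vdot G1 x1 y1 + vdot G2 x2 y2.
Proof.
rewrite /vdot /gram_prod mul_row_block !mulmx0 addr0 add0r tr_row_mx mul_row_col.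
by rewrite mxE.
Qed.

Lemma inner_product_prod n1 n2 (G1 : 'M[R]_n1) (G2 : 'M[R]_n2) :
  inner_product G1 -> inner_product G2 -> inner_product (gram_prod G1 G2).
Proof.
move=> [G1s G1p] [G2s G2p]; split=> [|v].
  by rewrite /gram_prod tr_block_mx !trmx0 G1s G2s.
rewrite -[v]hsubmxK row_mx_eq0 negb_and -/(vdot _ _ _) vdot_prod /vdot.
have ge0 m (G : 'M[R]_m) : (forall v : 'rV[R]_m, v != 0 -> 0 < (v *m G *m v^T) 0 0) ->
    forall v : 'rV[R]_m, 0 <= (v *m G *m v^T) 0 0.
  move=> Gp x; have [->|x0] := eqVneq x 0; first by rewrite !mul0mx mxE.
  exact/ltW/Gp.
by move=> /orP[/G1p h1|/G2p h2]; [apply: ltr_wpDr => //; exact: ge0|apply: ltr_wpDl => //; exact: ge0].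
Qed.

Lemma vnorm_prodl n1 n2 (G1 : 'M[R]_n1) (G2 : 'M[R]_n2) u :
  vnorm (gram_prod G1 G2) (row_mx u 0) = vnorm G1 u.
Proof. by rewrite /vnorm vdot_prod /vdot !mul0mx [X in _ + X]mxE addr0. Qed.

Lemma vnorm_prodr n1 n2 (G1 : 'M[R]_n1) (G2 : 'M[R]_n2) u :
  vnorm (gram_prod G1 G2) (row_mx 0 u) = vnorm G2 u.
Proof. by rewrite /vnorm vdot_prod /vdot !mul0mx [X in X + _]mxE add0r. Qed.

Lemma vnorm_factor n (S : 'M[R]_n) u :
  vnorm (S *m S^T) u = Num.sqrt (\sum_j ((u *m S) 0 j) ^+ 2).
Proof.
rewrite /vnorm /vdot mulmxA -mulmxA -trmx_mul mxE; congr Num.sqrt.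
by apply: eq_bigr => j _; rewrite [X in _ * X]mxE expr2.
Qed.

Lemma ler_sqrt_sumsq (I : finType) (f : I -> R) i : `|f i| <= Num.sqrt (\sum_j f j ^+ 2).
Proof.
rewrite -sqrtr_sqr ler_wsqrtr// (bigD1 i)//= lerDl sumr_ge0// => j _.
exact: sqr_ge0.
Qed.

Lemma sqrt_sumsq_le (I : finType) (f : I -> R) : Num.sqrt (\sum_j f j ^+ 2) <= \sum_j `|f j|.
Proof.
rewrite -[leRHS]ger0_norm ?sumr_ge0// -sqrtr_sqr ler_wsqrtr//.
suff [] : \sum_j f j ^+ 2 <= (\sum_j `|f j|) ^+ 2 /\ 0 <= \sum_j `|f j| by [].
elim/big_ind2 : _ => [|x x' y y' [h h0] [h' h0']|i _]; first by rewrite expr0n.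
  split; last exact: addr_ge0.
  by rewrite sqrrD; have := mulr_ge0 h0 h0'; lra.
by rewrite real_normK// num_real.
Qed.

(** If G = S S^T, then the norm of u is the Euclidean norm of u S. *)
Lemma vnorm_norm n (G : 'M[R]_n) : inner_product G ->
  exists2 C, 0 < C & forall u, `|u| <= C * vnorm G u /\ vnorm G u <= C * `|u|.
Proof.
move=> /inner_product_factor[S Su ->].
pose C := n%:R * `|invmx S| + n%:R * (n%:R * `|S|) + 1.
have C0 : 0 < C by rewrite ltr_wpDl// addr_ge0// !mulr_ge0.
exists C => // u; rewrite vnorm_factor; set N := Num.sqrt _; split.
  have -> : `|u| = `|(u *m S) *m invmx S| by rewrite mulmxK.
  apply: le_trans (norm_mulmx _ _) _.
  have uS : `|u *m S| <= N.
    apply: norm_coordP => [|i j]; first exact: sqrtr_ge0.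
    rewrite (ord1 i); exact: (ler_sqrt_sumsq (fun j => (u *m S) 0 j)).
  rewrite mulrAC; apply: ler_pM => //.
  by rewrite /C -addrA lerDl addr_ge0// !mulr_ge0.
apply: le_trans (sqrt_sumsq_le _) _.
apply: (@le_trans _ _ (\sum_(j < n) n%:R * `|u| * `|S|)).
  by apply: ler_sum => j _; apply: le_trans (norm_mulmx _ _); exact: ler_coord_norm.
rewrite sumr_const card_ord -[_ *+ n]mulr_natl.
have -> : n%:R * (n%:R * `|u| * `|S|) = (n%:R * (n%:R * `|S|)) * `|u| by ring.
rewrite ler_wpM2r// /C; have : 0 <= n%:R * `|invmx S| by rewrite mulr_ge0.
by move: (n%:R * `|invmx S|) (n%:R * _) => *; lra.
Qed.

End InnerProduct.

Section Mass.
Context {R : realType}.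

Definition l1norm k n (al : kvec R k n) : R := \sum_I `|al I : R|.

Lemma l1norm_ge0 k n (al : kvec R k n) : 0 <= l1norm al.
Proof. exact: sumr_ge0. Qed.

Lemma ler_l1norm k n (al : kvec R k n) I : `|al I : R| <= l1norm al.
Proof. by rewrite /l1norm (bigD1 I)//= lerDl sumr_ge0. Qed.

Lemma mass_le_l1norm k n (G : 'M[R]_n) :
  exists2 C, 0 < C & forall al : kvec R k n, mass G al <= C * l1norm al.
Proof.
pose b (I : multi k n) : kvec R k n := wedge (basis_rows I).
pose C := \sum_I Num.sqrt (kdot G (b I) (b I)) + 1.
have C0 : 0 < C by rewrite ltr_wpDl// sumr_ge0// => I _; exact: sqrtr_ge0.
exists C => // al; apply: (@le_trans _ _ (\sum_I `|al I : R| * Num.sqrt (kdot G (b I) (b I)))).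
  apply: ge_inf_mem; first by exists 0; exact: mass_set_lbound.
  exists (map (fun I => (al I : R) *: b I) (index_enum _)); split.
  - by move=> _ /mapP[I _ ->]; exists (al I), (basis_rows I).
  - by rewrite big_map; exact: kvec_basis.
  - rewrite big_map; apply: eq_bigr => I _.
    by rewrite kdotZ sqrtrM ?sqr_ge0// sqrtr_sqr.
rewrite mulr_sumr; apply: ler_sum => I _; rewrite mulrC ler_wpM2r//.
rewrite /C (bigD1 I)//= -addrA lerDl addr_ge0// sumr_ge0// => J _; exact: sqrtr_ge0.
Qed.

Lemma alternating_mulmx k n m (W : lmodType R) (A : 'M[R]_(n, m)) (phi : 'M[R]_(k, m) -> W) :
  alternating phi -> alternating (fun N : 'M[R]_(k, n) => phi (N *m A)).
Proof.
move=> [pl pa]; have sA (M : 'M[R]_(k, n)) i x : setrow M i x *m A = setrow (M *m A) i (x *m A).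
  by apply/row_matrixP => a; rewrite row_mul !row_setrow; case: eqP => // _; rewrite row_mul.
split=> [M i a x y|M i j ij Mij]; first by rewrite !sA -pl mulmxDl scalemxAl.
by apply: (pa _ i j ij); rewrite !row_mul Mij.
Qed.

(** Cauchy-Binet, read as: the minors of a product are alternating in its left factor. *)
Lemma wedge_mulmx k n m (M : 'M[R]_(k, n)) (A : 'M[R]_(n, m)) :
  wedge (M *m A) = \sum_(I : multi k n) (wedge M I : R) *: (wedge (basis_rows I *m A) : kvec R k m).
Proof.
by rewrite -[RHS]/(klin (fun N => wedge (N *m A)) (wedge M)) klin_wedge//;
   apply: alternating_mulmx; exact: alternating_wedge.
Qed.

Lemma alternating_gram k n (A : 'M[R]_(k, n)) :
  alternating (fun N : 'M[R]_(k, n) => \det (A *m N^T) : R^o).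
Proof.
have -> : (fun N : 'M[R]_(k, n) => \det (A *m N^T) : R^o) = (fun N => \det (N *m A^T) : R^o).
  by apply/funext => N; rewrite -det_tr trmx_mul trmxK.
exact: alternating_mulmx (@det_alternating _ k).
Qed.

Lemma det_gram k n (X : 'M[R]_(k, n)) :
  \det (X *m X^T) = \sum_(J : multi k n) (wedge X J : R) ^+ 2.
Proof.
rewrite -(klin_wedge _ (alternating_gram X)) /klin; apply: eq_bigr => J _.
rewrite expr2 [in RHS]ffunE ffunE; congr (_ * \det _).
apply/matrixP => i j; rewrite !mxE (bigD1 (val J j))//= big1 ?addr0 => [|l lJ].
  by rewrite !mxE eqxx mulr1.
by rewrite !mxE eq_sym (negbTE lJ) mulr0.
Qed.

Lemma kdot_wedge k n (G : 'M[R]_n) (M : 'M[R]_(k, n)) : G^T = G ->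
  kdot G (wedge M) (wedge M) = \det (M *m G *m M^T).
Proof.
move=> Gs; rewrite /kdot.
have H N : \sum_(J : multi k n) (wedge M J : R) * \det (N *m G *m (basis_rows J)^T)
    = \det (N *m G *m M^T).
  exact: (klin_wedge M (alternating_gram (N *m G))).
transitivity (\sum_(I : multi k n) (wedge M I : R) * \det (basis_rows I *m G *m M^T)).
  apply: eq_bigr => I _; rewrite -H mulr_sumr; apply: eq_bigr => J _.
  by rewrite mulrA.
have sw N : \det (N *m G *m M^T) = \det (M *m G *m N^T).
  by rewrite -det_tr !trmx_mul trmxK Gs mulmxA.
under eq_bigr do rewrite sw.
exact: H.
Qed.

(** For a simple k-vector M the Gram determinant is the sum of the squares of the
    minors of M S, with G = S S^T, and S is invertible. *)
Lemma coord_le_mass k n (G : 'M[R]_n) : inner_product G ->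
  exists2 C, 0 < C & forall al : kvec R k n, l1norm al <= C * mass G al.
Proof.
move=> GI; have [S Su GS] := inner_product_factor GI; have [Gs _] := GI.
pose D := \sum_(J : multi k n) l1norm (wedge (basis_rows J *m invmx S) : kvec R k n) + 1.
have D0 : 0 < D by rewrite ltr_wpDl// sumr_ge0// => I _; exact: l1norm_ge0.
have simp (be : kvec R k n) : simple be -> l1norm be <= D * Num.sqrt (kdot G be be).
  move=> [c [M ->]]; rewrite kdotZ sqrtrM ?sqr_ge0// sqrtr_sqr mulrCA.
  have -> : l1norm (c *: wedge M) = `|c| * l1norm (wedge M).
    by rewrite /l1norm mulr_sumr; apply: eq_bigr => I _; rewrite ffunE -normrM.
  rewrite ler_wpM2l// kdot_wedge// GS mulmxA -mulmxA -trmx_mul det_gram.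
  set N := Num.sqrt _.
  have ME : M = (M *m S) *m invmx S by rewrite mulmxK.
  rewrite [in leLHS]ME wedge_mulmx /l1norm.
  apply: (@le_trans _ _ (\sum_I \sum_J N * `|wedge (basis_rows J *m invmx S) I : R|)).
    apply: ler_sum => I _; rewrite sum_ffunE; apply: le_trans (ler_norm_sum _ _ _) _.
    apply: ler_sum => J _; rewrite ffunE normrM ler_wpM2r//.
    exact: (ler_sqrt_sumsq (fun J => wedge (M *m S) J : R)).
  rewrite exchange_big/= /D mulrDl mul1r mulr_suml ler_wpDr ?sqrtr_ge0//.
  by apply: ler_sum => J _; rewrite mulrC mulr_sumr.
exists D => // al; rewrite -ler_pdivrMl//; apply: lb_le_inf => [|_ [s [ss -> ->]]].
  exists (\sum_(I : multi k n) Num.sqrt (kdot G ((al I : R) *: (wedge (basis_rows I) : kvec R k n))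
      ((al I : R) *: (wedge (basis_rows I) : kvec R k n)))).
  exists (map (fun I => (al I : R) *: (wedge (basis_rows I) : kvec R k n)) (index_enum _)); split.
  - by move=> _ /mapP[I _ ->]; exists (al I), (basis_rows I).
  - by rewrite big_map; exact: kvec_basis.
  - by rewrite big_map.
rewrite ler_pdivrMl// mulr_sumr.
apply: (@le_trans _ _ (\sum_(be <- s) l1norm be)).
  rewrite /l1norm exchange_big/=; apply: ler_sum => I _.
  by rewrite sum_ffunE; exact: ler_norm_sum.
by rewrite big_seq [leRHS]big_seq; apply: ler_sum => be /ss; exact: simp.
Qed.

Lemma massZ k n (G : 'M[R]_n) c (al : kvec R k n) : mass G (c *: al) = `|c| * mass G al.
Proof.
apply/eqP; rewrite eq_le massZ_le/=; have [->|c0] := eqVneq c 0.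
  by rewrite normr0 mul0r mass_ge0.
rewrite -ler_pdivlMl ?normr_gt0// -normfV.
by rewrite -{1}[al]scale1r -(mulVf c0) -scalerA massZ_le.
Qed.

Lemma mass_eq0 k n (G : 'M[R]_n) (al : kvec R k n) : inner_product G ->
  mass G al = 0 -> al = 0.
Proof.
move=> /(@coord_le_mass k)[C C0 H] al0; apply/ffunP => I; rewrite ffunE.
apply/eqP; rewrite -normr_le0; apply: le_trans (ler_l1norm al I) _.
by have := H al; rewrite al0 mulr0.
Qed.

Lemma l1norm_linear k n k' n' (L : kvec R k n -> kvec R k' n') : linear L ->
  exists2 C, 0 < C & forall al, l1norm (L al) <= C * l1norm al.
Proof.
move=> Ll; pose b (I : multi k n) : kvec R k n := wedge (basis_rows I).
pose C := \sum_I l1norm (L (b I)) + 1.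
have C0 : 0 < C by rewrite ltr_wpDl// sumr_ge0// => I _; exact: l1norm_ge0.
exists C => // al; rewrite [al in leLHS]kvec_basis (linear_sum_of _ _ Ll).
apply: (@le_trans _ _ (\sum_I `|al I : R| * l1norm (L (b I)))).
  rewrite /l1norm; under [leRHS]eq_bigr do rewrite mulr_sumr.
  rewrite exchange_big/=; apply: ler_sum => J _; rewrite sum_ffunE.
  apply: le_trans (ler_norm_sum _ _ _) _; apply: ler_sum => I _.
  by rewrite (linearZ_of _ _ Ll) ffunE normrM.
rewrite [l1norm al]/l1norm mulr_sumr; apply: ler_sum => I _.
rewrite mulrC ler_wpM2r// /C (bigD1 I)//= -addrA lerDl addr_ge0// sumr_ge0// => J _.
exact: l1norm_ge0.
Qed.

(** The chain operators act on the values of a chain by linear maps, and this bounds the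
    cost of the resulting difference chains. *)
Lemma mass_linear k n k' n' (G : 'M[R]_n) (G' : 'M[R]_n') (L : kvec R k n -> kvec R k' n') :
  inner_product G -> linear L ->
  exists2 C, 0 < C & forall al, mass G' (L al) <= C * mass G al.
Proof.
move=> /(@coord_le_mass k)[C1 C10 H1] /l1norm_linear[C2 C20 H2].
have [C3 C30 H3] := @mass_le_l1norm k' n' G'.
exists (C3 * (C2 * C1)) => [|al]; first by rewrite !mulr_gt0.
apply: le_trans (H3 _) _; rewrite -mulrA ler_pM2l//.
apply: le_trans (H2 _) _; rewrite -mulrA ler_pM2l//.
Qed.

End Mass.

(** * Dirac chains and forms *)

Section DiracTheory.
Context {R : realType}.

Lemma dchain_supp n k (U : set 'rV[R]_n) (A : dchain k U) : supp A `<=` U.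
Proof. by case: A => A /= /asboolP[]. Qed.

Lemma dval_lin n k (U : set 'rV[R]_n) a (A B : dchain k U) q :
  dval (a *: A + B) q = a *: dval A q + dval B q.
Proof. by []. Qed.

Lemma dval_sum n k (U : set 'rV[R]_n) (T : Type) (s : seq T) (P : pred T)
    (A : T -> dchain k U) q :
  dval (\sum_(t <- s | P t) A t) q = \sum_(t <- s | P t) dval (A t) q.
Proof.
elim: s => [|t s IH]; rewrite ?big_nil// !big_cons; case: ifP => // _.
by rewrite -IH.
Qed.

Lemma dchain_eq n k (U : set 'rV[R]_n) (A B : dchain k U) :
  (forall q, dval A q = dval B q) -> A = B.
Proof. by move=> AB; apply/val_inj/funext. Qed.

Lemma dval_insubd n k (U : set 'rV[R]_n) (f : 'rV[R]_n -> kvec R k n) :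
  finite_set (supp f) -> supp f `<=` U -> dval (insubd (0 : dchain k U) f) = f.
Proof. by move=> ff fU; rewrite insubdK//; apply/asboolP. Qed.

Lemma fpointE n k (p : 'rV[R]_n) (al : kvec R k n) q :
  fpoint p al q = if q == p then al else 0.
Proof. by []. Qed.

Lemma dpoint_out n k (U : set 'rV[R]_n) p (al : kvec R k n) : ~ U p -> dpoint U p al = 0.
Proof.
move=> pU; apply: dchain_eq => q; rewrite /dpoint.
have [->|al0] := eqVneq al 0.
  rewrite dval_insubd ?fpointE ?if_same//.
    rewrite (_ : supp _ = set0) // -subset0 => x; rewrite /supp/= fpointE if_same.
    by rewrite eqxx.
  by move=> x; rewrite /supp/= fpointE if_same eqxx.
rewrite /insubd insubN//; apply/asboolP => -[_ /(_ p)].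
by rewrite /supp/= fpointE eqxx => /(_ al0).
Qed.

Lemma dval_dpoint n k (U : set 'rV[R]_n) p (al : kvec R k n) q : U p ->
  dval (dpoint U p al) q = if q == p then al else 0.
Proof.
move=> Up; rewrite /dpoint dval_insubd//.
  apply: (@sub_finite_set _ _ [set p]); last exact: finite_set1.
  by move=> x; rewrite /supp/= fpointE; case: (eqVneq x p) => // _; rewrite eqxx.
by move=> x; rewrite /supp/= fpointE; case: (eqVneq x p) => [->//|_]; rewrite eqxx.
Qed.

Lemma dpoint_linear n k (U : set 'rV[R]_n) p : linear (@dpoint R n k U p).
Proof.
move=> a al be; have [pU|pU] := pselect (U p); last first.
  by rewrite !dpoint_out// scaler0 addr0.
apply: dchain_eq => q; rewrite dval_lin !dval_dpoint//; case: eqP => // _.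
by rewrite scaler0 addr0.
Qed.

Lemma dpoint0 n k (U : set 'rV[R]_n) p : dpoint U p (0 : kvec R k n) = 0.
Proof. exact: linear0_of (@dpoint_linear n k U p). Qed.

Lemma dpointZ n k (U : set 'rV[R]_n) p a (al : kvec R k n) :
  dpoint U p (a *: al) = a *: dpoint U p al.
Proof. by rewrite -[a *: al]addr0 dpoint_linear dpoint0 addr0. Qed.

Lemma dchain_sum_dpoint n k (U : set 'rV[R]_n) (A : dchain k U) :
  A = \sum_(p <- fset_set (supp A)) dpoint U p (A p).
Proof.
have Af := dchain_finite A; apply: dchain_eq => q; rewrite dval_sum.
have Up p : p \in fset_set (supp A) -> U p.
  by rewrite in_fset_set// inE; exact: dchain_supp.
have [qA|qA] := boolP (q \in fset_set (supp A)).
  rewrite (bigD1_seq q) ?finmap.fset_uniq//= dval_dpoint ?eqxx; last exact: Up.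
  rewrite big_seq_cond big1 ?addr0 => [|p /andP[/Up pU]]//.
  by rewrite eq_sym dval_dpoint// => /negbTE ->.
rewrite big1_seq => [|p /= pA].
  by apply/eqP; move: qA; rewrite in_fset_set// notin_setE => /negP; rewrite negbK.
by rewrite dval_dpoint; [case: eqP => // qp; rewrite -qp (negbTE qA) in pA|exact: Up].
Qed.

Lemma linear_sum_dpoint n k (U : set 'rV[R]_n) (W : lmodType R) (f : dchain k U -> W)
    (A : dchain k U) : linear f -> f A = \sum_(p <- fset_set (supp A)) f (dpoint U p (A p)).
Proof.
by move=> fl; rewrite {1}[A]dchain_sum_dpoint linear_sum_of.
Qed.

Lemma klin_comp n k (W W' : lmodType R) (L : W -> W') (phi : 'M[R]_(k, n) -> W) al :
  linear L -> klin (fun M => L (phi M)) al = L (klin phi al).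
Proof.
move=> Ll; rewrite /klin linear_sum_of//; apply: eq_bigr => I _.
exact/esym/linearZ_of.
Qed.

Lemma lin_ext_sum n k (U : set 'rV[R]_n) (W : lmodType R)
    (phi : 'rV[R]_n -> 'M[R]_(k, n) -> W) (A : dchain k U) :
  lin_ext phi A = \sum_(p <- fset_set (supp A)) klin (phi p) (A p).
Proof. by rewrite /lin_ext fsbig_finite//; exact: dchain_finite. Qed.

Lemma lin_ext_dpoint n k (U : set 'rV[R]_n) (W : lmodType R)
    (phi : 'rV[R]_n -> 'M[R]_(k, n) -> W) p (al : kvec R k n) : U p ->
  lin_ext phi (dpoint U p al) = klin (phi p) al.
Proof.
move=> Up; rewrite (@lin_ext_widen _ _ _ _ _ _ _ [set p]).
  by rewrite fsbig_set1 dval_dpoint// eqxx.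
by move=> q; rewrite /supp/= dval_dpoint//; case: (eqVneq q p) => // _; rewrite eqxx.
Qed.

Lemma DeltaE n k (s : seq 'rV[R]_n) p (al : kvec R k n) :
  Delta (s, p, al) = foldr (fun u A q => A (q - u) - A q) (fpoint p al) s.
Proof. by []. Qed.

Lemma supp_Delta_finite n k (t : dterm k) : finite_set (@supp R n k (Delta t)).
Proof.
case: t => -[s p] al; elim: s => [|u s IH].
  apply: (@sub_finite_set _ _ [set p]); last exact: finite_set1.
  by move=> x; rewrite /supp/= DeltaE/= fpointE; case: (eqVneq x p) => // _; rewrite eqxx.
apply: (@sub_finite_set _ _ ((fun q => q + u) @` supp (Delta (s, p, al)) `|` supp (Delta (s, p, al)))).
  move=> q; rewrite /supp/= !DeltaE/= => h; rewrite -!DeltaE in h *.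
  have [e|ne] := eqVneq (Delta (s, p, al) q) 0; last by right.
  by left; exists (q - u); [move: h; rewrite e subr0|rewrite subrK].
by rewrite finite_setU; split=> //; exact: finite_image.
Qed.

Lemma hull_sub n (S : set 'rV[R]_n) : S `<=` hull S.
Proof.
move=> x Sx; exists 1%N, (fun _ => 1), (fun _ => x); split=> //; rewrite big_ord1//.
by rewrite scale1r.
Qed.

Lemma hull_mono n (S S' : set 'rV[R]_n) : S `<=` S' -> hull S `<=` hull S'.
Proof.
move=> SS x [m [w [s [w0 sS w1 ->]]]]; exists m, w, s; split=> // i.
exact: SS.
Qed.

Lemma hull_linear n n' (f : 'rV[R]_n -> 'rV[R]_n') (S : set 'rV[R]_n) (S' : set 'rV[R]_n') :
  linear f -> (forall x, S x -> S' (f x)) -> forall x, hull S x -> hull S' (f x).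
Proof.
move=> fl fS x [m [w [s [w0 sS w1 ->]]]]; exists m, w, (f \o s); split=> // [i|].
  exact/fS/sS.
by rewrite linear_sum_of//; apply: eq_bigr => i _; exact: linearZ_of.
Qed.

Lemma hull_set1 n (p : 'rV[R]_n) : hull [set p] `<=` [set p].
Proof.
move=> x [m [w [s [w0 sS w1 ->]]]] /=.
by under eq_bigr do rewrite sS; rewrite -scaler_suml w1 scale1r.
Qed.

Lemma inside_dchain n k (U : set 'rV[R]_n) (t : dterm k) : inside U t ->
  dval (insubd (0 : dchain k U) (Delta t)) = Delta t.
Proof.
move=> tU; apply: dval_insubd; first exact: supp_Delta_finite.
exact: subset_trans (@hull_sub _ _) tU.
Qed.

Section OperatorBound.
Context {n k r : nat} (G : 'M[R]_n) (U : set 'rV[R]_n).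

Lemma bnorm_le_cost (A : dchain k U) (s : seq (dterm k)) :
  {in s, forall t, inside U t /\ (dorder t <= r)%N} ->
  dval A = \sum_(t <- s) Delta t -> bnorm G r k U A <= \sum_(t <- s) cost G t.
Proof.
move=> sU As; apply: ge_inf_mem; first exact: bnorm_set_lbound.
by exists s.
Qed.

Lemma bnorm_le_cost1 (A : dchain k U) (t : dterm k) :
  inside U t -> (dorder t <= r)%N -> dval A = Delta t -> bnorm G r k U A <= cost G t.
Proof.
move=> tU tr At; have := @bnorm_le_cost A [:: t]; rewrite !big_seq1; apply=> //.
by move=> t'; rewrite inE => /eqP ->.
Qed.

(** The norm of level r is the largest seminorm that is at most the cost on the
    difference chains, so that operators need to be estimated on those only. *)
Lemma operator_bound (W : lmodType R) (p : seminorm W) (T : dchain k U -> W) C :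
  0 < C -> linear T ->
  (forall (A : dchain k U) t, inside U t -> (dorder t <= r)%N -> dval A = Delta t ->
     p (T A) <= C * cost G t) ->
  forall A, p (T A) <= C * bnorm G r k U A.
Proof.
move=> C0 Tl H A; rewrite -ler_pdivrMl//; apply: lb_le_inf; first exact: bnorm_set_neq0.
move=> _ [s [sU As ->]]; rewrite ler_pdivrMl//.
have -> : A = \sum_(t <- s) insubd (0 : dchain k U) (Delta t).
  apply: dchain_eq => q; rewrite As fct_sumE dval_sum big_seq [RHS]big_seq.
  by apply: eq_bigr => t /sU[tU _]; rewrite inside_dchain.
rewrite linear_sum_of// mulr_sumr; apply: le_trans (snorm_sum _ _ _) _.
rewrite big_seq [leRHS]big_seq; apply: ler_sum => t /sU[tU tr].
by apply: H => //; exact: inside_dchain.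
Qed.

End OperatorBound.

Definition abs_seminorm : seminorm R^o := Seminorm (@ler_normD R R) (@normrM R).

Section Forms.
Context {n k r : nat} (G : 'M[R]_n) (U : set 'rV[R]_n).
Hypothesis GI : inner_product G.

Lemma DeltaZ' c (s : seq 'rV[R]_n) p (al : kvec R k n) q :
  Delta (s, p, c *: al) q = c *: Delta (s, p, al) q.
Proof. by rewrite (DeltaZ c (s, p, al)). Qed.

(** If the cost vanishes, so does the k-vector or one of the displacements, and the
    difference in the direction 0 is 0. *)
Lemma cost_eq0 (t : dterm k) : cost G t = 0 -> Delta t = 0.
Proof.
case: t => -[s p] al /eqP; rewrite mulf_eq0 => /orP[|/eqP /= al0]; last first.
  rewrite (mass_eq0 GI al0); apply/funext => q.
  by rewrite -(scale0r (0 : kvec R k n)) DeltaZ' scale0r.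
rewrite /= => /eqP s0; have [C C0 vn] := vnorm_norm GI.
have {s0} : 0 \in s.
  elim: s s0 => [|u s IH]; rewrite ?big_nil; first by move/eqP; rewrite oner_eq0.
  rewrite big_cons inE => /eqP; rewrite mulf_eq0 => /orP[/eqP u0|/eqP /IH ->]; last by rewrite orbT.
  by have [] := vn u; rewrite u0 mulr0 normr_le0 eq_sym => ->.
elim: s => // u s IH; rewrite inE => /orP[/eqP <-|/IH s0].
  by apply/funext => q; rewrite DeltaE/= subr0 subrr.
apply/funext => q; rewrite DeltaE/=.
have -> : foldr (fun u A q => A (q - u) - A q) (fpoint p al) s = 0 by [].
by rewrite subrr.
Qed.

Lemma form_norm_ge (om : kform k U) (j : 'I_r.+1) :
  let S := [set y | exists (t : dterm k) (A : dchain k U),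
      [/\ dorder t = j, inside U t, dval A = Delta t, cost G t = 1 &
          y = `|om A|%:E]] in
  (ereal_sup S <= form_norm G r om)%E.
Proof.
exact: (le_bigmax _ (fun j : 'I_r.+1 => ereal_sup [set y | exists (t : dterm k) (A : dchain k U),
      [/\ dorder t = j, inside U t, dval A = Delta t, cost G t = 1 &
          y = `|om A|%:E]])).
Qed.

(** The norm of a form sees difference chains of cost 1 only; the others reduce to them by
    homogeneity, except that those of cost 0 have to vanish. *)
Lemma bform_bound (om : kform k U) : bform G r om ->
  exists2 C, 0 < C & forall (A : dchain k U) t, inside U t -> (dorder t <= r)%N ->
    dval A = Delta t -> `|om A| <= C * cost G t.
Proof.
rewrite /bform => omr.
have [C C0 HC] : exists2 C, 0 < C & (form_norm G r om <= C%:E)%E.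
  move: omr; case: (form_norm G r om) => [x _||]//.
    by exists (`|x| + 1); [rewrite ltr_wpDl|rewrite lee_fin -[leLHS]addr0 lerD// ler_norm].
  by move=> _; exists 1; rewrite ?leNye.
exists C => // A t tU tr At.
have [c0|c0] := eqVneq (cost G t) 0.
  rewrite c0 mulr0; have -> : A = 0.
    by apply: dchain_eq => q; rewrite At (cost_eq0 c0).
  by rewrite linear0 normr0.
have cp : 0 < cost G t by rewrite lt_neqAle eq_sym c0 cost_ge0.
pose t' : dterm k := (t.1, (cost G t)^-1 *: t.2).
pose A' := (cost G t)^-1 *: A.
have At' : dval A' = Delta t'.
  by rewrite /t' DeltaZ -At.
have : `|om A'| <= C.
  rewrite -lee_fin; apply: le_trans HC; rewrite /form_norm.
  apply: le_trans (form_norm_ge om (Ordinal (tr : (dorder t < r.+1)%N))).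
  apply: ereal_sup_ubound; exists t', A'; split=> //.
      move: tU; rewrite /inside -At -At'; apply: subset_trans; apply: hull_mono => q.
      change ((cost G t)^-1 *: dval A q != 0 -> dval A q != 0).
      by rewrite scaler_eq0 negb_or => /andP[].
    by rewrite /cost/= massZ mulrCA gtr0_norm ?invr_gt0// mulVf.
rewrite /A' linearZ/= normrM gtr0_norm ?invr_gt0//.
by rewrite mulrC ler_pdivrMr.
Qed.

Lemma bform_le_bnorm (om : kform k U) : bform G r om ->
  exists2 C, 0 < C & forall A, `|om A| <= C * bnorm G r k U A.
Proof.
move=> /bform_bound[C C0 H]; exists C => //.
apply: (operator_bound (p := abs_seminorm)) => // a x y.
by rewrite linearP.
Qed.

Lemma bint_lim (om : kform k U) (J : bhat G r k U) A : bform G r om -> converges_to A J ->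
  om (A i) @[i --> \oo] --> bint J om.
Proof.
move=> /bform_le_bnorm[C C0 omC].
have [|l Hl] := bounded_functional_limit J _ omC; first by move=> x y; rewrite linearB.
by move: A; apply: (xgetPex 0 (P := [set x | forall A, converges_to A J ->
      om (A i) @[i --> \oo] --> x])); exists l.
Qed.

End Forms.

Lemma bform_level n k r s (G : 'M[R]_n) (U : set 'rV[R]_n) (om : kform k U) :
  (r <= s)%N -> bform G s om -> bform G r om.
Proof.
move=> rs; apply: le_lt_trans; rewrite /form_norm; apply/bigmax_leP; split.
  exact: bigmax_ge_id.
move=> j _; apply: (le_bigmax _ (fun j : 'I_s.+1 => ereal_sup [set y | exists (t : dterm k) (A : dchain k U),
      [/\ dorder t = j, inside U t, dval A = Delta t, cost G t = 1 &
          y = `|om A|%:E]]) (widen_ord (rs : (r < s.+1)%N) j)).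
Qed.

End DiracTheory.

(** * Contraction, Cartesian product and pushforward of Dirac chains *)

Section ChainOperators.
Context {R : realType}.

Lemma sum_supp n k (U : set 'rV[R]_n) (W : lmodType R) (A : dchain k U)
    (F : 'rV[R]_n -> kvec R k n -> W) l : F l 0 = 0 ->
  \sum_(p <- fset_set (supp A)) (if l == p then F p (A p) else 0) = F l (A l).
Proof.
move=> F0; have Af := dchain_finite A.
have [lA|lA] := boolP (l \in fset_set (supp A)).
  rewrite (bigD1_seq l) ?finmap.fset_uniq//= eqxx big1 ?addr0// => p.
  by rewrite eq_sym => /negbTE ->.
rewrite big1_seq => [|p /= pA].
  suff -> : A l = 0 by rewrite F0.
  by apply/eqP; move: lA; rewrite in_fset_set// notin_setE => /negP; rewrite negbK.
by case: eqP => // lp; rewrite -lp (negbTE lA) in pA.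
Qed.

Lemma supp_in n k (U : set 'rV[R]_n) (A : dchain k U) p : p \in fset_set (supp A) -> U p.
Proof. by rewrite in_fset_set ?inE; [exact: dchain_supp|exact: dchain_finite]. Qed.

Lemma lin_ext_dpoint_comp n k n' k' (U : set 'rV[R]_n) (U' : set 'rV[R]_n')
    (F : 'rV[R]_n -> 'rV[R]_n') (phi : 'rV[R]_n -> 'M[R]_(k, n) -> kvec R k' n')
    (A : dchain k U) :
  lin_ext (fun p M => dpoint U' (F p) (phi p M)) A
  = \sum_(p <- fset_set (supp A)) dpoint U' (F p) (klin (phi p) (A p)).
Proof.
by rewrite lin_ext_sum; apply: eq_bigr => p _; apply: klin_comp; exact: dpoint_linear.
Qed.

(** Common to the contraction and the Cartesian products: such operators commute with the
    difference operators, up to the transformation g of the displacements. *)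
Lemma Delta_map n k n' k' (f : 'rV[R]_n' -> 'rV[R]_n) (g : 'rV[R]_n -> 'rV[R]_n')
    (Phi : 'rV[R]_n' -> kvec R k n -> kvec R k' n') (s : seq 'rV[R]_n) p al p' al' :
  (forall z, linear (Phi z)) -> (forall z u, Phi (z - g u) = Phi z) ->
  (forall z u, f (z - g u) = f z - u) ->
  (forall z, fpoint p' al' z = Phi z (fpoint p al (f z))) ->
  forall z, Delta (map g s, p', al') z = Phi z (Delta (s, p, al) (f z)).
Proof.
move=> Pl Pg fg base; elim: s => [|u s IH] z; first exact: base.
by rewrite /= !DeltaE/= -!DeltaE !IH Pg fg (linearB_of _ _ (Pl z)).
Qed.

Section Contraction.
Context {n k : nat} (G : 'M[R]_n) (v : 'rV[R]_n).

Definition contr_rows (M : 'M[R]_(k.+1, n)) : kvec R k n :=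
  \sum_(i < k.+1) ((-1) ^+ i * vdot G v (row i M)) *: (wedge (row' i M) : kvec R k n).

Definition contr : kvec R k.+1 n -> kvec R k n := klin contr_rows.

Lemma contr_linear : linear contr.
Proof. exact: klin_is_linear. Qed.

Lemma alternating_contr_rows : alternating contr_rows.
Proof.
have E M J : contr_rows M J = \sum_j (v *m G) 0 j *
    \sum_(i < k.+1) (-1) ^+ i * M i j * (wedge (row' i M) J : R).
  rewrite sum_ffunE; under [RHS]eq_bigr do rewrite mulr_sumr.
  rewrite exchange_big/=; apply: eq_bigr => i _; rewrite ffunE /vdot mxE.
  rewrite /GRing.scale/= mulr_sumr mulr_suml; apply: eq_bigr => j _.
  by rewrite !mxE; ring.
have alt J : alternating (fun M => contr_rows M J : R^o).
  under eq_fun do rewrite E.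
  apply: alternating_sum => j; apply: (alternating_linear (f := fun x : R^o => _ * x : R^o)).
    by move=> a x y /=; rewrite /GRing.scale/=; ring.
  exact: alternating_insert.
split=> [M i a x y|M i j ij Mij]; apply/ffunP => J.
  by have [h _] := alt J; rewrite h !ffunE.
by have [_ h] := alt J; rewrite (h _ _ _ ij Mij) ffunE.
Qed.

Lemma contr_wedge M : contr (wedge M) = contr_rows M.
Proof. exact: klin_wedge alternating_contr_rows. Qed.

Context (U : set 'rV[R]_n).

Lemma Edag_dirac_sum (A : dchain k.+1 U) :
  Edag_dirac G v A = \sum_(p <- fset_set (supp A)) dpoint U p (contr (A p)).
Proof.
rewrite -lin_ext_dpoint_comp /Edag_dirac; congr (lin_ext _ A).
apply/funext => p; apply/funext => M; rewrite linear_sum_of; last exact: dpoint_linear.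
by apply: eq_bigr => i _; rewrite dpointZ.
Qed.

Lemma Edag_dirac_val (A : dchain k.+1 U) q : dval (Edag_dirac G v A) q = contr (A q).
Proof.
rewrite Edag_dirac_sum dval_sum -(@sum_supp _ _ U _ A (fun _ => contr)).
  by apply: eq_big_seq => p /supp_in Up; rewrite dval_dpoint.
exact/linear0_of/contr_linear.
Qed.

Lemma Edag_dirac_linear : linear (@Edag_dirac R n G k U v).
Proof. exact: lin_ext_is_linear. Qed.

(** The contraction changes the k-vectors only, and so maps a difference chain to one with
    the same displacements. *)
Lemma Edag_bound r : inner_product G ->
  exists2 C, 0 < C & forall A, bnorm G r k U (Edag_dirac G v A) <= C * bnorm G r k.+1 U A.
Proof.
move=> GI; have [C C0 HC] := mass_linear G GI contr_linear.
exists C => //; apply: operator_bound => //; first exact: Edag_dirac_linear.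
move=> A [[s p] al] tU tr At; pose t' : dterm k := (s, p, contr al).
have DE z : Delta t' z = contr (Delta (s, p, al) z).
  rewrite /t' -{1}(map_id s); apply: (Delta_map (f := id) (g := id) (Phi := fun _ => contr)) => //.
  - by move=> _; exact: contr_linear.
  - by move=> z'; rewrite !fpointE; case: ifP => // _; rewrite linear0_of//; exact: contr_linear.
apply: (@le_trans _ _ (cost G t')).
  apply: bnorm_le_cost1 => //.
    apply: subset_trans tU; apply: hull_mono => z; rewrite /supp/= DE.
    by apply: contra => /eqP ->; rewrite linear0_of//; exact: contr_linear.
  by apply/funext => z; rewrite Edag_dirac_val At DE.
rewrite /cost/= mulrCA ler_wpM2l//.
by rewrite prodr_ge0// => u _; exact: sqrtr_ge0.
Qed.

End Contraction.

Section Cartesian.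
Context {n1 n2 k l m : nat} (e : (k + l)%N = m).

Definition cross_rows (M : 'M[R]_(k, n1)) (N : 'M[R]_(l, n2)) : 'M[R]_(m, n1 + n2) :=
  castmx (e, erefl) (col_mx (row_mx M 0) (row_mx 0 N)).

(** The k-vector iota_1 al /\ iota_2 be of the product space. *)
Definition cross (al : kvec R k n1) (be : kvec R l n2) : kvec R m (n1 + n2) :=
  klin (fun M => klin (fun N => wedge (cross_rows M N)) be) al.

Lemma cross_linearl be : linear (cross^~ be).
Proof. exact: klin_is_linear. Qed.

Lemma cross_linearr al : linear (cross al).
Proof.
move=> a x y; rewrite /cross /klin scaler_sumr -big_split/=; apply: eq_bigr => I _.
have := klin_is_linear (fun N => wedge (cross_rows (basis_rows I) N)) a x y.
by rewrite /klin => ->; rewrite scalerDr !scalerA mulrC.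
Qed.

Context (U1 : set 'rV[R]_n1) (U2 : set 'rV[R]_n2).
Local Notation U12 := (setprod U1 U2).

Lemma setprod_row_mx p q : U1 p -> U2 q -> U12 (row_mx p q).
Proof. by rewrite /setprod/= row_mxKl row_mxKr. Qed.

Lemma cart_dirac_sum (A : dchain k U1) (B : dchain l U2) :
  cart_dirac e A B = \sum_(p <- fset_set (supp A)) \sum_(q <- fset_set (supp B))
    dpoint U12 (row_mx p q) (cross (A p) (B q)).
Proof.
rewrite /cart_dirac lin_ext_sum; apply: eq_bigr => p _.
transitivity (klin (fun M => \sum_(q <- fset_set (supp B))
    dpoint U12 (row_mx p q) (klin (fun N => wedge (cross_rows M N)) (B q))) (A p)).
  by congr klin; apply/funext => M; exact: lin_ext_dpoint_comp.
rewrite /klin; under eq_bigr do rewrite scaler_sumr.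
rewrite exchange_big/=; apply: eq_bigr => q _.
exact: (@klin_comp _ _ _ _ _ (dpoint U12 (row_mx p q))
  (fun M => klin (fun N => wedge (cross_rows M N)) (B q)) (A p) (@dpoint_linear _ _ _ _ _)).
Qed.

Lemma cart_dirac_val (A : dchain k U1) (B : dchain l U2) z :
  dval (cart_dirac e A B) z = cross (A (lsubmx z)) (B (rsubmx z)).
Proof.
rewrite cart_dirac_sum dval_sum -(@sum_supp _ _ U1 _ A (fun p al => cross al (B (rsubmx z)))).
  apply: eq_big_seq => p /supp_in Up; rewrite dval_sum.
  rewrite -(@sum_supp _ _ U2 _ B (fun q be => cross (A p) be)); last first.
    exact/linear0_of/cross_linearr.
  case: eqP => [zp|zp].
    apply: eq_big_seq => q /supp_in Uq; rewrite dval_dpoint; last exact: setprod_row_mx.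
    by rewrite -{1}[z]hsubmxK -zp; have -> : (row_mx (lsubmx z) (rsubmx z) == row_mx (lsubmx z) q)
       = (rsubmx z == q) by apply/eqP/eqP => [/eq_row_mx[]|->].
  rewrite big1_seq// => q /= /supp_in Uq; rewrite dval_dpoint; last exact: setprod_row_mx.
  by case: eqP => // zq; exfalso; apply: zp; rewrite zq row_mxKl.
exact: (linear0_of (cross_linearl _)).
Qed.

Lemma cart_dirac_linearl (B : dchain l U2) : linear (fun A : dchain k U1 => cart_dirac e A B).
Proof.
move=> a A A'; apply: dchain_eq => z; rewrite dval_lin !cart_dirac_val dval_lin.
exact: cross_linearl.
Qed.

Lemma cart_dirac_linearr (A : dchain k U1) : linear (fun B : dchain l U2 => cart_dirac e A B).
Proof.
move=> a B B'; apply: dchain_eq => z; rewrite dval_lin !cart_dirac_val dval_lin.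
exact: cross_linearr.
Qed.

Lemma cart_dirac_dpoint p al q be : U1 p -> U2 q ->
  cart_dirac e (dpoint U1 p al) (dpoint U2 q be) = dpoint U12 (row_mx p q) (cross al be).
Proof.
move=> Up Uq; apply: dchain_eq => z.
rewrite cart_dirac_val !dval_dpoint//; last exact: setprod_row_mx.
rewrite -{3}[z]hsubmxK.
have -> : (row_mx (lsubmx z) (rsubmx z) == row_mx p q) = (lsubmx z == p) && (rsubmx z == q).
  by apply/eqP/andP => [/eq_row_mx[-> ->]|[/eqP -> /eqP ->]].
case: eqP => _ /=; last exact: (linear0_of (cross_linearl _)).
by case: eqP => // _; exact/linear0_of/cross_linearr.
Qed.

Context (G1 : 'M[R]_n1) (G2 : 'M[R]_n2).
Hypotheses (GI1 : inner_product G1) (GI2 : inner_product G2).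
Local Notation G12 := (gram_prod G1 G2).

(** Uniform in the point [q]: the product with a point mass only adds a coordinate to
    the points and to the displacements. *)
Lemma cart_dirac_boundl r (be : kvec R l n2) : exists2 C, 0 < C & forall q, U2 q ->
  forall A, bnorm G12 r m U12 (cart_dirac e A (dpoint U2 q be)) <= C * bnorm G1 r k U1 A.
Proof.
have [C C0 HC] := mass_linear G12 GI1 (cross_linearl be).
exists C => // q Uq; apply: operator_bound => //; first exact: cart_dirac_linearl.
move=> A [[s p] al] tU tr At.
pose t' : dterm m := (map (fun u => row_mx u 0) s, row_mx p q, cross al be).
have DE z : Delta t' z = cross (Delta (s, p, al) (lsubmx z)) (fpoint q be (rsubmx z)).
  apply: (Delta_map (f := lsubmx) (g := fun u => row_mx u 0)
     (Phi := fun z x => cross x (fpoint q be (rsubmx z)))) => [z'|z' u|z' u|z'].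
  - exact: cross_linearl.
  - by rewrite linearB/= row_mxKr subr0.
  - by rewrite linearB/= row_mxKl.
  - rewrite !fpointE -{1}[z']hsubmxK.
    have -> : (row_mx (lsubmx z') (rsubmx z') == row_mx p q) = (lsubmx z' == p) && (rsubmx z' == q).
      by apply/eqP/andP => [/eq_row_mx[-> ->]|[/eqP -> /eqP ->]].
    case: eqP => _ /=; last by rewrite (linear0_of (cross_linearl _)).
    by case: eqP => // _; rewrite linear0_of//; exact: cross_linearr.
have suppD z : supp (Delta t') z -> supp (Delta (s, p, al)) (lsubmx z) /\ [set q] (rsubmx z).
  rewrite /supp/= DE => h; split.
    by apply: contra h => /eqP ->; rewrite (linear0_of (cross_linearl _)).
  by apply: contrapT => /eqP/negbTE zq; move: h; rewrite fpointE zq linear0_of ?eqxx//; exact: cross_linearr.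
apply: (@le_trans _ _ (cost G12 t')).
  apply: bnorm_le_cost1 => /=.
  - move=> z zh; split.
      by apply/tU/(hull_linear _ _ zh) => [|x /suppD[]//]; exact: linearP.
    have : hull [set q] (rsubmx z).
      by apply: (hull_linear _ _ zh) => [|x /suppD[]//]; exact: linearP.
    by move=> /hull_set1 ->.
  - by rewrite /dorder/= size_map.
  - apply/funext => z; rewrite DE cart_dirac_val At dval_dpoint//.
rewrite /cost/= big_map; under eq_bigr do rewrite vnorm_prodl.
rewrite mulrCA ler_wpM2l//.
by rewrite prodr_ge0// => u _; exact: sqrtr_ge0.
Qed.

(** The chain A is a finite sum of point masses; the constant depends on A through its
    support. *)
Lemma cart_dirac_boundr r s (A : dchain k U1) : (s <= r)%N -> exists2 C, 0 < C &
  forall B, bnorm G12 r m U12 (cart_dirac e A B) <= C * bnorm G2 s l U2 B.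
Proof.
move=> sr; suff H (ps : seq 'rV[R]_n1) : {in ps, forall p, U1 p} -> exists2 C, 0 < C &
    forall B, \sum_(p <- ps) bnorm G12 r m U12 (cart_dirac e (dpoint U1 p (A p)) B)
      <= C * bnorm G2 s l U2 B.
  have [|C C0 HC] := H (fset_set (supp A)); first by move=> p /supp_in.
  exists C => // B; apply: le_trans (HC B).
  by rewrite (linear_sum_dpoint A (cart_dirac_linearl B)); exact: snorm_sum.
elim: ps => [|p ps IH] psU.
  by exists 1 => // B; rewrite big_nil mul1r snorm_ge0.
have [|C1 C10 H1] := IH; first by move=> q qs; apply: psU; rewrite inE qs orbT.
have Up : U1 p by apply: psU; rewrite mem_head.
have [C C0 HC] := mass_linear G12 GI2 (cross_linearr (A p)).
exists (C + C1) => [|B]; first exact: addr_gt0.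
rewrite big_cons mulrDl; apply: lerD => //; move: B.
apply: operator_bound => //; first exact: cart_dirac_linearr.
move=> B [[us q] be] tU tr Bt.
pose t' : dterm m := (map (fun u => row_mx 0 u) us, row_mx p q, cross (A p) be).
have DE z : Delta t' z = cross (fpoint p (A p) (lsubmx z)) (Delta (us, q, be) (rsubmx z)).
  apply: (Delta_map (f := rsubmx) (g := fun u => row_mx 0 u)
     (Phi := fun z x => cross (fpoint p (A p) (lsubmx z)) x)) => [z'|z' u|z' u|z'].
  - exact: cross_linearr.
  - by rewrite linearB/= row_mxKl subr0.
  - by rewrite linearB/= row_mxKr.
  - rewrite !fpointE -{1}[z']hsubmxK.
    have -> : (row_mx (lsubmx z') (rsubmx z') == row_mx p q) = (lsubmx z' == p) && (rsubmx z' == q).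
      by apply/eqP/andP => [/eq_row_mx[-> ->]|[/eqP -> /eqP ->]].
    case: eqP => _ /=; last by rewrite (linear0_of (cross_linearl _)).
    by case: eqP => // _; rewrite linear0_of//; exact: cross_linearr.
have suppD z : supp (Delta t') z -> [set p] (lsubmx z) /\ supp (Delta (us, q, be)) (rsubmx z).
  rewrite /supp/= DE => h; split; last first.
    by apply: contra h => /eqP ->; rewrite linear0_of//; exact: cross_linearr.
  by apply: contrapT => /eqP/negbTE zq; move: h; rewrite fpointE zq (linear0_of (cross_linearl _)) eqxx.
apply: (@le_trans _ _ (cost G12 t')).
  apply: bnorm_le_cost1 => /=.
  - move=> z zh; split; last first.
      by apply/tU/(hull_linear _ _ zh) => [|x /suppD[]//]; exact: linearP.
    have : hull [set p] (lsubmx z).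
      by apply: (hull_linear _ _ zh) => [|x /suppD[]//]; exact: linearP.
    by move=> /hull_set1 ->.
  - by rewrite /dorder/= size_map; exact: leq_trans sr.
  - by apply/funext => z; rewrite DE cart_dirac_val Bt dval_dpoint.
rewrite /cost/= big_map; under eq_bigr do rewrite vnorm_prodr.
rewrite mulrCA ler_wpM2l//.
by rewrite prodr_ge0// => u _; exact: sqrtr_ge0.
Qed.

End Cartesian.

(** The k-th exterior power of v |-> v *m D. *)
Definition kmap k n m (D : 'M[R]_(n, m)) : kvec R k n -> kvec R k m :=
  klin (fun M => wedge (M *m D)).

Lemma kmap_linear k n m (D : 'M[R]_(n, m)) : linear (@kmap k n m D).
Proof. exact: klin_is_linear. Qed.

Lemma kmap_wedge k n m (D : 'M[R]_(n, m)) (M : 'M[R]_(k, n)) :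
  kmap D (wedge M) = wedge (M *m D).
Proof. by apply: klin_wedge; apply: alternating_mulmx; exact: alternating_wedge. Qed.

Lemma kvec_linear_eq k n (W : lmodType R) (f g : kvec R k n -> W) : linear f -> linear g ->
  (forall I : multi k n, f (wedge (basis_rows I)) = g (wedge (basis_rows I))) -> f =1 g.
Proof.
move=> fl gl fg al; rewrite (kvec_basis al) !linear_sum_of//; apply: eq_bigr => I _.
by rewrite !linearZ_of// fg.
Qed.

Lemma kmap_comp k n m p (D : 'M[R]_(n, m)) (E : 'M[R]_(m, p)) (al : kvec R k n) :
  kmap E (kmap D al) = kmap (D *m E) al.
Proof.
apply: (@kvec_linear_eq _ _ _ (fun al => kmap E (kmap D al))) => [a x y||I].
- by rewrite !kmap_linear.
- exact: kmap_linear.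
- by rewrite !kmap_wedge mulmxA.
Qed.

Lemma push_rowsE n m k (F : 'rV[R]_n -> 'rV[R]_m) p (M : 'M[R]_(k, n)) :
  \matrix_(i < k) 'd F p (row i M) = M *m lin1_mx ('d F p).
Proof. by apply/row_matrixP => i; rewrite row_mul mul_rV_lin1 rowK. Qed.

Lemma push_dirac_dpoint n m k (U : set 'rV[R]_n) (U' : set 'rV[R]_m) (F : 'rV[R]_n -> 'rV[R]_m)
    p (al : kvec R k n) : U p ->
  push_dirac U' F (dpoint U p al) = dpoint U' (F p) (kmap (lin1_mx ('d F p)) al).
Proof.
move=> Up; rewrite /push_dirac lin_ext_dpoint// /kmap -klin_comp; last exact: dpoint_linear.
by apply: eq_bigr => I _; rewrite push_rowsE.
Qed.

Lemma push_dirac_linear n m k (U : set 'rV[R]_n) (U' : set 'rV[R]_m) (F : 'rV[R]_n -> 'rV[R]_m) :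
  linear (@push_dirac R n m k U U' F).
Proof. exact: lin_ext_is_linear. Qed.

Definition unit1 : kvec R 1 1 := wedge (1%:M : 'M[R]_1).

(** Among the rows of the product only the last one has a time component, and it comes after
    k others. *)
Lemma contr_cross n k (G : 'M[R]_n) (al : kvec R k n) :
  contr (gram_prod G 1%:M) (e_time (R := R) (n := n)) (cross (addn1 k) al unit1)
  = (-1) ^+ k *: kmap (row_mx 1%:M 0) al.
Proof.
apply: (@kvec_linear_eq _ _ _ (fun al => contr _ _ (cross (addn1 k) al unit1))
   (fun al => (-1) ^+ k *: kmap (row_mx 1%:M 0) al)) => [a x y|a x y|I].
- by rewrite cross_linearl contr_linear.
- by rewrite kmap_linear scalerDr !scalerA mulrC.
rewrite kmap_wedge mul_mx_row mulmx1 mulmx0.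
have [I1 I1E] : exists I1 : multi 1 1, unit1 = wedge (basis_rows I1).
  pose F : {ffun 'I_1 -> 'I_1} := [ffun i => i].
  have P : [forall i : 'I_1, forall j : 'I_1, (i < j)%N ==> (F i < F j)%N].
    by apply/forallP => i; apply/forallP => j; rewrite !ord1.
  exists (exist _ F P : multi 1 1); congr wedge; apply/matrixP => i j.
  by rewrite !ord1 !mxE /= ffunE.
rewrite /cross klin_basis I1E klin_basis contr_wedge /contr_rows.
set N := cross_rows _ _ _.
have bI1 : basis_rows I1 = 1%:M :> 'M[R]_1.
  by apply/matrixP => i j; rewrite !ord1 !mxE eqxx (ord1 (val I1 0)).
have rN (i : 'I_k.+1) : row i N = if unlift ord_max i is Some i' then row_mx (row i' (basis_rows I)) 0
    else row_mx 0 1%:M.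
  case: unliftP => [i'|] ->; apply/rowP => j; rewrite !mxE castmxE/= cast_ord_id.
    rewrite (_ : cast_ord _ _ = lshift 1 i') ?col_mxEu; last exact/val_inj/lift_max.
    by rewrite [in LHS]mxE; case: splitP => a _; rewrite !mxE.
  rewrite (_ : cast_ord _ _ = rshift k 0) ?col_mxEd; last by apply/val_inj; rewrite /= addn0.
  by rewrite bI1 !mxE.
rewrite (bigD1 ord_max)//= big1 ?addr0 => [|i im].
  rewrite rN unlift_none /e_time vdot_prod /vdot !mul0mx mxE add0r mul1mx trmx1 mul1mx mxE mulr1.
  congr (_ *: wedge _); apply/row_matrixP => i.
  have -> : row i (row' ord_max N) = row (lift ord_max i) N by apply/rowP => j; rewrite !mxE.
  by rewrite rN liftK row_row_mx row0.
rewrite rN; case: unliftP im => [i' _ _|->]; last by rewrite eqxx.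
by rewrite /e_time vdot_prod /vdot !mul0mx trmx0 mulmx0 !mxE addr0 mulr0 scale0r.
Qed.

End ChainOperators.

(** * Calculus on the real line *)

Section Calculus.
Context {R : realType}.
Implicit Types a b c d e s t L T : R.

Lemma is_derive_coord m n (M : R -> 'M[R]_(m, n)) t v i j :
  is_derive t (1 : R) M v -> is_derive t (1 : R) (fun s => M s i j) (v i j).
Proof.
move=> [dM Mv]; have dMij := (derivable_mxP M t 1).1 dM i j.
by split=> //; rewrite -Mv (derive_mx dM) mxE.
Qed.

Lemma is_derive_mx m n (M : R -> 'M[R]_(m, n)) t (v : 'M[R]_(m, n)) :
  (forall i j, is_derive t (1 : R) (fun s => M s i j) (v i j)) -> is_derive t (1 : R) M v.
Proof.
move=> H; have dM : derivable M t 1 by apply/derivable_mxP => i j; have [] := H i j.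
by split=> //; rewrite (derive_mx dM); apply/matrixP => i j; rewrite mxE; have [] := H i j.
Qed.

Lemma is_derive_continuous (W : normedModType R) (f : R -> W) t v :
  is_derive t (1 : R) f v -> {for t, continuous f}.
Proof. by move=> [df _]; apply/differentiable_continuous/derivable1_diffP. Qed.

Lemma is_derive_within (W : normedModType R) (f f' : R -> W) a b :
  (forall t, a <= t <= b -> is_derive t (1 : R) f (f' t)) -> {within `[a, b], continuous f}.
Proof.
move=> H; apply: continuous_in_subspaceT => t; rewrite inE/= in_itv/= => tab.
exact: is_derive_continuous (H t tab).
Qed.

Lemma is_derive_scale (f : R -> R) c s (v : R) :
  is_derive (c * s) (1 : R) f v -> is_derive s (1 : R) (fun s => f (c * s)) (c * v).
Proof.
move=> fd; have cd : is_derive s (1 : R) (fun s => c * s) c.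
  by apply: is_derive_eq; rewrite scaler1.
by have := is_derive1_comp fd cd; rewrite /comp mulrC.
Qed.

Lemma is_derive_scale_mx m n (f : R -> 'M[R]_(m, n)) c s (v : 'M[R]_(m, n)) :
  is_derive (c * s) (1 : R) f v -> is_derive s (1 : R) (fun s => f (c * s)) (c *: v).
Proof.
move=> fd; apply: is_derive_mx => i j; rewrite mxE.
exact: (is_derive_scale (f := fun s => f s i j) (is_derive_coord i j fd)).
Qed.

Lemma real_mvt_ge0 (f f' : R -> R) a b : a <= b ->
  (forall t, a <= t <= b -> is_derive t (1 : R) f (f' t)) ->
  (forall t, a < t < b -> 0 <= f' t) -> f a <= f b.
Proof.
rewrite le_eqVlt => /orP[/eqP -> //|ab] fd f0.
have [||c] := @MVT _ f f' a b ab; first by move=> x /[!in_itv]/= /andP[ax xb]; apply: fd; rewrite !ltW.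
  exact: is_derive_within fd.
rewrite in_itv/= => cab e; rewrite -subr_ge0 e mulr_ge0 ?f0// subr_ge0 ltW//.
Qed.

(** The norm is the largest absolute value of an entry, so that real functions suffice. *)
Lemma mvt_le m n (f f' : R -> 'M[R]_(m, n)) (g g' : R -> R) a b : a <= b ->
  (forall t, a <= t <= b -> is_derive t (1 : R) f (f' t)) ->
  (forall t, a <= t <= b -> is_derive t (1 : R) g (g' t)) ->
  (forall t, a < t < b -> `|f' t| <= g' t) -> `|f b - f a| <= g b - g a.
Proof.
move=> ab fd gd fg.
have H (h h' : R -> R) : (forall t, a <= t <= b -> is_derive t (1 : R) h (h' t)) ->
    (forall t, a < t < b -> `|h' t| <= g' t) -> h b - h a <= g b - g a.
  move=> hd hg; rewrite lerBlDr addrAC -lerBlDr opprK -lerBrDr -subr_ge0.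
  have := @real_mvt_ge0 (fun t => g t - h t) (fun t => g' t - h' t) a b ab.
  have : forall t, a <= t <= b -> is_derive t (1 : R) (fun t => g t - h t) (g' t - h' t).
    by move=> t tab; have := gd t tab; have := hd t tab => h1 g1; exact: is_deriveB.
  move=> /[swap] /[apply] H; have : g a - h a <= g b - h b.
    by apply: H => t tab; rewrite subr_ge0; apply: le_trans (ler_norm _) (hg t tab).
  by lra.
have gab : 0 <= g b - g a.
  have := H (fun=> 0) (fun=> 0) (fun t _ => is_derive_cst _ _ _); rewrite subr0; apply=> t tab.
  by rewrite normr0; apply: le_trans (fg t tab).
apply: norm_coordP => // i j; rewrite !mxE ler_norml; apply/andP; split; last first.
  apply: (H (fun t => f t i j) (fun t => f' t i j)) => t tab; first exact/is_derive_coord/fd.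
  by apply: le_trans (fg t tab); exact: ler_coord_norm.
rewrite lerNl opprB.
have := H (fun t => - f t i j) (fun t => - f' t i j); rewrite opprK addrC; apply => t tab.
  by have := is_derive_coord i j (fd t tab) => d; exact: is_deriveN.
by rewrite normrN; apply: le_trans (fg t tab); exact: ler_coord_norm.
Qed.

Lemma is_derive_expR_scale (c d : R) s :
  is_derive s (1 : R) (fun s => d * expR (c * s)) (d * (c * expR (c * s))).
Proof.
have h : is_derive s (1 : R) (fun s => expR (c * s)) (c * expR (c * s)).
  exact: is_derive_scale (is_derive_expR _).
by have := is_deriveZ d h.
Qed.

(** Grönwall, with a crude constant: at the maximum of |f| against the weight
    exp (2 L t), integrating the hypothesis bounds the maximum by half of itself. *)
Lemma gronwall m n (f f' : R -> 'M[R]_(m, n)) L e T : 0 < L -> 0 <= e -> 0 <= T -> T <= 1 ->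
  (forall t, 0 <= t <= T -> is_derive t (1 : R) f (f' t)) ->
  (forall t, 0 < t < T -> `|f' t| <= L * `|f t| + e) ->
  forall t, 0 <= t <= T -> `|f t| <= 2 * (`|f 0| + e) * expR (2 * L).
Proof.
move=> L0 e0 T0 T1 fd ff t tT.
pose w s := `|f s| * expR (- (2 * L) * s).
have wc : {within `[0, T], continuous w}.
  apply: continuous_in_subspaceT => s; rewrite inE/= in_itv/= => sT.
  have fc := is_derive_continuous (fd s sT).
  apply: cvgM; first exact: cvg_norm fc.
  exact: is_derive_continuous (is_derive_scale (is_derive_expR _)).
have [c] := EVT_max T0 wc; rewrite in_itv/= => cT wmax.
have wE s : `|f s| = w s * expR (2 * L * s).
  by rewrite /w -mulrA -expRD mulNr addNr expR0 mulr1.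
have fle s : 0 <= s <= T -> `|f s| <= w c * expR (2 * L * s).
  by move=> sT; rewrite wE ler_wpM2r ?expR_ge0// wmax// in_itv.
have /andP[c0 cleT] := cT.
have gd s : is_derive s (1 : R) (fun s => w c / 2 * expR (2 * L * s) + e * s)
    (w c / 2 * (2 * L * expR (2 * L * s)) + e).
  have h1 := is_derive_expR_scale (2 * L) (w c / 2) s.
  have h2 : is_derive s (1 : R) (fun s => e * s) e by apply: is_derive_eq; rewrite scaler1.
  exact: is_deriveD.
have := @mvt_le _ _ f f' _ _ 0 c c0 _ (fun s _ => gd s) _.
have -> : (forall s, 0 <= s <= c -> is_derive s (1 : R) f (f' s)) <-> True.
  split=> // _ s /andP[s0 sc]; apply: fd; rewrite s0/=; exact: le_trans sc cleT.
move=> /(_ I); rewrite mulr0 expR0 mulr1 mulr0 addr0 => H.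
have {}H : `|f c - f 0| <= w c / 2 * expR (2 * L * c) + e * c - w c / 2.
  apply: H => s /andP[s0 sc].
  have sT : s < T by apply: lt_le_trans sc cleT.
  apply: le_trans (ff s _) _; first by rewrite s0 sT.
  rewrite lerD2r (_ : w c / 2 * _ = L * (w c * expR (2 * L * s))); last by field.
  by rewrite ler_pM2l// fle// !ltW.
have wc0 : 0 <= w c by rewrite mulr_ge0 ?expR_ge0.
have fc : `|f c| <= `|f 0| + `|f c - f 0|.
  by rewrite -{1}(subrK (f 0) (f c)) addrC; exact: ler_normD.
rewrite wE in fc.
have ec1 : 1 <= expR (2 * L * c).
  by rewrite -expR0 ler_expR; apply: mulr_ge0 => //; apply: mulr_ge0 => //; exact: ltW.
have wle : w c <= 2 * (`|f 0| + e).
  have ec : e * c <= e by rewrite ler_piMr// (le_trans cleT).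
  have f0 : 0 <= `|f 0| by [].
  have : w c * expR (2 * L * c) <= 2 * (`|f 0| + e) by nra.
  by apply: le_trans; rewrite ler_peMr.
apply: le_trans (fle _ tT) _; rewrite ler_pM ?expR_ge0//.
have /andP[t0 tT'] := tT.
by rewrite ler_expR; have := le_trans tT' T1; nra.
Qed.

(** The bound on the derivative is needed only as long as the curve has not left the
    ball, and the conclusion shows that it never does. *)
Lemma tube m n (f f' : R -> 'M[R]_(m, n)) L d : 0 < L ->
  (forall t, 0 <= t <= 1 -> is_derive t (1 : R) f (f' t)) ->
  (forall t, 0 <= t <= 1 -> `|f t| <= d -> `|f' t| <= L * `|f t|) ->
  2 * `|f 0| * expR (2 * L) < d ->
  forall t, 0 <= t <= 1 -> `|f t| <= 2 * `|f 0| * expR (2 * L).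
Proof.
move=> L0 fd ff fd0 t t01.
have G T : 0 <= T <= 1 -> (forall s, 0 < s < T -> `|f s| <= d) ->
    `|f T| <= 2 * `|f 0| * expR (2 * L).
  move=> /andP[T0 T1] dT; rewrite -[X in 2 * X]addr0; apply: (@gronwall _ _ f f' L 0 T) => //.
  - move=> s /andP[s0 sT]; apply: fd; rewrite s0/=; exact: le_trans T1.
  - move=> s sT; rewrite addr0; apply: ff; last exact: dT.
    by case/andP: sT => s0 sT; rewrite ltW//= (le_trans (ltW sT)).
  - by rewrite T0 lexx.
apply: (G) => // s /andP[s0 st]; rewrite leNgt; apply/negP => ds.
pose S := [set s | 0 <= s <= 1 /\ d <= `|f s|].
have Ss : S s.
  split; last exact: ltW.
  by rewrite ltW//=; case/andP: t01 => _; apply: le_trans; exact: ltW.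
have Slb : lbound S 0 by move=> x [/andP[]].
have Sinf : has_inf S by split; [exists s|exists 0].
pose T := inf S.
have T0 : 0 <= T by apply: lb_le_inf => //; exists s.
have T1 : T <= 1.
  apply: le_trans (_ : s <= 1); first by apply: ge_inf => //; exists 0.
  by case: Ss => /andP[].
have T01 : 0 <= T <= 1 by rewrite T0.
have fT : `|f T| < d.
  apply: le_lt_trans fd0; apply: (G) => // x /andP[x0 xT]; rewrite leNgt; apply/negP => dx.
  have : T <= x.
    apply: ge_inf; first by exists 0.
    by split; [rewrite ltW//= (le_trans (ltW xT))|exact: ltW].
  by rewrite leNgt xT.
have := is_derive_continuous (fd T T01) => /(cvg_norm (F := nbhs T)) => cn.
have /cvgrPdist_lt/(_ (d - `|f T|)) := cn; rewrite subr_gt0 => /(_ fT)/nbhs_ballP[e /= e0 He].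
have [x [x01 dx] xT] := inf_adherent e0 Sinf.
have : `| `|f T| - `|f x| | < d - `|f T|.
  apply: He; rewrite /ball/= ltr_norml; apply/andP; split.
    by move: xT; rewrite -/T; lra.
  apply: le_lt_trans (_ : 0 < e) => //; rewrite subr_le0; apply: ge_inf; first by exists 0.
  by split.
rewrite distrC => /(le_lt_trans (ler_norm _)); rewrite ltrD2r.
by rewrite ltNge dx.
Qed.

Lemma antiderivative_segment (g : R -> R) M : continuous g -> 0 < M ->
  exists F : R -> R, forall t, - M < t < M -> is_derive t (1 : R) F (g t).
Proof.
move=> gc M0; exists (fun x => \int[lebesgue_measure]_(t in `[- M, x]) g t)%R => t /andP[t1 t2].
have gi : lebesgue_measure.-integrable `[- M, M] (EFin \o g).
  apply: continuous_compact_integrable; first exact: segment_compact.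
  exact: continuous_subspaceT.
have [dF Fg] := continuous_FTC1_closed t2 gi t1 (gc t).
by split; [exact: dF|rewrite -Fg; exact/esym/derive1E].
Qed.

Lemma mvt_zero m n (f : R -> 'M[R]_(m, n)) a b : a <= b ->
  (forall t, a <= t <= b -> is_derive t (1 : R) f 0) -> f b = f a.
Proof.
move=> ab fd; suff : `|f b - f a| <= 0 - 0 by rewrite subrr normr_le0 subr_eq0 => /eqP.
apply: (mvt_le ab fd (g := fun=> 0) (fun t _ => is_derive_cst _ _ _)) => t _.
by rewrite normr0.
Qed.

(** The antiderivatives on the segments [-M, M] that vanish at 0 extend one another. *)
Lemma antiderivative (g : R -> R) : continuous g ->
  exists F : R -> R, F 0 = 0 /\ forall t, is_derive t (1 : R) F (g t).
Proof.
move=> gc; have /choice[A HA] M : exists F : R -> R, 0 < M -> forall t, - M < t < M ->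
    is_derive t (1 : R) F (g t).
  have [M0|M0] := ltP 0 M; last by exists (fun=> 0).
  by have [F HF] := antiderivative_segment gc M0; exists F.
pose F x := A (`|x| + 1) x - A (`|x| + 1) 0.
have FE M x : `|x| < M -> F x = A M x - A M 0.
  move=> xM; have M0 : 0 < M by apply: le_lt_trans xM.
  pose h t : 'M[R]_1 := const_mx (A (`|x| + 1) t - A M t).
  have hd t : `|t| <= `|x| -> is_derive t (1 : R) h 0.
    move=> tx; apply: is_derive_mx => i j; rewrite mxE.
    have -> : (fun s => h s i j) = (fun s => A (`|x| + 1) s - A M s).
      by apply/funext => s; rewrite mxE.
    have d1 : is_derive t (1 : R) (A (`|x| + 1)) (g t).
      apply: HA; first by rewrite ltr_wpDl.
      by rewrite -ltr_norml; apply: le_lt_trans tx _; rewrite ltrDl.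
    have d2 : is_derive t (1 : R) (A M) (g t).
      by apply: HA => //; rewrite -ltr_norml; apply: le_lt_trans tx _.
    by have := is_deriveB d1 d2; rewrite subrr.
  suff : h x = h 0.
    by move=> /matrixP/(_ 0 0); rewrite !mxE /F; lra.
  have [x0|x0] := leP 0 x.
    apply: mvt_zero x0 _ => t /andP[t0 tx]; apply: hd.
    by rewrite !ger0_norm// (le_trans t0).
  apply/esym; apply: mvt_zero (ltW x0) _ => t /andP[t0 tx]; apply: hd.
  by rewrite !ler0_norm ?lerN2// ltW.
exists F; split; first by rewrite /F subrr.
move=> t; have M0 : 0 < `|t| + 1 by rewrite ltr_wpDl.
have d1 : is_derive t (1 : R) (fun x => A (`|t| + 1) x - A (`|t| + 1) 0) (g t).
  have d2 : is_derive t (1 : R) (A (`|t| + 1)) (g t).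
    by apply: HA => //; rewrite -ltr_norml ltrDl.
  by have := is_deriveB d2 (is_derive_cst (A (`|t| + 1) 0) t 1); rewrite subr0.
apply: near_eq_is_derive d1.
near=> x; apply/esym/FE; near: x.
apply/nbhs_ballP; exists 1 => //= x; rewrite /ball/= => tx.
by rewrite -(subrK t x) addrC (le_lt_trans (ler_normD _ _))// ltrD2l distrC.
Unshelve. all: by end_near. Qed.

Lemma antiderivative_mx m n (g : R -> 'M[R]_(m, n)) : continuous g ->
  exists F : R -> 'M[R]_(m, n), F 0 = 0 /\ forall t, is_derive t (1 : R) F (g t).
Proof.
move=> gc; have H (ij : 'I_m * 'I_n) : exists F : R -> R, F 0 = 0 /\
    forall t, is_derive t (1 : R) F (g t ij.1 ij.2).
  apply: antiderivative => t; apply: (@continuous_comp _ _ _ g (fun M : 'M[R]_(m, n) => M ij.1 ij.2)).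
    exact: gc.
  exact: coord_continuous.
have /choice[F HF] := H.
exists (fun t => \matrix_(i, j) F (i, j) t); split.
  by apply/matrixP => i j; rewrite !mxE; have [] := HF (i, j).
move=> t; apply: is_derive_mx => i j; under eq_fun do rewrite mxE.
by have [_] := HF (i, j); exact.
Qed.

(** The weight exp (2 L |s|) makes the Picard operator contract by one half. *)
Lemma exp_weight_bound m n (z z' : R -> 'M[R]_(m, n)) L c : 0 < L -> z 0 = 0 ->
  (forall s, is_derive s (1 : R) z (z' s)) ->
  (forall s, `|z' s| <= 2 * L * c * expR (2 * L * `|s|)) ->
  forall s, `|z s| <= c * expR (2 * L * `|s|).
Proof.
move=> L0 z0 zd zb s.
have c0 : 0 <= c.
  have := le_trans (normr_ge0 _) (zb 0); rewrite normr0 mulr0 expR0 mulr1.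
  by rewrite pmulr_rge0// mulr_gt0.
have [s0|s0] := leP 0 s.
  have := @mvt_le _ _ z z' _ _ 0 s s0 (fun t _ => zd t)
    (fun t _ => is_derive_expR_scale (2 * L) c t).
  rewrite z0 subr0 mulr0 expR0 mulr1 (ger0_norm s0) => H.
  apply: le_trans (H _) _; last by rewrite lerBlDr lerDl.
  move=> t /andP[t0 _]; apply: le_trans (zb t) _; rewrite (ger0_norm (ltW t0)).
  by rewrite le_eqVlt; apply/orP; left; apply/eqP; ring.
have := @mvt_le _ _ z z' _ _ s 0 (ltW s0) (fun t _ => zd t)
    (fun t _ => is_derive_expR_scale (- (2 * L)) (- c) t).
rewrite z0 sub0r normrN mulr0 expR0 mulr1 (ler0_norm (ltW s0)) => H.
have -> : 2 * L * - s = - (2 * L) * s by ring.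
apply: le_trans (H _) _; last by lra.
move=> t /andP[_ t0]; apply: le_trans (zb t) _; rewrite (ler0_norm (ltW t0)).
have -> : 2 * L * - t = - (2 * L) * t by ring.
by rewrite le_eqVlt; apply/orP; left; apply/eqP; ring.
Qed.

Lemma geometric_tail (V : lmodType R) (N : seminorm V) (u : nat -> V) D :
  (forall i, N (u i.+1 - u i) <= D / 2 ^+ i) ->
  forall i j, (i <= j)%N -> N (u j - u i) <= 2 * D / 2 ^+ i.
Proof.
move=> uD i j; have D0 : 0 <= D.
  by have := le_trans (snorm_ge0 _ _) (uD 0); rewrite expr0 divr1.
suff H : (i <= j)%N -> N (u j - u i) <= 2 * D / 2 ^+ i - 2 * D / 2 ^+ j.
  by move=> /H h; apply: le_trans h _; rewrite lerBlDr lerDl mulr_ge0 ?mulr_ge0.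
elim: j => [|j IH]; first by rewrite leqn0 => /eqP ->; rewrite !subrr snorm0.
rewrite leq_eqVlt => /orP[/eqP ->|/IH h]; first by rewrite !subrr snorm0.
rewrite -(subrKA (u j)); apply: le_trans (snorm_triangle _ _ _) _.
apply: le_trans (lerD (uD j) h) _; rewrite exprS.
by rewrite le_eqVlt; apply/orP; left; apply/eqP; field; rewrite !expf_neq0.
Qed.

Lemma pow2_small D e : 0 < e -> exists m, forall i, (m <= i)%N -> D / 2 ^+ i < e.
Proof.
move=> e0; pose m := Num.truncn (`|D| / e); exists m => i mi.
rewrite ltr_pdivrMr ?exprn_gt0//; apply: le_lt_trans (ler_norm _) _.
rewrite mulrC -ltr_pdivrMr//; apply: lt_le_trans (truncnS_gt _) _.
by rewrite -natrX ler_nat; apply: leq_trans (ltn_expl i (isT : 1 < 2)%N).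
Qed.

Lemma geometric_cauchy (V : lmodType R) (N : seminorm V) (u : nat -> V) D :
  (forall i, N (u i.+1 - u i) <= D / 2 ^+ i) ->
  forall e, 0 < e -> exists m, forall i j, (m <= i)%N -> (m <= j)%N -> N (u i - u j) < e.
Proof.
move=> uD e e0; have [m Hm] := pow2_small (2 * D) e0; exists m => i j mi mj.
have [ij|ji] := leqP i j; last by apply: le_lt_trans (geometric_tail uD (ltnW ji)) _; exact: Hm.
by rewrite snormB_sym; apply: le_lt_trans (geometric_tail uD ij) _; exact: Hm.
Qed.

Definition mx_seminorm m n : seminorm 'M[R]_(m, n) :=
  Seminorm (@ler_normD R 'M[R]_(m, n)) (@normrZ R 'M[R]_(m, n)).

Lemma cauchy_cvg_mx m n (u : nat -> 'M[R]_(m, n)) :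
  (forall e, 0 < e -> exists m, forall i j, (m <= i)%N -> (m <= j)%N -> `|u i - u j| < e) ->
  exists l : 'M[R]_(m, n), forall e, 0 < e -> exists m, forall i, (m <= i)%N -> `|u i - l| < e.
Proof.
move=> H; have /cvg_ex[l ul] : cvg (u i @[i --> \oo]).
  apply/cauchy_cvgP/cauchy_exP => e e0; have [k Hk] := H e e0.
  by exists (u k), k => // j kj; rewrite mx_norm_ball /ball_/=; apply: Hk.
exists l => e e0; have /cvgrPdist_lt/(_ e e0)[k _ Hk] := ul.
by exists k => i ki; rewrite distrC; exact: Hk.
Qed.

Section Picard.
Context {m n : nat} (W : R -> 'M[R]_(m, n) -> 'M[R]_(m, n)) (L B : R) (y0 : 'M[R]_(m, n)).
Hypothesis L0 : 0 < L.
Hypothesis Wc : forall y, continuous y -> continuous (fun s => W s (y s)).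
Hypothesis WL : forall s x x', `|W s x - W s x'| <= L * `|x - x'|.
Hypothesis WB : forall s, `|W s y0| <= B.

Lemma picard_step (y : R -> 'M[R]_(m, n)) : continuous y ->
  exists z, z 0 = y0 /\ forall s, is_derive s (1 : R) z (W s (y s)).
Proof.
move=> /Wc/antiderivative_mx[F [F0 Fd]]; exists (fun s => y0 + F s); rewrite F0 addr0; split=> // s.
by have := is_deriveD (is_derive_cst y0 s 1) (Fd s); rewrite add0r.
Qed.

(** The steps of the iteration that starts at the constant y0 decrease geometrically for the
    weight exp (2 L |s|), hence it converges uniformly on bounded sets. *)
Lemma picard : exists y : R -> 'M[R]_(m, n), y 0 = y0 /\
  forall s, is_derive s (1 : R) y (W s (y s)).
Proof.
have /choice[P HP] (y : R -> 'M[R]_(m, n)) : exists z, continuous y ->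
    z 0 = y0 /\ forall s, is_derive s (1 : R) z (W s (y s)).
  have [yc|yc] := pselect (continuous y); last by exists y.
  by have [z Hz] := picard_step yc; exists z.
pose Y i := iter i P (fun=> y0).
have dc (z z' : R -> 'M[R]_(m, n)) : (forall s, is_derive s (1 : R) z (z' s)) -> continuous z.
  by move=> zd s; exact: is_derive_continuous (zd s).
have Yc i : continuous (Y i).
  elim: i => [|i IH]; first by move=> s; exact: cvg_cst.
  by have [_ h] := HP _ IH; exact: dc h.
have Y0 i : Y i.+1 0 = y0 by have [] := HP _ (Yc i).
have Yd i s : is_derive s (1 : R) (Y i.+1) (W s (Y i s)).
  by have [_] := HP _ (Yc i); exact.
pose D := B / (2 * L); pose w s := expR (2 * L * `|s|).
have B0 : 0 <= B by apply: le_trans (WB 0).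
have w1 s : 1 <= w s.
  by rewrite -expR0 ler_expR; apply: mulr_ge0 => //; apply: mulr_ge0 => //; exact: ltW.
have YD i s : `|Y i.+1 s - Y i s| <= D / 2 ^+ i * w s.
  elim: i s => [|i IH] s.
    have zd t : is_derive t (1 : R) (fun s => Y 1%N s - y0) (W t y0).
      by have := is_deriveB (Yd 0%N t) (is_derive_cst y0 t 1); rewrite subr0.
    apply: (exp_weight_bound L0 _ zd) => [|t]; first by rewrite Y0 subrr.
    rewrite expr0 divr1 (_ : 2 * L * D = B); last by rewrite /D; field; rewrite gt_eqF.
    by apply: le_trans (WB t) _; rewrite ler_peMr// w1.
  have zd t : is_derive t (1 : R) (fun s => Y i.+2 s - Y i.+1 s) (W t (Y i.+1 t) - W t (Y i t)).
    exact: is_deriveB.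
  apply: (exp_weight_bound L0 _ zd) => [|t]; first by rewrite !Y0 subrr.
  apply: le_trans (WL _ _ _) _; apply: le_trans (_ : _ <= L * (D / 2 ^+ i * w t)) _.
    by rewrite ler_pM2l.
  by rewrite /w exprS le_eqVlt; apply/orP; left; apply/eqP; field; rewrite expf_neq0.
have YDw s i : mx_seminorm m n (Y i.+1 s - Y i s) <= (D * w s) / 2 ^+ i.
  by apply: le_trans (YD i s) _; rewrite mulrAC.
have /choice[y Hy] s := cauchy_cvg_mx (geometric_cauchy (YDw s)).
have yY s i : `|y s - Y i s| <= 2 * (D * w s) / 2 ^+ i.
  apply/ler_addgt0Pl => e e0; have [k Hk] := Hy s _ e0.
  rewrite -(subrKA (Y (maxn i k) s)); apply: le_trans (ler_normD _ _) _; apply: lerD.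
    by rewrite distrC ltW// Hk// leq_maxr.
  exact: (geometric_tail (YDw s) (leq_maxl i k)).
have yc : continuous y.
  move=> s; apply/cvgrPdist_lt => e e0.
  pose ws := expR (2 * L * (`|s| + 1)).
  have [k Hk] := pow2_small (2 * (D * ws)) (divr_gt0 e0 (ltr0Sn _ 2)).
  have wle t : `|s - t| < 1 -> w t <= ws.
    move=> st; rewrite /w /ws ler_expR ler_pM2l ?mulr_gt0//.
    rewrite -{1}(subrK s t) addrC; apply: le_trans (ler_normD _ _) _.
    by rewrite lerD2l distrC ltW.
  have D0 : 0 <= D by rewrite divr_ge0// mulr_ge0// ltW.
  have yYe t : `|s - t| < 1 -> `|y t - Y k t| < e / 3.
    move=> st; apply: le_lt_trans (yY t k) _; apply: le_lt_trans (Hk k (leqnn k)).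
    rewrite ler_pM2r ?invr_gt0 ?exprn_gt0// ler_pM2l// ler_wpM2l//; exact: wle.
  have /cvgrPdist_lt/(_ _ (divr_gt0 e0 (ltr0Sn _ 2))) := Yc k s.
  move=> Yn; near=> t.
  have st : `|s - t| < 1 by near: t; apply: (@cvgr_dist_lt _ _ _ (nbhs s) _ id s).
  have -> : y s - y t = (y s - Y k s) + ((Y k s - Y k t) + (Y k t - y t)).
    by rewrite !subrKA.
  have -> : e = e / 3 + (e / 3 + e / 3) by field.
  apply: le_lt_trans (ler_normD _ _) _; apply: ltrD; first by apply: yYe; rewrite subrr normr0.
  apply: le_lt_trans (ler_normD _ _) _; apply: ltrD; last by rewrite distrC; exact: yYe.
  by near: t.
have [F [F0 Fd]] := picard_step yc.
suff Fy : F = y by exists y; split=> [|s]; [rewrite -Fy|rewrite -{1}Fy; exact: Fd].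
apply/funext => s; apply/eqP; rewrite -subr_eq0 -normr_le0; apply/ler_addgt0Pl => e e0; rewrite addr0.
have FY i : `|F s - Y i.+1 s| <= D / 2 ^+ i * w s.
  have zd t : is_derive t (1 : R) (fun s => F s - Y i.+1 s) (W t (y t) - W t (Y i t)).
    exact: is_deriveB.
  apply: (exp_weight_bound L0 _ zd) => [|t]; first by rewrite Y0 F0 subrr.
  apply: le_trans (WL _ _ _) _; apply: le_trans (_ : _ <= L * (2 * (D * w t) / 2 ^+ i)) _.
    by rewrite ler_pM2l.
  by rewrite /w le_eqVlt; apply/orP; left; apply/eqP; field; rewrite expf_neq0.
have [k1 H1] := pow2_small (D * w s) (divr_gt0 e0 (ltr0Sn _ 1)).
have [k2 H2] := Hy s _ (divr_gt0 e0 (ltr0Sn _ 1)).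
pose k := maxn k1 k2.
rewrite -(subrKA (Y k.+1 s)) (splitr e); apply: le_trans (ler_normD _ _) _; apply: lerD.
  apply: le_trans (FY k) _; rewrite mulrAC ltW// H1// leq_maxl//.
by rewrite ltW// H2// (leq_trans (leq_maxr k1 k2)).
Unshelve. all: by end_near. Qed.

End Picard.

(** The theorem of Heine, for pairs of points of which only one has to be in the compact
    set. *)
Lemma uniform_on_compact (V W : normedModType R) (K : set V) (f : V -> W) : compact K ->
  (forall x, K x -> {for x, continuous f}) ->
  forall e, 0 < e -> exists2 d, 0 < d &
    forall x y, K x -> `|y - x| < d -> `|f y - f x| < e.
Proof.
move=> /compact_near_coveringP Kc fc e e0.
have := Kc _ (0^'+) (fun d x => forall y, `|y - x| < d -> `|f y - f x| < e) _ _.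
case=> [x Kx|d /= d0 Hd]; last first.
  exists (d / 2); first by rewrite divr_gt0.
  move=> x y Kx yx; apply: (Hd (d / 2)) => //=; last by rewrite divr_gt0.
  by rewrite /ball/= sub0r normrN gtr0_norm ?divr_gt0//; lra.
have /cvgrPdist_lt/(_ _ (divr_gt0 e0 (ltr0Sn _ 1)))/nbhs_ballP[d /= d0 Hd] := fc x Kx.
have {}Hd y : `|x - y| < d -> `|f x - f y| < e / 2 by move=> xy; apply: Hd; rewrite -ball_normE.
exists (ball x (d / 2), [set t | 0 < t < d / 2]) => [|[x' t] /= [xx' /andP[t0 td]] y yx'].
  split=> /=; first by apply: nbhsx_ballx; rewrite divr_gt0.
  near=> t; apply/andP; split; first by near: t; exact: nbhs_right_gt.
  by near: t; apply: nbhs_right_lt; rewrite divr_gt0.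
move: xx'; rewrite -ball_normE /= => xx'.
rewrite -(subrKA (f x)) (splitr e); apply: le_lt_trans (ler_normD _ _) _; apply: ltrD.
  rewrite distrC; apply: Hd; rewrite -(subrKA x') (splitr d).
  apply: le_lt_trans (ler_normD _ _) _; apply: ltrD => //; rewrite distrC; exact: lt_trans td.
by apply: Hd; apply: lt_trans xx' _; lra.
Unshelve. all: by end_near. Qed.

(** Mean value theorem on each piece, and uniform continuity of the derivative. *)
Lemma riemann_sum_cvg (f g : R -> R) a b : a <= b ->
  (forall t, a <= t <= b -> is_derive t (1 : R) f (g t)) ->
  (forall t, a <= t <= b -> {for t, continuous g}) ->
  forall e, 0 < e -> exists m, forall k, (m <= k)%N ->
    `|\sum_(j < k.+1) (b - a) / k.+1%:R * g (a + j%:R * ((b - a) / k.+1%:R)) - (f b - f a)| < e.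
Proof.
move=> ab fd gc e e0; have ba0 : 0 <= b - a by rewrite subr_ge0.
have e'0 : 0 < e / (b - a + 1) by rewrite divr_gt0// ltr_wpDl.
have gc' t : `[a, b]%classic t -> {for t, continuous g}.
  by rewrite /= in_itv/=; exact: gc.
have [d d0 Hd] := uniform_on_compact (@segment_compact R a b) gc' e'0.
exists (Num.truncn ((b - a) / d)) => k mk; set h := (b - a) / k.+1%:R.
have k0 : 0 < k.+1%:R :> R by rewrite ltr0n.
have h0 : 0 <= h by rewrite divr_ge0// ltW.
have hd : h < d.
  rewrite ltr_pdivrMr// mulrC -ltr_pdivrMr//; apply: lt_le_trans (truncnS_gt _) _.
  by rewrite ler_nat ltnS.
have kh : k.+1%:R * h = b - a by rewrite mulrC divfK// gt_eqF.
pose t (j : nat) := a + j%:R * h.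
have tle j : (j <= k.+1)%N -> a <= t j <= b.
  move=> jk; rewrite lerDl mulr_ge0//= -lerBrDl -kh ler_wpM2r// ler_nat//.
have tel : f b - f a = \sum_(j < k.+1) (f (t j.+1) - f (t j)).
  rewrite -(big_mkord xpredT (fun j => f (t j.+1) - f (t j))) telescope_sumr//.
  by rewrite /t kh mul0r addr0 [a + _]addrC subrK.
rewrite tel -sumrB; apply: le_lt_trans (ler_norm_sum _ _ _) _.
apply: (@le_lt_trans _ _ (\sum_(j < k.+1) h * (e / (b - a + 1)))).
  apply: ler_sum => j _; have tj1 : t j.+1 - t j = h by rewrite /t -natr1; ring.
  have tjj : t j <= t j.+1 by rewrite -subr_ge0 tj1.
  have /andP[atj _] := tle j (ltnW (ltn_ord j)); have /andP[_ tjb] := tle j.+1 (ltn_ord j).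
  have fd' s : t j <= s <= t j.+1 -> is_derive s (1 : R) f (g s).
    by move=> /andP[s1 s2]; apply: fd; rewrite (le_trans atj)//= (le_trans s2).
  have [c|c] := @MVT_segment _ f g _ _ tjj _ (is_derive_within fd').
    by rewrite in_itv/= => /andP[c1 c2]; apply: fd'; rewrite !ltW.
  rewrite in_itv/= tj1 => /andP[c1 c2] ->; rewrite [g c * h]mulrC -mulrBr normrM (ger0_norm h0).
  rewrite ler_wpM2l// distrC ltW//; apply: (Hd (t j) c).
    by rewrite /= in_itv/=; apply: tle; exact: ltnW.
  by rewrite ger0_norm ?subr_ge0//; apply: le_lt_trans hd; rewrite -tj1 lerD2r.
rewrite sumr_const card_ord -[_ *+ k.+1]mulr_natl mulrA kh mulrCA -ltr_pdivlMl//.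
rewrite mulVf ?gt_eqF// ltr_pdivrMr ?ltr_wpDl// mul1r; lra.
Qed.

End Calculus.

(** * Differentiability in normed spaces *)

Section Differentiability.
Context {R : realType}.
Implicit Types e d s t : R.

Lemma differentiable_eps (V W : normedModType R) (F : V -> W) (L : {linear V -> W}) x :
  continuous L ->
  (forall e, 0 < e -> exists2 d, 0 < d & forall u, `|u| < d -> `|F (x + u) - F x - L u| <= e * `|u|) ->
  differentiable F x /\ forall u, 'd F x u = L u.
Proof.
move=> Lc H; have E : F \o shift x = cst (F x) + L +o_ 0 id.
  apply/eqaddoP => e e0; have [d d0 Hd] := H e e0.
  apply/nbhs_ballP; exists d => // u; rewrite -ball_normE/= sub0r normrN => ud.
  rewrite -[leLHS]/(`|F (u + x) - (F x + L u)|) opprD addrA [u + x]addrC.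
  exact: Hd.
have dE : 'd F x = L :> (V -> W) by exact: diff_unique.
by split=> [|u]; [apply/diff_locallyP; rewrite dE|rewrite dE].
Qed.

Lemma differentiable_epsP (V W : normedModType R) (F : V -> W) x : differentiable F x ->
  forall e, 0 < e -> exists2 d, 0 < d & forall u, `|u| < d ->
    `|F (x + u) - F x - 'd F x u| <= e * `|u|.
Proof.
move=> /diff_locallyP[_ /eqaddoP H] e e0.
have /nbhs_ballP[d /= d0 Hd] := H e e0; exists d => // u ud.
have := Hd u; rewrite -ball_normE/= sub0r normrN => /(_ ud).
by rewrite -[leLHS]/(`|F (u + x) - (F x + 'd F x u)|) opprD addrA [u + x]addrC.
Qed.

Lemma lipschitz_continuous_at (V W : normedModType R) (f : V -> W) C x :
  (forall y, `|f x - f y| <= C * `|x - y|) -> {for x, continuous f}.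
Proof.
move=> fC; apply/cvgrPdist_lt => e e0.
have C0 : 0 < `|C| + 1 by rewrite ltr_wpDl.
near=> y; apply: le_lt_trans (fC y) _; apply: (@le_lt_trans _ _ ((`|C| + 1) * `|x - y|)).
  by rewrite ler_wpM2r// (le_trans (ler_norm _))// lerDl.
rewrite mulrC -ltr_pdivlMr//; near: y.
by apply: (@cvgr_dist_lt _ _ _ (nbhs x) _ id x) => //; rewrite divr_gt0.
Unshelve. all: by end_near. Qed.

Lemma continuous_sum (V W : normedModType R) (I : Type) (r : seq I) (f : I -> V -> W) x :
  (forall i, {for x, continuous (f i)}) ->
  {for x, continuous (fun y => \sum_(i <- r) f i y)}.
Proof.
move=> fc; elim: r => [|i r IH].
  have -> : (fun y => \sum_(j <- [::]) f j y) = (fun=> 0) by apply/funext => y; rewrite big_nil.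
  exact: cvg_cst.
have -> : (fun y => \sum_(j <- i :: r) f j y) = (fun y => f i y + \sum_(j <- r) f j y).
  by apply/funext => y; rewrite big_cons.
by apply: continuousD => //; exact: fc.
Qed.

Lemma continuous_mulmx_right m n p (D : 'M[R]_(n, p)) : continuous (fun u : 'M[R]_(m, n) => u *m D).
Proof.
move=> u; apply: (@lipschitz_continuous_at _ _ _ (n%:R * `|D|)) => v.
by rewrite -mulmxBl mulrAC; exact: norm_mulmx.
Qed.

Lemma differentiable_eps_mx n m (F : 'rV[R]_n -> 'rV[R]_m) (D : 'M[R]_(n, m)) x :
  (forall e, 0 < e -> exists2 d, 0 < d & forall u, `|u| < d -> `|F (x + u) - F x - u *m D| <= e * `|u|) ->
  differentiable F x /\ forall u, 'd F x u = u *m D.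
Proof. by move=> H; apply: (@differentiable_eps _ _ F (mulmxr D)) => //; exact: continuous_mulmx_right. Qed.

Lemma is_derive_differentiable (W : normedModType R) (f : R -> W) t v :
  is_derive t (1 : R) f v -> differentiable f t /\ forall s, 'd f t s = s *: v.
Proof.
move=> [df fv]; have dft : differentiable f t by exact/derivable1_diffP.
split=> // s; rewrite -fv deriveE// -linearZ; congr ('d f t _).
by rewrite /GRing.scale/= mulr1.
Qed.

Lemma is_derive_chain (V W : normedModType R) (g : R -> V) (F : V -> W) t v :
  is_derive t (1 : R) g v -> differentiable F (g t) ->
  is_derive t (1 : R) (fun s => F (g s)) ('d F (g t) v).
Proof.
move=> gd Fd; have [dg gE] := is_derive_differentiable gd.
have dFg : differentiable (F \o g) t by exact: differentiable_comp.
split; first exact/derivable1_diffP.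
by rewrite deriveE// diff_comp//= gE scale1r.
Qed.

Lemma is_derive_line (V W : normedModType R) (F : V -> W) p w t :
  differentiable F (p + t *: w) ->
  is_derive t (1 : R) (fun s => F (p + s *: w)) ('d F (p + t *: w) w).
Proof.
move=> Fd; apply: (is_derive_chain (g := fun s => p + s *: w)) => //.
have h : is_derive t (1 : R) (fun s : R => s *: w) w.
  have [hd hv] := is_diff_scalel t w.
  by split; [exact/derivable1_diffP|rewrite deriveE// hv scale1r].
by have := is_deriveD (is_derive_cst p t 1) h; rewrite add0r.
Qed.

End Differentiability.

(** * The flow of a vector field *)

Section Flow.
Context {R : realType} {n : nat}.
Implicit Types (U : set 'rV[R]_n) (V : 'rV[R]_n -> 'rV[R]_n) (e d s t : R).

(** Vectors are rows, so that matrices act on them from the right. *)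
Definition jac V (x : 'rV[R]_n) : 'M[R]_n := \matrix_(i, j) ('D_(delta_mx 0 i) V x) 0 j.

Lemma jacE V x v : differentiable V x -> 'd V x v = v *m jac V x.
Proof.
move=> Vd; rewrite -mul_rV_lin1; congr (_ *m _).
by apply/matrixP => i j; rewrite !mxE deriveE.
Qed.

Definition C1_on U V := (forall p, U p -> differentiable V p) /\
  (forall p, U p -> {for p, continuous (jac V)}).

Lemma continuous_mx (T : normedModType R) m p (M : T -> 'M[R]_(m, p)) x :
  (forall i j, {for x, continuous (fun y => M y i j)}) -> {for x, continuous M}.
Proof.
move=> Mc; apply/cvgrPdist_lt => e e0.
have H (ij : 'I_m * 'I_p) : \forall y \near x, `|M x ij.1 ij.2 - M y ij.1 ij.2| < e / 2.
  by have /cvgrPdist_lt/(_ _ (divr_gt0 e0 (ltr0Sn _ 1))) := Mc ij.1 ij.2.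
have {}H : \forall y \near x, forall ij : 'I_m * 'I_p, `|M x ij.1 ij.2 - M y ij.1 ij.2| < e / 2.
  exact: filter_forall.
move: H; apply: filterS => y Hy; apply: (@le_lt_trans _ _ (e / 2)); last by lra.
apply: norm_coordP => [|i j]; first by rewrite divr_ge0// ltW.
by rewrite !mxE; exact/ltW/(Hy (i, j)).
Qed.

Lemma Cr_continuous m r U (F : 'rV[R]_n -> 'rV[R]_m) p : Cr r U F -> U p -> {for p, continuous F}.
Proof.
by case: r => [|r] /= FC Up; [exact: FC|have [Fd _] := FC; exact/differentiable_continuous/Fd].
Qed.

Lemma Cr_C1_on r U V : (1 <= r)%N -> Cr r U V -> C1_on U V.
Proof.
case: r => // r _ [Vd Vc]; split=> // p Up; apply: (@continuous_mx 'rV[R]_n) => i j.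
have -> : (fun y => jac V y i j) = (fun y => ('D_(delta_mx 0 i) V y) 0 j).
  by apply/funext => y; rewrite mxE.
have := Cr_continuous (Vc (delta_mx 0 i)) Up.
move=> h; apply: (@continuous_comp _ _ _ _ (fun M : 'rV[R]_n => M 0 j)) => //.
exact: coord_continuous.
Qed.

Lemma compact_in_open (W : normedModType R) (K A : set W) : compact K -> open A -> K `<=` A ->
  exists2 d, 0 < d & forall x y, K x -> `|y - x| < d -> A y.
Proof.
move=> Kc Ao KA; pose f (y : W) : R^o := if y \in A then 0 else 1.
have fc x : K x -> {for x, continuous f}.
  move=> /KA Ax; apply/cvgrPdist_lt => e e0.
  have : \forall y \near x, A y by exact: open_nbhs_nbhs.
  apply: filterS => y Ay; rewrite /f !mem_set// subrr normr0//.
have [d d0 Hd] := uniform_on_compact Kc fc (@ltr01 R).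
exists d => // x y Kx yx; have := Hd x y Kx yx.
rewrite /f (mem_set (KA x Kx)) subr0; case: ifPn => [yA _|_]; first exact: set_mem.
by rewrite normr1 ltxx.
Qed.

Section Tube.
Context (U : set 'rV[R]_n) (V : 'rV[R]_n -> 'rV[R]_n) (gam : R -> 'rV[R]_n) (s0 s1 : R).
Hypotheses (Uo : open U) (VC : C1_on U V) (s01 : s0 <= s1).
Hypothesis (gU : forall s, s0 <= s <= s1 -> U (gam s)).
Hypothesis (gc : forall s, s0 <= s <= s1 -> {for s, continuous gam}).

(** Uniform continuity of the derivative near the compact image of the curve, and the mean
    value theorem on segments. *)
Lemma tube_data : exists d L, [/\ 0 < d, 0 < L,
  forall s w, s0 <= s <= s1 -> `|w| <= d -> U (gam s + w),
  forall s w w', s0 <= s <= s1 -> `|w| <= d -> `|w'| <= d ->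
    `|V (gam s + w) - V (gam s + w')| <= L * `|w - w'| &
  (forall s, s0 <= s <= s1 -> `|jac V (gam s)| <= L) /\
  forall e, 0 < e -> exists2 c, 0 < c & forall s w, s0 <= s <= s1 -> `|w| < c ->
    `|V (gam s + w) - V (gam s) - w *m jac V (gam s)| <= e * `|w|].
Proof.
have [Vd Jc] := VC; pose K := gam @` `[s0, s1].
have gc' : {within `[s0, s1], continuous gam}.
  by apply: continuous_in_subspaceT => s; rewrite inE/= in_itv/=; exact: gc.
have Kc : compact K by apply: continuous_compact gc' _; exact: segment_compact.
have KU : K `<=` U by move=> _ [s + <-]; rewrite /= in_itv/=; exact: gU.
have Kg s : s0 <= s <= s1 -> K (gam s) by move=> ss; exists s => //; rewrite /= in_itv.
have [d1 d10 Hd1] := compact_in_open Kc Uo KU.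
have JcK x : K x -> {for x, continuous (jac V)} by move=> /KU; exact: Jc.
have [d2 d20 Hd2] := uniform_on_compact Kc JcK (@ltr01 R).
have [M M0 HM] : exists2 M, 0 <= M & forall s, s0 <= s <= s1 -> `|jac V (gam s)| <= M.
  pose h s := `|jac V (gam s)|.
  have hc : {within `[s0, s1], continuous h}.
    apply: continuous_in_subspaceT => s; rewrite inE/= in_itv/= => ss.
    apply: (@continuous_comp _ _ _ (jac V \o gam) (fun M => `|M|)); last exact: norm_continuous.
    by apply: continuous_comp; [exact: gc|exact/Jc/gU].
  have [c _ Hc] := EVT_max s01 hc.
  by exists (h c) => [|s ss]; [exact: normr_ge0|apply: Hc; rewrite in_itv].
pose d := Num.min d1 d2 / 2.
have d0 : 0 < d by rewrite divr_gt0// lt_min d10.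
have dd1 : d < d1.
  by have : Num.min d1 d2 <= d1; [rewrite ge_min lexx|move: d0; rewrite /d; lra].
have dd2 : d < d2.
  by have : Num.min d1 d2 <= d2; [rewrite ge_min lexx orbT|move: d0; rewrite /d; lra].
pose L := n%:R * (M + 1) + M + 1.
have L0 : 0 < L by rewrite ltr_wpDl// addr_ge0// mulr_ge0// addr_ge0.
have inU s w : s0 <= s <= s1 -> `|w| <= d -> U (gam s + w).
  move=> ss wd; apply: (Hd1 (gam s)); first exact: Kg.
  by rewrite [gam s + w]addrC addrK; exact: le_lt_trans dd1.
have inJ s w : s0 <= s <= s1 -> `|w| <= d -> `|jac V (gam s + w)| <= M + 1.
  move=> ss wd; rewrite -(subrK (jac V (gam s)) (jac V _)) addrC.
  apply: le_trans (ler_normD _ _) _; apply: lerD; first exact: HM.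
  apply/ltW/Hd2; first exact: Kg.
  by rewrite [gam s + w]addrC addrK; exact: le_lt_trans dd2.
have convex w w' t c : 0 <= t <= 1 -> `|w| <= c -> `|w'| <= c -> `|w' + t *: (w - w')| <= c.
  move=> /andP[t0 t1] wc wc'.
  have -> : w' + t *: (w - w') = t *: w + (1 - t) *: w'.
    by rewrite scalerBr scalerBl scale1r addrCA addrA.
  apply: le_trans (ler_normD _ _) _; rewrite !normrZ ger0_norm// ger0_norm ?subr_ge0//.
  have := ler_wpM2l t0 wc; have : (1 - t) * `|w'| <= (1 - t) * c by rewrite ler_wpM2l// subr_ge0.
  by lra.
exists d, L; split=> //.
- move=> s w w' ss wd wd'.
  pose f t := V (gam s + w' + t *: (w - w')).
  pose f' t := (w - w') *m jac V (gam s + w' + t *: (w - w')).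
  have lineE t : gam s + w' + t *: (w - w') = gam s + (w' + t *: (w - w')) by rewrite addrA.
  have fd t : 0 <= t <= 1 -> is_derive t (1 : R) f (f' t).
    move=> t01; have Ut : U (gam s + w' + t *: (w - w')).
      by rewrite lineE; apply: inU => //; exact: convex.
    by rewrite /f' -jacE; [apply: is_derive_line|]; exact: Vd.
  pose c := n%:R * `|w - w'| * (M + 1).
  have gd t : 0 <= t <= 1 -> is_derive t (1 : R) (fun t => c * t) c.
    by move=> _; apply: is_derive_eq; rewrite scaler1.
  have := mvt_le ler01 fd gd; rewrite /f scale1r scale0r addr0.
  have -> : gam s + w' + (w - w') = gam s + w by rewrite -addrA [w' + _]addrC subrK.
  rewrite mulr1 mulr0 subr0 => H; apply: le_trans (H _) _.
    move=> t /andP[t0 t1]; apply: le_trans (norm_mulmx _ _) _; rewrite /c ler_wpM2l ?mulr_ge0//.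
    by rewrite lineE; apply: inJ => //; apply: convex => //; rewrite !ltW.
  rewrite /c mulrAC ler_wpM2r// /L -addrA lerDl addr_ge0//.
- split=> [s ss|e e0].
    apply: le_trans (HM s ss) _; rewrite /L -addrA addrCA lerDl addr_ge0// mulr_ge0// addr_ge0//.
  have e'0 : 0 < e / (n%:R + 1) by rewrite divr_gt0// ltr_wpDl.
  have [d3 d30 Hd3] := uniform_on_compact Kc JcK e'0.
  exists (Num.min d d3) => [|s w ss]; first by rewrite lt_min d0.
  rewrite lt_min => /andP[wd wd3]; set J := jac V (gam s).
  have small t : 0 <= t <= 1 -> `|t *: w| <= `|w|.
    by move=> /andP[t0 t1]; rewrite normrZ ger0_norm// ler_piMl.
  pose f t := V (gam s + t *: w) - t *: (w *m J).
  pose f' t := w *m jac V (gam s + t *: w) - w *m J.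
  have fd t : 0 <= t <= 1 -> is_derive t (1 : R) f (f' t).
    move=> t01; have Ut : U (gam s + t *: w).
      by apply: inU => //; apply: le_trans (small t t01) _; exact: ltW.
    have h1 : is_derive t (1 : R) (fun t => V (gam s + t *: w)) (w *m jac V (gam s + t *: w)).
      by rewrite -jacE; [apply: is_derive_line|]; exact: Vd.
    have h2 : is_derive t (1 : R) (fun t : R => t *: (w *m J)) (w *m J).
      have [hd hv] := is_diff_scalel t (w *m J).
      by split; [exact/derivable1_diffP|rewrite deriveE// hv scale1r].
    exact: is_deriveB.
  have gd t : 0 <= t <= 1 -> is_derive t (1 : R) (fun t => e * `|w| * t) (e * `|w|).
    by move=> _; apply: is_derive_eq; rewrite scaler1.
  have := mvt_le ler01 fd gd; rewrite /f !scale1r !scale0r addr0 subr0.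
  rewrite mulr1 mulr0 subr0 addrAC => H; apply: H => t /andP[t0 t1].
  rewrite /f' -mulmxBr; apply: le_trans (norm_mulmx _ _) _.
  rewrite mulrAC ler_wpM2r//.
  have t01 : 0 <= t <= 1 by rewrite !ltW.
  have : `|jac V (gam s + t *: w) - J| < e / (n%:R + 1).
    apply: Hd3; first exact: Kg.
    by rewrite [gam s + _]addrC addrK; exact: le_lt_trans (small t t01) _.
  have n0 : 0 <= n%:R :> R by [].
  rewrite ltr_pdivlMr ?ltr_wpDl// => h.
  by have := normr_ge0 (jac V (gam s + t *: w) - J); nra.
Qed.

End Tube.

(** The retraction of the line onto [lo, hi]. *)
Definition clampr (lo hi x : R) := Num.max lo (Num.min x hi).

Lemma clampr_in lo hi x : lo <= hi -> lo <= clampr lo hi x <= hi.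
Proof. by move=> lh; rewrite /clampr le_max lexx/= ge_max lh ge_min lexx orbT. Qed.

Lemma clampr_id lo hi x : lo <= x <= hi -> clampr lo hi x = x.
Proof. by move=> /andP[lx xh]; rewrite /clampr min_l// max_r. Qed.

Lemma clampr_lip lo hi x y : `|clampr lo hi x - clampr lo hi y| <= `|x - y|.
Proof.
wlog xy : x y / x <= y => [H|].
  by have [/H//|/ltW/H] := leP x y; rewrite distrC [leRHS]distrC.
rewrite distrC [leRHS]distrC [leRHS]ger0_norm ?subr_ge0// /clampr ler_norml.
by case: (leP x hi); case: (leP y hi); case: (leP lo x); case: (leP lo y); case: (leP lo hi);
   rewrite /Num.max/Num.min; do ?case: ifP; lra.
Qed.

Definition clampv (d : R) m (w : 'rV[R]_m) : 'rV[R]_m := \row_j clampr (- d) d (w 0 j).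

Lemma clampv_norm d m (w : 'rV[R]_m) : 0 <= d -> `|clampv d w| <= d.
Proof.
move=> d0; apply: norm_coordP => // i j; rewrite mxE ler_norml clampr_in//.
by rewrite ge0_cp.
Qed.

Lemma clampv_id d m (w : 'rV[R]_m) : `|w| <= d -> clampv d w = w.
Proof.
move=> wd; apply/rowP => j; rewrite mxE clampr_id// -ler_norml.
exact: le_trans (ler_coord_norm w 0 j) wd.
Qed.

Lemma clampv_lip d m (w w' : 'rV[R]_m) : `|clampv d w - clampv d w'| <= `|w - w'|.
Proof.
apply: norm_coordP => // i j; rewrite !mxE; apply: le_trans (clampr_lip _ _ _ _) _.
by have := ler_coord_norm (w - w') 0 j; rewrite !mxE.
Qed.

Section Solutions.
Context (U : set 'rV[R]_n) (V : 'rV[R]_n -> 'rV[R]_n).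
Hypotheses (Uo : open U) (VC : C1_on U V).

Definition integral_curve (gam : R -> 'rV[R]_n) s0 s1 :=
  forall s, s0 <= s <= s1 -> U (gam s) /\ is_derive s (1 : R) gam (V (gam s)).

Lemma integral_curve_tube gam s0 s1 : s0 <= s1 -> integral_curve gam s0 s1 ->
  exists d L, [/\ 0 < d, 0 < L,
  forall s w, s0 <= s <= s1 -> `|w| <= d -> U (gam s + w),
  forall s w w', s0 <= s <= s1 -> `|w| <= d -> `|w'| <= d ->
    `|V (gam s + w) - V (gam s + w')| <= L * `|w - w'| &
  (forall s, s0 <= s <= s1 -> `|jac V (gam s)| <= L) /\
  forall e, 0 < e -> exists2 c, 0 < c & forall s w, s0 <= s <= s1 -> `|w| < c ->
    `|V (gam s + w) - V (gam s) - w *m jac V (gam s)| <= e * `|w|].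
Proof.
move=> s01 gS; apply: tube_data => // s ss; first by have [] := gS s ss.
by have [_ /is_derive_continuous] := gS s ss.
Qed.

Lemma scale_between s0 s1 c t : s0 <= 0 <= s1 -> s0 <= c <= s1 -> 0 <= t <= 1 ->
  s0 <= c * t <= s1.
Proof. by move=> /andP[? ?] /andP[? ?] /andP[? ?]; apply/andP; split; nra. Qed.

Lemma scale_between_strict s0 s1 c t : s0 < 0 < s1 -> s0 < c < s1 -> 0 <= t <= 1 ->
  s0 < c * t < s1.
Proof.
move=> /andP[? ?] /andP[? ?] /andP[t0 t1]; have [c0|c0] := leP 0 c.
  have h1 : 0 <= c * t by rewrite mulr_ge0.
  have h2 : c * t <= c by rewrite ler_piMr.
  by apply/andP; split; lra.
have h1 : c * t <= 0 by rewrite mulr_le0_ge0// ltW.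
have h2 : c <= c * t by nra.
by apply/andP; split; lra.
Qed.

(** The difference of the two curves starts at 0 and cannot leave it. The time c t, with t
    in [0, 1], covers both signs of c. *)
Lemma integral_curve_unique gam sig s0 s1 c : s0 <= 0 <= s1 -> s0 <= c <= s1 ->
  integral_curve gam s0 s1 -> gam 0 = sig 0 ->
  (forall t, 0 <= t <= 1 -> is_derive (c * t) (1 : R) sig (V (sig (c * t)))) ->
  gam c = sig c.
Proof.
move=> h0 hc gS gs0 sd; have s01 : s0 <= s1 by case/andP: h0; exact: le_trans.
have [d [L [d0 L0 _ VL _]]] := integral_curve_tube s01 gS.
pose z t := sig (c * t) - gam (c * t).
pose z' t := c *: V (sig (c * t)) - c *: V (gam (c * t)).
have zd t : 0 <= t <= 1 -> is_derive t (1 : R) z (z' t).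
  move=> t01; have [_ gd] := gS _ (scale_between h0 hc t01).
  by apply: is_deriveB; apply: is_derive_scale_mx => //; exact: sd.
have L'0 : 0 < `|c| * L + 1 by rewrite ltr_wpDl// mulr_ge0// ltW.
have zb t : 0 <= t <= 1 -> `|z t| <= d -> `|z' t| <= (`|c| * L + 1) * `|z t|.
  move=> t01 ztd; rewrite /z' -scalerBr normrZ.
  have := VL _ (z t) 0 (scale_between h0 hc t01) ztd.
  have -> : gam (c * t) + z t = sig (c * t) by rewrite /z addrC subrK.
  rewrite normr0 addr0 subr0 => /(_ (ltW d0)) h.
  by have := ler_wpM2l (normr_ge0 c) h; have := normr_ge0 (z t); lra.
have z00 : z 0 = 0 by rewrite /z mulr0 gs0 subrr.
have := tube L'0 zd zb; rewrite z00 normr0 mulr0 mul0r => /(_ d0 1).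
by rewrite ler01 lexx => /(_ isT); rewrite normr_le0 subr_eq0 mulr1 => /eqP.
Qed.

Lemma solution_integral_curve t p gam : solution V U t p gam ->
  exists s0 s1, [/\ s0 < Num.min 0 t, Num.max 0 t < s1, gam 0 = p & integral_curve gam s0 s1].
Proof.
move=> [al [be [alt tbe g0 gS]]].
exists ((al + Num.min 0 t) / 2), ((Num.max 0 t + be) / 2); split=> //; [lra|lra|].
move=> s /andP[s0 s1]; apply: gS; apply/andP; split; lra.
Qed.

Lemma flow_eq t p gam : solution V U t p gam -> flow V U t p = gam t.
Proof.
move=> gS; rewrite /flow.
have [sig [[al [be [alt tbe sig0 sS]]] ->]] := xgetPex p
  (P := [set x | exists gam, solution V U t p gam /\ x = gam t]) (ex_intro _ _ (ex_intro _ gam (conj gS erefl))).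
have [s0 [s1 [s0t ts1 g0 gI]]] := solution_integral_curve gS.
apply/esym; apply: (@integral_curve_unique _ _ s0 s1).
- by move: s0t ts1; rewrite lt_min gt_max => /andP[? _] /andP[? _]; rewrite !ltW.
- by move: s0t ts1; rewrite lt_min gt_max => /andP[_ ?] /andP[_ ?]; rewrite !ltW.
- exact: gI.
- by rewrite g0.
- move=> x /andP[x0 x1]; have [] := sS (t * x); last by [].
  move: alt tbe; rewrite lt_min gt_max => /andP[al0 alt] /andP[be0 tbe].
  by apply: scale_between_strict; rewrite ?al0 ?alt ?x0.
Qed.

Section Family.
Context (gam : R -> 'rV[R]_n) (s0 s1 : R).
Hypotheses (s00 : s0 < 0) (s10 : 0 < s1) (gS : integral_curve gam s0 s1).

Let s01 : s0 <= s1. Proof. by rewrite ltW// (lt_trans s00). Qed.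

(** The neighbouring curves are gam + y, where y solves the equation of the difference.
    Its field is made globally Lipschitz by clamping the time to the segment and y to
    a ball, and y is too small for the clamping to matter. *)
Lemma flow_family : exists d K (y : 'rV[R]_n -> R -> 'rV[R]_n), [/\ 0 < d, 0 < K &
  forall u, `|u| < d -> [/\ y u 0 = u,
    forall s, s0 <= s <= s1 -> `|y u s| <= K * `|u|,
    forall s, s0 < s < s1 -> is_derive s (1 : R) (y u) (V (gam s + y u s) - V (gam s)) &
    forall s, s0 < s < s1 -> flow V U s (gam 0 + u) = gam s + y u s]].
Proof.
have [r [L [r0 L0 inU VL _]]] := integral_curve_tube s01 gS.
pose W s (x : 'rV[R]_n) := V (gam (clampr s0 s1 s) + clampv r x) - V (gam (clampr s0 s1 s)).
have cin s : s0 <= clampr s0 s1 s <= s1 by exact: clampr_in.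
have cr x : `|clampv r x| <= r by apply: clampv_norm; exact: ltW.
have r00 : `|0 : 'rV[R]_n| <= r by rewrite normr0 ltW.
have [Vd _] := VC.
have gcl : continuous (fun s => gam (clampr s0 s1 s)).
  move=> s; apply: (@continuous_comp _ _ _ (clampr s0 s1) gam).
    by apply: (@lipschitz_continuous_at _ _ _ _ 1) => x; rewrite mul1r; exact: clampr_lip.
  by have [_ /is_derive_continuous] := gS (cin s).
have Wc (x : R -> 'rV[R]_n) : continuous x -> continuous (fun s => W s (x s)).
  move=> xc s; apply: (@continuousB _ _ R).
    apply: (@continuous_comp _ _ _ (fun s => gam (clampr s0 s1 s) + clampv r (x s)) V).
      apply: (@continuousD _ _ R); first exact: gcl.
      apply: (@continuous_comp _ _ _ x (@clampv r n)); first exact: xc.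
      by apply: (@lipschitz_continuous_at _ 'rV[R]_n 'rV[R]_n _ 1) => w; rewrite mul1r; exact: clampv_lip.
    by apply/differentiable_continuous/Vd; exact: inU.
  apply: (@continuous_comp _ _ _ (fun s => gam (clampr s0 s1 s)) V); first exact: gcl.
  by apply/differentiable_continuous/Vd; have [] := gS (cin s).
have WL s x x' : `|W s x - W s x'| <= L * `|x - x'|.
  rewrite /W opprB subrKA; apply: le_trans (VL _ _ _ (cin s) (cr _ x) (cr _ x')) _.
  by rewrite ler_pM2l//; exact: clampv_lip.
have WB s u : `|W s u| <= L * r.
  rewrite /W -[X in _ - V X]addr0; apply: le_trans (VL _ _ _ (cin s) (cr _ u) r00) _.
  by rewrite subr0 ler_pM2l.
have /choice[y Hy] u := picard L0 Wc WL (WB^~ u).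
pose M := Num.max (- s0) s1; have M0 : 0 < M by rewrite lt_max s10 orbT.
have Mle s : s0 <= s <= s1 -> `|s| <= M.
  move=> /andP[? ?]; rewrite ler_norml /M lerNl !le_max; apply/andP; split.
    by apply/orP; left; rewrite lerN2.
  by apply/orP; right.
pose K := 2 * expR (2 * (M * L)); have K0 : 0 < K by rewrite mulr_gt0// expR_gt0.
have yK u s : s0 <= s <= s1 -> `|y u s| <= K * `|u|.
  move=> ss; have [y0 yd] := Hy u.
  pose z t := y u (s * t); pose z' t := s *: W (s * t) (y u (s * t)).
  have zd t : 0 <= t <= 1 -> is_derive t (1 : R) z (z' t).
    by move=> _; apply: is_derive_scale_mx; exact: yd.
  have zb t : 0 < t < 1 -> `|z' t| <= M * L * `|z t| + 0.
    move=> _; rewrite addr0 /z' normrZ -mulrA; apply: ler_pM => //; first exact: Mle.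
    have := WL (s * t) (y u (s * t)) 0; rewrite subr0 {2}/W.
    have -> : clampv r 0 = 0 :> 'rV[R]_n by rewrite clampv_id.
    by rewrite addr0 subrr subr0.
  have := @gronwall _ _ _ z z' (M * L) 0 1 (mulr_gt0 M0 L0) (lexx _) ler01 (lexx _) zd zb 1.
  rewrite ler01 lexx /z mulr1 mulr0 y0 addr0 => /(_ isT) h; apply: le_trans h _.
  by rewrite /K mulrAC.
have d0 : 0 < r / K by rewrite divr_gt0.
exists (r / K), K, y; split=> // u; rewrite ltr_pdivlMr// mulrC => ud.
have [y0 yd] := Hy u.
have yr s : s0 <= s <= s1 -> `|y u s| <= r by move=> ss; apply: le_trans (yK u s ss) (ltW ud).
have yd' s : s0 < s < s1 -> is_derive s (1 : R) (y u) (V (gam s + y u s) - V (gam s)).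
  move=> /andP[s0s ss1]; have ss : s0 <= s <= s1 by rewrite !ltW.
  by have := yd s; rewrite /W (clampr_id ss) (clampv_id (yr s ss)).
split; [exact: y0|exact: yK|exact: yd'|] => s /andP[s0s ss1].
have h : solution V U s (gam 0 + u) (fun s => gam s + y u s); last exact: (flow_eq h).
exists s0, s1; split.
- by rewrite lt_min s00.
- by rewrite gt_max s10.
- by rewrite y0.
- move=> x /andP[x0 x1]; have xx : s0 <= x <= s1 by rewrite !ltW.
  split; first by apply: inU => //; exact: yr.
  have [_ gd] := gS xx.
  have x01 : s0 < x < s1 by rewrite x0.
  by have := is_deriveD gd (yd' x x01); rewrite addrCA subrr addr0.
Qed.

(** The equation is linear, hence globally Lipschitz once the time is clamped to the
    segment. *)
Lemma variation : exists Y : R -> 'M[R]_n, Y 0 = 1%:M /\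
  forall s, s0 <= s <= s1 -> is_derive s (1 : R) Y (Y s *m jac V (gam s)).
Proof.
have [r [L [r0 L0 inU VL [JL _]]]] := integral_curve_tube s01 gS.
pose W s (X : 'M[R]_n) := X *m jac V (gam (clampr s0 s1 s)).
have cin s : s0 <= clampr s0 s1 s <= s1 by exact: clampr_in.
have [_ Jc] := VC.
have nL0 : 0 < n%:R * L + 1 by rewrite ltr_wpDl// mulr_ge0// ltW.
have Wc (x : R -> 'M[R]_n) : continuous x -> continuous (fun s => W s (x s)).
  move=> xc s; apply: continuous_mx => i j.
  have -> : (fun s => W s (x s) i j) = (fun s => \sum_(l < n) x s i l * jac V (gam (clampr s0 s1 s)) l j).
    by apply/funext => t; rewrite mxE.
  apply: (@continuous_sum _ _ R) => l; apply: cvgM.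
    by apply: (@continuous_comp _ _ _ x (fun M : 'M[R]_n => M i l)); [exact: xc|exact: coord_continuous].
  apply: (@continuous_comp _ _ _ (fun s => jac V (gam (clampr s0 s1 s))) (fun M : 'M[R]_n => M l j)); last exact: coord_continuous.
  apply: (@continuous_comp _ _ _ (fun s => gam (clampr s0 s1 s)) (jac V)).
    apply: (@continuous_comp _ _ _ (clampr s0 s1) gam).
      by apply: (@lipschitz_continuous_at _ _ _ _ 1) => t; rewrite mul1r; exact: clampr_lip.
    by have [_ /is_derive_continuous] := gS (cin s).
  by apply: Jc; have [] := gS (cin s).
have Wn s X : `|W s X| <= (n%:R * L + 1) * `|X|.
  apply: le_trans (norm_mulmx _ _) _; rewrite mulrAC ler_wpM2r//.
  by rewrite ler_wpDr// ler_wpM2l// JL.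
have WL s x x' : `|W s x - W s x'| <= (n%:R * L + 1) * `|x - x'| by rewrite /W -mulmxBl; exact: Wn.
have [Y [Y0 Yd]] := picard nL0 Wc WL (fun s => Wn s 1%:M).
exists Y; split; first exact: Y0.
by move=> s ss; have := Yd s; rewrite /W (clampr_id ss).
Qed.

(** The difference of a neighbouring curve and its linear approximation solves the
    variation equation up to an error that is small with respect to the displacement. *)
Lemma flow_linearization (Y : R -> 'M[R]_n) d K (y : 'rV[R]_n -> R -> 'rV[R]_n) :
  0 < d -> 0 < K -> Y 0 = 1%:M ->
  (forall s, s0 <= s <= s1 -> is_derive s (1 : R) Y (Y s *m jac V (gam s))) ->
  (forall u, `|u| < d -> [/\ y u 0 = u,
    forall s, s0 <= s <= s1 -> `|y u s| <= K * `|u| &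
    forall s, s0 < s < s1 -> is_derive s (1 : R) (y u) (V (gam s + y u s) - V (gam s))]) ->
  forall e, 0 < e -> exists2 c, 0 < c & forall u s, `|u| < c -> s0 < s < s1 ->
    `|y u s - u *m Y s| <= e * `|u|.
Proof.
move=> d0 K0 Y0 Yd Hy e e0.
have [r [L [r0 L0 inU VL [JL Vlin]]]] := integral_curve_tube s01 gS.
pose M := Num.max (- s0) s1; have M0 : 0 < M by rewrite lt_max s10 orbT.
have Mle s : s0 <= s <= s1 -> `|s| <= M.
  move=> /andP[? ?]; rewrite ler_norml /M lerNl !le_max; apply/andP; split.
    by apply/orP; left; rewrite lerN2.
  by apply/orP; right.
pose N := M * (n%:R * L + 1); have N0 : 0 < N.
  by rewrite mulr_gt0// ltr_wpDl// mulr_ge0// ltW.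
pose E := expR (2 * N); have E0 : 0 < E by rewrite expR_gt0.
pose e' := e / (2 * M * K * E); have e'0 : 0 < e' by rewrite divr_gt0// !mulr_gt0.
have [c c0 Hc] := Vlin _ e'0.
exists (Num.min d (c / K)) => [|u s]; first by rewrite lt_min d0 divr_gt0.
rewrite lt_min ltr_pdivlMr// => /andP[ud uc] /andP[s0s ss1].
have [y0 yK yd] := Hy u ud.
have ss : s0 <= s <= s1 by rewrite !ltW.
pose z t := y u (s * t) - u *m Y (s * t).
pose z' t := s *: (V (gam (s * t) + y u (s * t)) - V (gam (s * t))) - s *: (u *m (Y (s * t) *m jac V (gam (s * t)))).
have uYd t : s0 <= t <= s1 -> is_derive t (1 : R) (fun t => u *m Y t) (u *m (Y t *m jac V (gam t))).
  move=> tt; apply: is_derive_mx => i j.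
  have -> : (fun t => (u *m Y t) i j) = \sum_(l < n) (fun t => u i l * Y t l j).
    by apply/funext => x; rewrite fct_sumE mxE.
  rewrite mxE; apply: is_derive_sum => l.
  by have := is_deriveZ (u i l) (is_derive_coord l j (Yd t tt)).
have st t : 0 <= t <= 1 -> s0 < s * t < s1.
  by move=> t01; apply: scale_between_strict => //; rewrite ?s00 ?s0s.
have zd t : 0 <= t <= 1 -> is_derive t (1 : R) z (z' t).
  move=> t01; have /andP[h0 h1] := st t t01.
  apply: is_deriveB; first by apply: is_derive_scale_mx; apply: yd; rewrite h0.
  by apply: (is_derive_scale_mx (f := fun t => u *m Y t)); apply: uYd; rewrite !ltW.
have zb t : 0 < t < 1 -> `|z' t| <= N * `|z t| + M * (e' * (K * `|u|)).
  move=> /andP[t0 t1]; have t01 : 0 <= t <= 1 by rewrite !ltW.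
  have /andP[h0 h1] := st t t01; have hh : s0 <= s * t <= s1 by rewrite !ltW.
  rewrite /z' -scalerBr normrZ; set x := s * t in h0 h1 hh *.
  have -> : V (gam x + y u x) - V (gam x) - u *m (Y x *m jac V (gam x))
     = (V (gam x + y u x) - V (gam x) - y u x *m jac V (gam x)) + z t *m jac V (gam x).
    by rewrite /z -/x mulmxBl mulmxA [RHS]addrA subrK.
  have yc : `|y u x| < c by apply: le_lt_trans (yK x hh) _; rewrite mulrC.
  apply: (@le_trans _ _ (M * (e' * (K * `|u|) + (n%:R * L + 1) * `|z t|))); last first.
    by rewrite mulrDr addrC /N mulrA.
  apply: ler_pM => //; first exact: Mle.
  apply: le_trans (ler_normD _ _) _; apply: lerD.
    apply: le_trans (Hc x (y u x) hh yc) _; rewrite ler_pM2l//; exact: yK.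
  apply: le_trans (norm_mulmx _ _) _; rewrite mulrAC ler_wpM2r// ler_wpDr// ler_wpM2l// JL//.
have ee0 : 0 <= M * (e' * (K * `|u|)).
  by apply: mulr_ge0; [|apply: mulr_ge0; [|apply: mulr_ge0 => //]]; exact: ltW.
have := @gronwall _ _ _ z z' N _ 1 N0 ee0 ler01 (lexx _) zd zb 1.
rewrite ler01 lexx /z mulr1 mulr0 y0 Y0 mulmx1 subrr normr0 add0r => /(_ isT) h.
apply: le_trans h _; rewrite -/E /e' le_eqVlt; apply/orP; left; apply/eqP.
by field; rewrite !gt_eqF.
Qed.

End Family.

(** The linear approximation of the neighbouring curves is uniform in the time, and this
    makes the flow differentiable in the point and the time together. *)
Lemma flow_smooth p T : 0 <= T -> flow_dom V U T p ->
  exists s0 s1 (gam : R -> 'rV[R]_n) (Y : R -> 'M[R]_n),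
  [/\ s0 < 0, T < s1, gam 0 = p, Y 0 = 1%:M & forall s, s0 < s < s1 ->
    [/\ U (gam s), is_derive s (1 : R) gam (V (gam s)),
        is_derive s (1 : R) Y (Y s *m jac V (gam s)), flow V U s p = gam s &
        (forall u, 'd (flow V U s) p u = u *m Y s) /\
        (forall u, 'd (theta U V) (row_mx p s%:M) (row_mx u 0) = u *m Y s)]].
Proof.
move=> T0 [gam /solution_integral_curve[s0 [s1 [s0T Ts1 g0 gI]]]].
have s00 : s0 < 0 by move: s0T; rewrite lt_min => /andP[].
have s1T : T < s1 by move: Ts1; rewrite gt_max => /andP[].
have s10 : 0 < s1 by apply: le_lt_trans s1T.
have [Y [Y0 Yd]] := variation s00 s10 gI.
have [d [K [y [d0 K0 Hy]]]] := flow_family s00 s10 gI.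
have Hy' u : `|u| < d -> [/\ y u 0 = u,
    forall s, s0 <= s <= s1 -> `|y u s| <= K * `|u| &
    forall s, s0 < s < s1 -> is_derive s (1 : R) (y u) (V (gam s + y u s) - V (gam s))].
  by move=> /Hy[].
have lin := flow_linearization s00 s10 gI d0 K0 Y0 Yd Hy'.
exists s0, s1, gam, Y; split=> // s /andP[s0s ss1].
have ss : s0 <= s <= s1 by rewrite !ltW.
have [gU gd] := gI s ss; have Yds := Yd s ss.
have Fp x : s0 < x < s1 -> flow V U x p = gam x.
  move=> xx; have xx' : s0 <= x <= s1 by case/andP: xx => ? ?; rewrite !ltW.
  have [|_ yK _ yF] := Hy 0; first by rewrite normr0.
  have := yK x xx'; rewrite normr0 mulr0 normr_le0 => /eqP y0.
  by have := yF x xx; rewrite y0 !addr0 g0.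
have Fps : flow V U s p = gam s by apply: Fp; rewrite s0s.
split=> //; split=> u.
  have [|_ ->//] := @differentiable_eps_mx _ _ _ (flow V U s) (Y s) p.
  move=> e e0; have [c c0 Hc] := lin e e0.
  exists (Num.min c d) => [|v]; first by rewrite lt_min c0.
  rewrite lt_min => /andP[vc vd]; have [_ _ _ yF] := Hy v vd.
  rewrite -g0 yF ?s0s// g0 Fps [gam s + _]addrC addrK.
  by apply: Hc; rewrite ?s0s.
have [|_ ->] := @differentiable_eps_mx _ _ _ (theta U V) (col_mx (Y s) (V (gam s))) (row_mx p s%:M); last first.
  by rewrite mul_row_col mul0mx addr0.
move=> e e0; have e3 : 0 < e / 3 by rewrite divr_gt0.
have [c1 c10 H1] := lin _ e3.
have [gdiff gE] := is_derive_differentiable gd.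
have [c2 c20 H2] := differentiable_epsP gdiff e3.
have en0 : 0 < e / 3 / (n%:R + 1) by rewrite divr_gt0// ltr_wpDl.
have /cvgrPdist_lt/(_ _ en0)/nbhs_ballP[c3 /= c30 H3] := is_derive_continuous Yds.
have [c4 c40 H4] : exists2 c4, 0 < c4 & forall t, `|t| < c4 -> s0 < s + t < s1.
  exists (Num.min (s1 - s) (s - s0)) => [|t]; first by rewrite lt_min !subr_gt0 ss1.
  rewrite lt_min !ltr_norml => /andP[/andP[? ?] /andP[? ?]]; apply/andP; split; lra.
exists (Num.min (Num.min c1 c2) (Num.min (Num.min c3 c4) d)) => [|v].
  by rewrite !lt_min c10 c20 c30 c40 d0.
rewrite !lt_min => /andP[/andP[v1 v2] /andP[/andP[v3 v4] vd]].
pose w := lsubmx v; pose t := rsubmx v 0 0.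
have wv : `|w| <= `|v|.
  by apply: norm_coordP => // i j; rewrite mxE; exact: ler_coord_norm.
have tv : `|t| <= `|v| by rewrite /t mxE; exact: ler_coord_norm.
have vE : v = row_mx w t%:M.
  rewrite -[LHS]hsubmxK; congr row_mx; apply/matrixP => i j.
  by rewrite !ord1 [RHS]mxE eqxx mulr1n.
have thE x q : theta U V (row_mx q x%:M) = flow V U x q.
  by rewrite /theta /time row_mxKl row_mxKr mxE eqxx mulr1n.
have stt : s0 < s + t < s1 by apply: H4; exact: le_lt_trans tv v4.
have [_ _ _ yF] := Hy w (le_lt_trans wv vd).
have -> : row_mx p s%:M + v = row_mx (p + w) (s + t)%:M.
  by rewrite raddfD /= -add_row_mx -vE.
have -> : v *m col_mx (Y s) (V (gam s)) = w *m Y s + t *: V (gam s).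
  by rewrite [in LHS]vE mul_row_col mul_scalar_mx.
rewrite !thE Fps -g0 yF//.
have -> : gam (s + t) + y w (s + t) - gam s - (w *m Y s + t *: V (gam s))
   = (gam (s + t) - gam s - t *: V (gam s)) + ((y w (s + t) - w *m Y (s + t)) + w *m (Y (s + t) - Y s)).
  rewrite mulmxBr; move: (gam _) (y _ _) (w *m _) (w *m _) (t *: _) (gam _) => a b c f g h.
  by apply/rowP => i; rewrite !mxE; ring.
have -> : e * `|v| = e / 3 * `|v| + (e / 3 * `|v| + e / 3 * `|v|) by field.
apply: le_trans (ler_normD _ _) _; apply: lerD.
  rewrite -gE; apply: le_trans (H2 t (le_lt_trans tv v2)) _.
  by rewrite ler_pM2l.
apply: le_trans (ler_normD _ _) _; apply: lerD.
  by apply: le_trans (H1 w (s + t) (le_lt_trans wv v1) stt) _; rewrite ler_pM2l.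
apply: le_trans (norm_mulmx _ _) _.
have h : `|Y (s + t) - Y s| < e / 3 / (n%:R + 1).
  rewrite distrC; apply: H3; rewrite -ball_normE/= opprD addrA subrr sub0r normrN.
  exact: le_lt_trans tv v3.
have n0 : 0 <= n%:R :> R by [].
move: h; rewrite ltr_pdivlMr ?ltr_wpDl// => h.
have := normr_ge0 (Y (s + t) - Y s); have := normr_ge0 w.
move: `|Y _ - _| `|w| `|v| wv h => a b f bf h b0 a0.
have : n%:R * a <= e / 3 by nra.
by nra.
Qed.

End Solutions.

End Flow.

(** * Almost additive functions *)

Section AlmostAdditive.
Context {R : realType} {V : normedModType R}.
Implicit Types C d e : R.

(** The defect l (a u) - a (l u), multiplied by k, depends on the fractional part of k a
    only, and is therefore bounded in k. *)
Lemma additive_bounded_linear (l : V -> R^o) C : 0 <= C ->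
  (forall u v, l (u + v) = l u + l v) -> (forall u, `|l u| <= C * `|u|) -> linear l.
Proof.
move=> C0 lD lC.
have l0 : l 0 = 0 by apply: (addrI (l 0)); rewrite -lD !addr0.
have lN u : l (- u) = - l u by apply/eqP; rewrite -addr_eq0 -lD addNr l0.
have lMn u k : l (u *+ k) = l u *+ k.
  by elim: k => [|k IH]; rewrite ?mulr0n// !mulrS lD IH.
have lMz u (k : int) : l (u *~ k) = l u *~ k.
  by case: k => k; rewrite ?NegzE ?mulrNz ?lN -!pmulrn lMn.
have lZ a u : l (a *: u) = a * l u.
  apply/eqP; rewrite -subr_eq0 -normr_le0; apply/ler_addgt0Pl => e e0; rewrite addr0.
  pose k := (Num.truncn (2 * C * `|u| / e)).+1.
  have k0 : 0 < k%:R :> R by rewrite ltr0n.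
  have kE : 2 * C * `|u| <= k%:R * e by rewrite -ler_pdivrMr// ltW// truncnS_gt.
  rewrite -(ler_pM2l k0); apply: le_trans kE.
  set z := Num.floor (k%:R * a); set x := k%:R * a - z%:~R.
  have /andP[x0 x1] : 0 <= x < 1.
    by have := floor_itv (k%:R * a); rewrite -/z intrD /x; lra.
  have xE : k%:R * (l (a *: u) - a * l u) = l (x *: u) - x * l u.
    rewrite /x scalerBl lD lN scaler_int lMz -scalerA scaler_nat lMn -mulr_natl -mulrzl; ring.
  rewrite -[k%:R in leLHS]ger0_norm ?ler0n// -normrM xE.
  apply: le_trans (ler_normB _ _) _; rewrite normrM (ger0_norm x0).
  have := lC (x *: u); rewrite normrZ (ger0_norm x0) => h1.
  have h2 := lC u; have h3 := normr_ge0 u; have h4 := normr_ge0 (l u).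
  have h5 : x * (C * `|u|) <= C * `|u| by apply: ler_piMl; [exact: mulr_ge0|exact: ltW].
  have h6 : x * `|l u| <= `|l u| by rewrite ler_piMl// ltW.
  have h7 : C * (x * `|u|) = x * (C * `|u|) by ring.
  lra.
by move=> a u v; rewrite lD lZ.
Qed.

(** The linear part is the limit of the sequence 2^m f (u / 2^m), as in the theorem of
    Hyers on approximately additive maps. *)
Lemma almost_additive (f : V -> R^o) C d : 0 <= C -> 0 < d ->
  (forall u v, `|u| < d -> `|v| < d -> `|f (u + v) - f u - f v| <= C * `|u| * `|v|) ->
  (forall u, `|u| < d -> `|f u| <= C * `|u|) ->
  exists l : V -> R^o, [/\ linear l, forall u, `|l u| <= C * `|u| &
    forall u, `|u| < d -> `|f u - l u| <= C * `|u| ^+ 2].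
Proof.
move=> C0 d0 fD fC.
pose h m u : V := (2 ^+ m)^-1 *: u.
have p0 m : 0 < 2 ^+ m :> R by rewrite exprn_gt0.
have hN m u : `|h m u| = `|u| / 2 ^+ m.
  by rewrite normrZ ger0_norm ?invr_ge0 1?ltW// mulrC.
pose a u m : R^o := 2 ^+ m * f (h m u).
have small u : exists m, forall i, (m <= i)%N -> `|h i u| < d.
  by have [m H] := pow2_small `|u| d0; exists m => i /H; rewrite hN.
have step u m : `|h m.+1 u| < d -> `|a u m.+1 - a u m| <= C * `|u| ^+ 2 / 2 / 2 ^+ m.
  move=> hd; have := fD _ _ hd hd.
  have -> : h m.+1 u + h m.+1 u = h m u.
    rewrite /h -scalerDl; congr (_ *: _); rewrite exprS; field; exact/lt0r_neq0.
  rewrite !hN /a => H.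
  have -> : 2 ^+ m.+1 * f (h m.+1 u) - 2 ^+ m * f (h m u)
          = - (2 ^+ m * (f (h m u) - f (h m.+1 u) - f (h m.+1 u))).
    by rewrite exprS; ring.
  rewrite normrN normrM (ger0_norm (ltW (p0 m))).
  apply: le_trans (ler_wpM2l (ltW (p0 m)) H) _.
  have -> : 2 ^+ m * (C * (`|u| / 2 ^+ m.+1) * (`|u| / 2 ^+ m.+1))
          = C * `|u| ^+ 2 / 2 / 2 ^+ m / 2.
    by rewrite exprS; field; exact/lt0r_neq0.
  have : 0 <= C * `|u| ^+ 2 / 2 / 2 ^+ m.
    by rewrite !divr_ge0 ?mulr_ge0 ?sqr_ge0 ?(ltW (p0 m)).
  lra.
have lim u : exists L : R^o, a u i @[i --> \oo] --> L.
  apply: cvgn_ex; apply: real_cauchy_cvg.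
  have [m0 Hm] := small u.
  pose D := C * `|u| ^+ 2 / 2 + \sum_(i < m0) 2 ^+ i * `|a u i.+1 - a u i|.
  have GC := @geometric_cauchy _ _ abs_seminorm (a u) D.
  suff aD i : `|a u i.+1 - a u i| <= D / 2 ^+ i by move=> e; apply: (GC aD).
  have D0 : 0 <= C * `|u| ^+ 2 / 2 by rewrite divr_ge0 ?mulr_ge0 ?sqr_ge0.
  have sge (P : pred 'I_m0) : 0 <= \sum_(j < m0 | P j) 2 ^+ j * `|a u j.+1 - a u j|.
    by apply: sumr_ge0 => j _; exact: mulr_ge0 (ltW (p0 j)) (normr_ge0 _).
  have [im|im] := ltnP i m0.
    by rewrite ler_pdivlMr// mulrC /D (bigD1 (Ordinal im))//= addrCA lerDl; apply: addr_ge0.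
  apply: le_trans (step u i (Hm _ (leqW im))) _; apply: ler_wpM2r.
    by rewrite invr_ge0 (ltW (p0 i)).
  by rewrite /D lerDl.
have [l ll] := choice lim.
have lD u v : l (u + v) = l u + l v.
  apply/eqP; rewrite -subr_eq0 opprD addrA -normr_le0.
  apply: (@cvgn_le _ (fun m => `|a (u + v) m - a u m - a v m|) (fun m => C * `|u| * `|v| / 2 ^+ m)).
  - by apply: cvg_norm; apply: cvgB => //; apply: cvgB.
  - apply/cvg0P => [m|e /(pow2_small (C * `|u| * `|v|))//].
    by rewrite !mulr_ge0 ?invr_ge0 ?(ltW (p0 m)).
  - have [m1 H1] := small u; have [m2 H2] := small v; exists (maxn m1 m2) => // i.
    rewrite /= geq_max => /andP[i1 i2].
    have := fD _ _ (H1 _ i1) (H2 _ i2); rewrite -scalerDr -/(h i (u + v)) !hN => H.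
    rewrite /a -!mulrBr normrM (ger0_norm (ltW (p0 i))).
    apply: le_trans (ler_wpM2l (ltW (p0 i)) H) _; rewrite le_eqVlt; apply/orP; left.
    by apply/eqP; field; exact/lt0r_neq0.
have lC u : `|l u| <= C * `|u|.
  apply: (@cvgn_le _ (fun m => `|a u m|) (fun=> C * `|u|)).
  - exact: cvg_norm.
  - exact: cvgn_cst.
  - have [m H] := small u; exists m => // i /H hd; have := fC _ hd; rewrite hN => h1.
    rewrite /a normrM (ger0_norm (ltW (p0 i))) mulrC -ler_pdivlMr//.
    by rewrite -mulrA.
exists l; split=> //; first exact: additive_bounded_linear C0 lD lC.
move=> u ud; rewrite distrC.
apply: (@cvgn_le _ (fun m => `|a u m - f u|) (fun=> C * `|u| ^+ 2)).
- by apply: cvg_norm; apply: cvgB => //; exact: cvg_cst.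
- exact: cvgn_cst.
- exists 0%N => // i _.
  have ad j : abs_seminorm (a u j.+1 - a u j) <= C * `|u| ^+ 2 / 2 / 2 ^+ j.
    apply: step; rewrite hN ltr_pdivrMr//; apply: (lt_le_trans ud).
    by rewrite ler_peMr ?(ltW d0)// exprn_ege1// ler1n.
  have := geometric_tail ad (leq0n i).
  have -> : a u 0%N = f u by rewrite /a /h expr0 invr1 scale1r mul1r.
  by rewrite expr0 divr1 mulrCA divff ?mulr1.
Qed.

(** Second differences of size O(|u| |v|) near a point make the increments almost
    additive there. *)
Lemma second_difference_differentiable (f : V -> R^o) C d p : 0 <= C -> 0 < d ->
  (forall u v, `|u| < d -> `|v| < d ->
    `|f (p + u + v) - f (p + u) - f (p + v) + f p| <= C * `|u| * `|v|) ->
  (forall u, `|u| < d -> `|f (p + u) - f p| <= C * `|u|) ->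
  differentiable f p.
Proof.
move=> C0 d0 f2 f1.
have [||l [ll lC lf]] := @almost_additive (fun u => f (p + u) - f p) C d C0 d0.
- move=> u v ud vd; have := f2 u v ud vd; congr (`|_| <= _); rewrite addrA; ring.
- exact: f1.
pose L := HB.pack_for {linear V -> R^o} l (GRing.isLinear.Build R V R^o *:%R l ll).
have [] // := @differentiable_eps _ V R^o f L p _ _.
- move=> x; apply: (@lipschitz_continuous_at _ _ _ _ C) => y /=.
  by rewrite -(linearB_of _ _ ll).
- move=> e e0; exists (Num.min d (e / (C + 1))) => [|u].
    by rewrite lt_min d0 divr_gt0// ltr_wpDl.
  rewrite lt_min => /andP[ud ue]; apply: le_trans (lf u ud) _.
  rewrite expr2 mulrA ler_wpM2r//.
  apply: (@le_trans _ _ ((C + 1) * `|u|)); first by rewrite ler_wpM2r// lerDl.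
  by rewrite mulrC -ler_pdivlMr ?ltW// ltr_wpDl.
Qed.

Lemma increment_continuous (f : V -> R^o) C d p : 0 < C -> 0 < d ->
  (forall u, `|u| < d -> `|f (p + u) - f p| <= C * `|u|) -> {for p, continuous f}.
Proof.
move=> C0 d0 H; apply/cvgrPdist_lt => e e0.
have m0 : 0 < Num.min d (e / C) by rewrite lt_min d0 divr_gt0.
near=> q.
have : `|p - q| < Num.min d (e / C).
  by near: q; exact: (@cvgr_dist_lt _ _ _ _ _ id p).
rewrite lt_min distrC => /andP[qd qe]; rewrite distrC -{1}[q](subrK p) [q - p + p]addrC.
by apply: le_lt_trans (H _ qd) _; rewrite mulrC -ltr_pdivlMr.
Unshelve. all: by end_near. Qed.

End AlmostAdditive.

(** * The coefficients of a form *)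

Section Coefficients.
Context {R : realType} {n k : nat}.
Implicit Types (U : set 'rV[R]_n) (p q u : 'rV[R]_n) (be : kvec R k n) (e d C : R).

Lemma hull_ball (S : set 'rV[R]_n) p e : (forall x, S x -> `|x - p| <= e) ->
  forall x, hull S x -> `|x - p| <= e.
Proof.
move=> Se x [m [w [s [w0 sS w1 ->]]]].
have -> : \sum_i w i *: s i - p = \sum_i w i *: (s i - p).
  under [in RHS]eq_bigr do rewrite scalerBr.
  by rewrite sumrB -scaler_suml w1 scale1r.
apply: le_trans (ler_norm_sum _ _ _) _; rewrite -[e]mul1r -w1 mulr_suml.
by apply: ler_sum => i _; rewrite normrZ ger0_norm// ler_wpM2l// Se.
Qed.

Lemma supp_Delta_ball (s : seq 'rV[R]_n) p be q :
  supp (Delta (s, p, be)) q -> `|q - p| <= \sum_(u <- s) `|u|.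
Proof.
elim: s q => [|u s IH] q.
  rewrite /supp/= DeltaE /= big_nil fpointE; case: (q =P p) => [->|_]; last by rewrite eqxx.
  by rewrite subrr normr0.
rewrite /supp/= DeltaE /= -!DeltaE big_cons => qD.
have [/eqP q0|/IH h] := boolP (Delta (s, p, be) q == 0); last first.
  by apply: le_trans h _; rewrite lerDr.
move: qD; rewrite q0 subr0 => /IH; rewrite addrAC => h.
rewrite -[q - p](subrK u) addrC; exact: le_trans (ler_normD _ _) (lerD (lexx _) h).
Qed.

Definition coef U (om : kform k U) be q : R^o := om (dpoint U q be).

Lemma coef_out U (om : kform k U) be q : ~ U q -> coef om be q = 0.
Proof. by move=> Uq; rewrite /coef dpoint_out// linear0. Qed.

Lemma coef_linear U (om : kform k U) q : linear (coef om ^~ q).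
Proof. by move=> a x y; rewrite /coef dpoint_linear linearP. Qed.

Variables (G : 'M[R]_n) (U : set 'rV[R]_n) (r : nat) (om : kform k U).
Hypotheses (GI : inner_product G) (Uo : open U) (omb : bform G r om).

Lemma open_ball p : U p -> exists2 d, 0 < d & forall q, `|q - p| < d -> U q.
Proof.
move=> Up; have [|d d0 H] := compact_in_open (@compact_set1 _ p) Uo.
  by move=> _ ->.
by exists d => // q; exact: H.
Qed.

(** A difference chain with short displacements stays in a ball inside U together with its
    convex hull. *)
Lemma coef_Delta_bound be p : U p -> exists C d, [/\ 0 < C, 0 < d,
  forall q, `|q - p| < d -> U q &
  forall (s : seq 'rV[R]_n) (A : dchain k U), (size s <= r)%N -> \sum_(u <- s) `|u| < d ->
    dval A = Delta (s, p, be) -> `|om A| <= C * \prod_(u <- s) vnorm G u].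
Proof.
move=> /open_ball[d d0 dU]; have [C C0 HC] := bform_bound GI omb.
exists (C * (mass G be + 1)), d; split=> //.
  by rewrite mulr_gt0// ltr_wpDl ?mass_ge0.
move=> s A sr sd As; apply: le_trans (HC A (s, p, be) _ _ As) _ => //.
  move=> q /(hull_ball (@supp_Delta_ball s p be)) h; apply: dU.
  exact: le_lt_trans sd.
rewrite /cost/= -mulrA ler_pM2l// mulrC ler_wpM2r ?lerDl//.
by apply: prodr_ge0 => u _; exact: sqrtr_ge0.
Qed.

Lemma coef_increment be p : (1 <= r)%N -> U p -> exists C d, [/\ 0 < C, 0 < d &
  forall u, `|u| < d -> `|coef om be (p + u) - coef om be p| <= C * `|u|].
Proof.
move=> r1 /(coef_Delta_bound be)[C [d [C0 d0 dU H]]].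
have [D D0 HD] := vnorm_norm GI; exists (C * D), d; split=> //; first exact: mulr_gt0.
have Up : U p by apply: dU; rewrite subrr normr0.
move=> u ud; have Upu : U (p + u) by apply: dU; rewrite addrAC subrr add0r.
have := H [:: u] (dpoint U (p + u) be - dpoint U p be) r1.
rewrite !big_seq1 linearB/= => /(_ ud) h.
apply: (@le_trans _ _ (C * vnorm G u)); last by rewrite -mulrA ler_pM2l//; have [] := HD u.
apply: h; apply/funext => q; rewrite DeltaE /= !fpointE subr_eq.
by rewrite -(dval_dpoint be q Upu) -(dval_dpoint be q Up).
Qed.

Lemma coef_continuous be p : (1 <= r)%N -> U p -> {for p, continuous (coef om be)}.
Proof.
by move=> r1 /(coef_increment be r1)[C [d [C0 d0 H]]]; exact: increment_continuous C0 d0 H.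
Qed.

(** At level 2 the second differences are bounded by the product of the displacements. *)
Lemma coef_differentiable be p : (2 <= r)%N -> U p -> differentiable (coef om be) p.
Proof.
move=> r2 Up; have [C1 [d1 [C10 d10 H1]]] := coef_increment be (ltnW r2) Up.
have [C [d [C0 d0 dU H]]] := coef_Delta_bound be Up.
have [D D0 HD] := vnorm_norm GI.
apply: (@second_difference_differentiable _ _ _ (Num.max C1 (C * D * D)) (Num.min d1 (d / 2))).
- by rewrite le_max (ltW C10).
- by rewrite lt_min d10 divr_gt0.
- move=> u v; rewrite !lt_min => /andP[_ ud] /andP[_ vd].
  have u0 := normr_ge0 u; have v0 := normr_ge0 v.
  have Uu : U (p + u) by apply: dU; rewrite addrAC subrr add0r; lra.
  have Uv : U (p + v) by apply: dU; rewrite addrAC subrr add0r; lra.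
  have Uuv : U (p + u + v).
    apply: dU; rewrite [p + u]addrC addrAC addrK.
    by apply: le_lt_trans (ler_normD _ _) _; lra.
  pose A := dpoint U (p + u + v) be - dpoint U (p + u) be
    - (dpoint U (p + v) be - dpoint U p be).
  have omA : om A = coef om be (p + u + v) - coef om be (p + u) - coef om be (p + v)
      + coef om be p.
    by rewrite /A !(linearB om) opprB addrA addrAC.
  have h : `|om A| <= C * (vnorm G u * (vnorm G v * 1)).
    have := H [:: u; v] A r2; rewrite !big_cons !big_nil; apply; first lra.
    apply/funext => q; rewrite DeltaE /= !fpointE.
    transitivity (dval (dpoint U (p + u + v) be) q - dval (dpoint U (p + u) be) q
      - (dval (dpoint U (p + v) be) q - dval (dpoint U p be) q)); first by [].
    by rewrite !dval_dpoint// !subr_eq [p + u + v]addrAC.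
  rewrite -omA; apply: le_trans h _; rewrite mulr1.
  apply: (@le_trans _ _ (C * D * D * `|u| * `|v|)); last first.
    by rewrite !ler_wpM2r// le_max lexx orbT.
  have [_ hu] := HD u; have [_ hv] := HD v.
  have -> : C * D * D * `|u| * `|v| = C * ((D * `|u|) * (D * `|v|)) by ring.
  by rewrite ler_pM2l// ler_pM// sqrtr_ge0.
- move=> u; rewrite lt_min => /andP[ud _]; apply: le_trans (H1 u ud) _.
  by rewrite ler_wpM2r// le_max lexx.
Qed.

End Coefficients.

(** * Cartan's formula *)

(** Locked: unification would otherwise unfold the choice operator behind the
    differential. *)
HB.lock Definition ddir (R : realType) (V W : normedModType R) (f : V -> W) (p v : V) : W :=
  'd f p v.

Section Derivations.
Context {R : realType}.

Lemma ddirE (V W : normedModType R) (f : V -> W) p v : ddir f p v = 'd f p v.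
Proof. by rewrite unlock. Qed.

Lemma ddir_linear (V W : normedModType R) (f : V -> W) p : linear (ddir f p).
Proof. by move=> a x y; rewrite !ddirE linearP. Qed.

Lemma ddirD (V W : normedModType R) (f g : V -> W) p v :
  differentiable f p -> differentiable g p -> ddir (f + g) p v = ddir f p v + ddir g p v.
Proof. by move=> fd gd; rewrite !ddirE (diffD fd gd). Qed.

Lemma ddirZ (V W : normedModType R) (f : V -> W) a p v :
  differentiable f p -> ddir (a *: f) p v = a *: ddir f p v.
Proof. by move=> fd; rewrite !ddirE (diffZ a fd). Qed.

Lemma ddirM (V : normedModType R) (f g : V -> R) p v :
  differentiable f p -> differentiable g p ->
  ddir (f * g) p v = f p * ddir g p v + g p * ddir f p v.
Proof. by move=> fd gd; rewrite !ddirE (diffM fd gd). Qed.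

Lemma ddir_comp (V W X : normedModType R) (f : V -> W) (g : W -> X) p v :
  differentiable f p -> differentiable g (f p) ->
  ddir (g \o f) p v = ddir g (f p) (ddir f p v).
Proof. by move=> fd gd; rewrite !ddirE (diff_comp fd gd). Qed.

Lemma ddir_cst (V W : normedModType R) (c : W) (p v : V) : ddir (cst c) p v = 0.
Proof. by rewrite ddirE diff_cst. Qed.

Lemma differentiable_bilinear_sum (T : normedModType R) (I : Type) (s : seq I)
    (f g : I -> T -> R) (x : T) :
  (forall i, differentiable (f i) x) -> (forall i, differentiable (g i) x) ->
  differentiable (fun y => \sum_(i <- s) f i y * g i y) x /\
  forall v, ddir (fun y => \sum_(i <- s) f i y * g i y) x v
    = \sum_(i <- s) (ddir (f i) x v * g i x + f i x * ddir (g i) x v).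
Proof.
move=> fd gd; elim: s => [|i s [IHd IHv]].
  have -> : (fun y => \sum_(i <- [::]) f i y * g i y) = cst 0.
    by apply/funext => y; rewrite big_nil.
  by split=> [|v]; [exact: differentiable_cst|rewrite big_nil ddir_cst].
have -> : (fun y => \sum_(j <- i :: s) f j y * g j y)
    = f i * g i + (fun y => \sum_(j <- s) f j y * g j y).
  by apply/funext => y; rewrite big_cons.
have fgd := differentiableM (fd i) (gd i).
split=> [|v]; first exact: differentiableD.
by rewrite (ddirD _ fgd IHd) ddirM// IHv big_cons addrC [g i x * _]mulrC [X in _ + X]addrC addrC.
Qed.

Lemma linear_continuous_rV n (l : 'rV[R]_n -> R^o) : linear l -> continuous l.
Proof.
move=> ll x; pose C := \sum_i `|l (delta_mx 0 i)|.
apply: (@lipschitz_continuous_at _ _ _ _ C) => y.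
rewrite -(linearB_of _ _ ll); move: (x - y) => z.
rewrite [in leLHS](row_sum_delta z) linear_sum_of//.
apply: le_trans (ler_norm_sum _ _ _) _; rewrite /C mulr_suml; apply: ler_sum => i _.
by rewrite linearZ_of// normrM mulrC ler_wpM2l// ler_coord_norm.
Qed.

Lemma differentiable_linear_comp n (T : normedModType R) (l : 'rV[R]_n -> R^o)
    (F : T -> 'rV[R]_n) x : linear l -> differentiable F x ->
  differentiable (l \o F : T -> R^o) x /\ forall v, ddir (l \o F : T -> R^o) x v = l (ddir F x v).
Proof.
move=> ll Fd; pose L := HB.pack_for {linear 'rV[R]_n -> R^o} l
  (GRing.isLinear.Build R 'rV[R]_n R^o *:%R l ll).
have Lc : continuous L by exact: linear_continuous_rV.
have Ld : differentiable L (F x) by exact: linear_differentiable.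
split=> [|v]; first exact: (differentiable_comp Fd Ld).
by rewrite (ddir_comp _ Fd Ld) [LHS]ddirE (diff_lin _ Lc).
Qed.

End Derivations.

Section FormDerivatives.
Context {R : realType} {n : nat}.
Implicit Types (U : set 'rV[R]_n) (V : 'rV[R]_n -> 'rV[R]_n) (p q v : 'rV[R]_n).

Lemma coef_basis k U (om : kform k U) (al : kvec R k n) q :
  coef om al q = \sum_(I : multi k n) (al I : R) * coef om (wedge (basis_rows I)) q.
Proof.
have cl := coef_linear om q.
by rewrite [in LHS](kvec_basis al) (linear_sum_of _ _ cl); apply: eq_bigr => I _; exact: (linearZ_of _ _ cl).
Qed.

Lemma dcoef_linear k U (om : kform k U) p v :
  (forall be, differentiable (coef om be) p) -> linear (fun be => ddir (coef om be) p v : R^o).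
Proof.
move=> od a x y.
have -> : coef om (a *: x + y) = a *: coef om x + coef om y.
  by apply/funext => q; exact: coef_linear.
have ax : differentiable (a *: coef om x) p by apply: differentiableZ; exact: od.
by rewrite (ddirD _ ax (od y)) (ddirZ _ _ (od x)).
Qed.

Lemma dcoef_basis k U (om : kform k U) p v (al : kvec R k n) :
  (forall be, differentiable (coef om be) p) ->
  ddir (coef om al) p v
  = \sum_(I : multi k n) (al I : R) * ddir (coef om (wedge (basis_rows I))) p v.
Proof.
move=> od; have dl := dcoef_linear v od.
rewrite [in LHS](kvec_basis al) (linear_sum_of _ _ dl); apply: eq_bigr => I _.
exact: (linearZ_of _ _ dl).
Qed.

(** The product rule for a k-vector that moves together with its base point. *)
Lemma differentiable_pairing k U (om : kform k U) (T : normedModType R)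
    (g : T -> 'rV[R]_n) (W W' : T -> kvec R k n) (x : T) :
  differentiable g x ->
  (forall I, differentiable (fun y => W y I : R) x /\
     forall v : T, ddir (fun y => W y I : R) x v = W' v I) ->
  (forall be, differentiable (coef om be) (g x)) ->
  differentiable (fun y => coef om (W y) (g y) : R) x /\
  forall v : T, ddir (fun y => coef om (W y) (g y) : R) x v
    = coef om (W' v) (g x) + ddir (coef om (W x)) (g x) (ddir g x v).
Proof.
move=> gd WW' od.
have -> : (fun y => coef om (W y) (g y) : R) = (fun y => \sum_(I : multi k n)
    (W y I : R) * ((coef om (wedge (basis_rows I)) : 'rV[R]_n -> R) \o g) y).
  by apply/funext => y; rewrite coef_basis.
have [|I|] := @differentiable_bilinear_sum _ T _ (index_enum (multi k n))
  (fun I y => W y I) (fun I => (coef om (wedge (basis_rows I)) : 'rV[R]_n -> R) \o g) x.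
- by move=> I; have [] := WW' I.
- by apply: (differentiable_comp gd); exact: od.
move=> Sd Sv; split=> // v; rewrite Sv big_split/=; congr (_ + _).
  by rewrite coef_basis; apply: eq_bigr => I _; have [_ ->] := WW' I.
rewrite (dcoef_basis _ _ od); apply: eq_bigr => I _; congr (_ * _).
exact: (ddir_comp _ gd (od _)).
Qed.

(** The right-hand side is alternating in the rows of N, so that it is the value at a simple
    vector of its own linear extension. *)
Lemma ext_d_wedge k U (om : kform k U) p (N : 'M[R]_(k.+1, n)) : U p ->
  (forall be, differentiable (coef om be) p) ->
  coef (ext_d om) (wedge N) p
  = \sum_(i < k.+1) (-1) ^+ i * ddir (coef om (wedge (row' i N))) p (row i N).
Proof.
move=> Up od.
pose phi (M : 'M[R]_(k.+1, n)) : R^o :=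
  \sum_(i < k.+1) (-1) ^+ i * ddir (coef om (wedge (row' i M))) p (row i M).
transitivity (klin (fun M : 'M[R]_(k.+1, n) => \sum_(i < k.+1) (-1) ^+ i *
    'D_(row i M) (fun q => feval om q (row' i M) : R^o) p : R^o) (wedge N)).
  exact: (lin_ext_dpoint _ _ Up).
have -> : (fun M : 'M[R]_(k.+1, n) => \sum_(i < k.+1) (-1) ^+ i *
    'D_(row i M) (fun q => feval om q (row' i M) : R^o) p : R^o) = phi.
  by apply/funext => M; apply: eq_bigr => i _; rewrite ddirE deriveE//; exact: od.
apply: klin_wedge.
have -> : phi = (fun M => \sum_(J : multi k n) \sum_(j < n)
    ddir (coef om (wedge (basis_rows J))) p (delta_mx 0 j) *
    (\sum_(i < k.+1) (-1) ^+ i * M i j * (wedge (row' i M) J : R)) : R^o).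
  apply/funext => M; rewrite /phi.
  under eq_bigr => i _.
    rewrite (dcoef_basis _ _ od) mulr_sumr.
    under eq_bigr => J _.
      rewrite (row_sum_delta (row i M)) (linear_sum_of _ _ (ddir_linear _ p)) !mulr_sumr.
      under eq_bigr do rewrite (linearZ_of _ _ (ddir_linear _ p)) mxE.
      over.
    over.
  rewrite exchange_big/=; apply: eq_bigr => J _; rewrite exchange_big/=; apply: eq_bigr => j _.
  rewrite mulr_sumr; apply: eq_bigr => i _.
  by rewrite -[_ *: _]/(_ * _); ring.
apply: alternating_sum => J; apply: alternating_sum => j.
apply: (@alternating_linear _ _ _ R^o R^o
  (fun x => ddir (coef om (wedge (basis_rows J))) p (delta_mx 0 j) * x)).
  by move=> a x y; rewrite mulrDr -!scalerAr.
exact: alternating_insert.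
Qed.

Lemma int_prod_wedge V k U (om : kform k.+1 U) p (M : 'M[R]_(k, n)) :
  coef (int_prod V om) (wedge M) p = coef om (wedge (col_mx (V p) M : 'M[R]_(1 + k, n))) p.
Proof.
have [Up|Up] := pselect (U p); last by rewrite !coef_out.
transitivity (klin (fun N : 'M[R]_(k, n) => feval om p (col_mx (V p) N) : R^o) (wedge M)).
  exact: (lin_ext_dpoint _ _ Up).
apply: (@klin_wedge _ _ _ _ (fun N => feval om p (col_mx (V p) N))).
apply: (@alternating_col_mx _ _ _ _ (V p) (fun N => feval om p N)).
apply: (@alternating_linear _ _ _ _ _ (fun be => om (dpoint U p be))).
  exact: (coef_linear om p).
exact: alternating_wedge.
Qed.

Lemma wedge_first_linear k (M : 'M[R]_(k, n)) (I : multi (1 + k) n) :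
  linear (fun x : 'rV[R]_n => wedge (col_mx x M : 'M[R]_(1 + k, n)) I : R^o).
Proof.
have cE x : (col_mx x M : 'M[R]_(1 + k, n)) = setrow (col_mx 0 M) (lshift k ord0) x.
  apply/row_matrixP => i; rewrite row_setrow.
  case: (split_ordP i) => j ->; first by rewrite ord1 eqxx rowKu; apply/rowP => b; rewrite mxE.
  by rewrite eq_rlshift !rowKd.
have coordL (a : R) (w w' : kvec R (1 + k) n) : (a *: w + w') I = a *: (w I : R^o) + w' I.
  by rewrite !ffunE.
by move=> a x y; have [H _] := @alternating_wedge R (1 + k) n; rewrite (cE (a *: x + y)) (cE x) (cE y) H coordL.
Qed.

Lemma differentiable_int_prod V k U (om : kform k.+1 U) p (M : 'M[R]_(k, n)) :
  differentiable V p -> (forall be, differentiable (coef om be) p) ->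
  differentiable (coef (int_prod V om) (wedge M)) p /\
  forall v, ddir (coef (int_prod V om) (wedge M)) p v
    = coef om (wedge (col_mx (v *m jac V p) M : 'M[R]_(1 + k, n))) p
      + ddir (coef om (wedge (col_mx (V p) M : 'M[R]_(1 + k, n)))) p v.
Proof.
move=> Vd od.
have -> : coef (int_prod V om) (wedge M)
    = (fun q => coef om (wedge (col_mx (V q) M : 'M[R]_(1 + k, n))) q).
  by apply/funext => q; exact: int_prod_wedge.
have [|I||Sd Sv] := @differentiable_pairing k.+1 U om _ id
    (fun q => wedge (col_mx (V q) M : 'M[R]_(1 + k, n)))
    (fun v => wedge (col_mx (v *m jac V p) M : 'M[R]_(1 + k, n))) p.
- by apply: (@linear_differentiable _ _ _ idfun) => x; exact: cvg_id.
- have [h1 h2] := differentiable_linear_comp (wedge_first_linear M I) Vd.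
  by split=> // v; rewrite h2 ddirE jacE.
- exact: od.
have idv v : ddir id p v = v.
  by rewrite ddirE (@diff_lin _ _ _ idfun)// => x; exact: cvg_id.
by split=> // v; rewrite Sv idv.
Qed.

Lemma differentiable_coef k U (om : kform k U) p :
  (forall M, differentiable (coef om (wedge M)) p) ->
  forall be, differentiable (coef om be) p.
Proof.
move=> od be.
have -> : coef om be = (fun q => \sum_(I : multi k n)
    cst (be I : R) q * (coef om (wedge (basis_rows I)) q : R)).
  by apply/funext => q; rewrite coef_basis.
have [|I|//] := @differentiable_bilinear_sum _ 'rV[R]_n _ (index_enum (multi k n))
  (fun I => cst (be I : R)) (fun I => coef om (wedge (basis_rows I))) p.
  by move=> I; exact: differentiable_cst.
exact: od.
Qed.

Section ColMx.
Context {k : nat} (x : 'rV[R]_n) (M : 'M[R]_(k, n)).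
Let C : 'M[R]_(k.+1, n) := col_mx x M.

Let C0 j : C ord0 j = x 0 j.
Proof.
transitivity (col_mx x M (lshift k ord0) j); last by rewrite col_mxEu.
by congr (col_mx x M _ j); exact/val_inj.
Qed.

Let CS i j : C (lift ord0 i) j = M i j.
Proof.
transitivity (col_mx x M (rshift 1 i) j); last by rewrite col_mxEd.
by congr (col_mx x M _ j); exact/val_inj.
Qed.

Lemma row0_col_mx : row ord0 C = x.
Proof. by apply/rowP => j; rewrite mxE C0. Qed.

Lemma rowS_col_mx i : row (lift ord0 i) C = row i M.
Proof. by apply/rowP => j; rewrite mxE CS mxE. Qed.

Lemma row'0_col_mx : row' ord0 C = M.
Proof. by apply/matrixP => i j; rewrite mxE CS. Qed.

End ColMx.

Lemma row'S_col_mx k (x : 'rV[R]_n) (M : 'M[R]_(k.+1, n)) i :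
  row' (lift ord0 i) (col_mx x M : 'M[R]_(k.+2, n)) = col_mx x (row' i M) :> 'M[R]_(k.+1, n).
Proof.
apply/row_matrixP => j; case: (unliftP ord0 j) => [l|] ->.
  rewrite rowS_col_mx; apply/rowP => c; rewrite !mxE.
  have -> : lift (lift ord0 i) (lift ord0 l) = lift ord0 (lift i l).
    by apply/val_inj; rewrite /= /bump/= !add1n ltnS; case: leqP.
  by have /rowP/(_ c) := rowS_col_mx x M (lift i l); rewrite !mxE.
rewrite row0_col_mx; apply/rowP => c; rewrite !mxE.
have -> : lift (lift ord0 i) ord0 = ord0 by exact/val_inj.
by have /rowP/(_ c) := row0_col_mx x M; rewrite !mxE.
Qed.

(** Cartan's formula in coordinates: in i_V d + d i_V the terms that differentiate the
    coefficients along the rows of [M] cancel. *)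
Lemma lie_wedge V k U (om : kform k U) p (M : 'M[R]_(k, n)) : U p ->
  differentiable V p -> (forall be, differentiable (coef om be) p) ->
  coef (lie V om) (wedge M) p
  = ddir (coef om (wedge M)) p (V p)
    + \sum_(i < k) coef om (wedge (setrow M i (row i M *m jac V p))) p.
Proof.
move=> Up Vd; case: k om M => [|k] om M od.
  have -> : coef (lie V om) (wedge M) p = coef (int_prod V (ext_d om)) (wedge M) p by [].
  rewrite big_ord0 addr0 int_prod_wedge ext_d_wedge// big_ord1 expr0 mul1r.
  rewrite row0_col_mx.
  by congr (ddir (coef om (wedge _)) p _); apply/matrixP => -[].
have -> : coef (lie V om) (wedge M) p
    = coef (int_prod V (ext_d om)) (wedge M) p + coef (ext_d (int_prod V om)) (wedge M) p by [].
have iod : forall be, differentiable (coef (int_prod V om) be) p.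
  by apply: differentiable_coef => N; have [] := differentiable_int_prod N Vd od.
rewrite int_prod_wedge !ext_d_wedge// big_ord_recl/= expr0 mul1r.
rewrite row0_col_mx row'0_col_mx -addrA -big_split/=; congr (_ + _); apply: eq_bigr => i _.
rewrite rowS_col_mx row'S_col_mx.
have [_ ->] := differentiable_int_prod (row' i M) Vd od.
have -> : coef om (wedge (col_mx (row i M *m jac V p) (row' i M) : 'M[R]_(k.+1, n))) p
    = (-1) ^+ i * coef om (wedge (setrow M i (row i M *m jac V p))) p.
  by rewrite -[RHS](linearZ_of _ _ (coef_linear om p)) -wedge_setrow.
have -> : (-1) ^+ bump 0 i = - (-1) ^+ i :> R by rewrite /bump/= add1n exprS mulN1r.
have s2 : (-1) ^+ i * (-1) ^+ i = 1 :> R by rewrite -exprD -signr_odd addnn odd_double expr0.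
by rewrite mulrDr mulrA s2 mul1r addrCA mulNr addNr addr0.
Qed.

End FormDerivatives.

(** * Derivatives along the flow *)

Section AlongFlow.
Context {R : realType}.
Implicit Types s t : R.

Lemma is_derive_bigsum (W : normedModType R) (I : Type) (r : seq I) (f : I -> R -> W)
    (f' : I -> W) t : (forall i, is_derive t (1 : R) (f i) (f' i)) ->
  is_derive t (1 : R) (fun s => \sum_(i <- r) f i s) (\sum_(i <- r) f' i).
Proof.
move=> fd; elim: r => [|i r IH].
  have -> : (fun s => \sum_(i <- [::]) f i s) = cst 0 by apply/funext => s; rewrite big_nil.
  by rewrite big_nil; exact: is_derive_cst.
have -> : (fun s => \sum_(j <- i :: r) f j s) = f i + (fun s => \sum_(j <- r) f j s).
  by apply/funext => s; rewrite big_cons.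
by rewrite big_cons; exact: is_deriveD.
Qed.

Lemma is_derive_prod k (f : 'I_k -> R -> R) (f' : 'I_k -> R) t :
  (forall i, is_derive t (1 : R) (f i) (f' i)) ->
  is_derive t (1 : R) (fun s => \prod_i f i s)
    (\sum_i \prod_l if l == i then f' l else f l t).
Proof.
elim: k f f' => [|k IH] f f' fd.
  have -> : (fun s => \prod_(i < 0) f i s) = cst 1 by apply/funext => s; rewrite big_ord0.
  by rewrite big_ord0; exact: is_derive_cst.
have -> : (fun s => \prod_i f i s) = f ord0 * (fun s => \prod_i f (lift ord0 i) s).
  by apply/funext => s; rewrite big_ord_recl.
have IHt := IH (fun i => f (lift ord0 i)) (fun i => f' (lift ord0 i)) (fun i => fd _).
apply: is_derive_eq (is_deriveM (fd ord0) IHt) _.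
rewrite big_ord_recl big_ord_recl eqxx addrC; congr (_ + _).
  by rewrite -[_ *: _]/(_ * _) mulrC; congr (_ * _); apply: eq_bigr.
rewrite -[_ *: _]/(_ * _) mulr_sumr; apply: eq_bigr => i _.
rewrite big_ord_recl/=; congr (_ * _); exact: eq_bigr.
Qed.

(** In the Leibniz expansion, replacing a factor of each product by its derivative amounts
    to replacing a row of the matrix. *)
Lemma is_derive_det k (Y : R -> 'M[R]_k) (Y' : 'M[R]_k) t : is_derive t (1 : R) Y Y' ->
  is_derive t (1 : R) (fun s => \det (Y s)) (\sum_i \det (setrow (Y t) i (row i Y'))).
Proof.
move=> Yd.
have -> : (fun s => \det (Y s))
    = (fun s => \sum_(g : 'S_k) ((-1) ^+ g *: (fun s => \prod_i Y s i (g i))) s).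
  by apply/funext => s.
have pd (g : 'S_k) := @is_derive_prod k (fun i s => Y s i (g i)) (fun i => Y' i (g i)) t
  (fun i => is_derive_coord i (g i) Yd).
have := is_derive_bigsum (index_enum 'S_k) (fun g => is_deriveZ ((-1) ^+ g) (pd g)).
move=> /is_derive_eq; apply; rewrite exchange_big/=.
under eq_bigr do rewrite scaler_sumr.
apply: eq_bigr => g _; apply: eq_bigr => i _.
rewrite -[_ *: _]/(_ * _); congr (_ * _); apply: eq_bigr => l _.
by rewrite !mxE; case: eqP => // ->.
Qed.

Context {n : nat}.
Implicit Types (U : set 'rV[R]_n) (V : 'rV[R]_n -> 'rV[R]_n).

Lemma is_derive_wedge k (Y : R -> 'M[R]_(k, n)) (Y' : 'M[R]_(k, n)) t I :
  is_derive t (1 : R) Y Y' ->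
  is_derive t (1 : R) (fun s => wedge (Y s) I : R)
    (\sum_i (wedge (setrow (Y t) i (row i Y')) I : R)).
Proof.
move=> Yd.
have -> : (fun s => wedge (Y s) I : R) = (fun s => \det (colsub (val I) (Y s))).
  by apply/funext => s; rewrite ffunE.
have := @is_derive_det k (fun s => colsub (val I) (Y s)) (colsub (val I) Y') t.
have cd : is_derive t (1 : R) (fun s => colsub (val I) (Y s)) (colsub (val I) Y').
  apply: is_derive_mx => i j; have := is_derive_coord i (val I j) Yd.
  by move=> /is_derive_eq; rewrite !mxE => /(_ _ erefl); congr is_derive; apply/funext => s; rewrite mxE.
move=> /(_ cd) /is_derive_eq; apply; apply: eq_bigr => i _.
rewrite ffunE colsub_setrow; congr (\det (setrow _ _ _)).
by apply/rowP => j; rewrite !mxE.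
Qed.

Lemma is_derive_mulmx m k l (B : 'M[R]_(m, k)) (Y : R -> 'M[R]_(k, l)) (Y' : 'M[R]_(k, l)) t :
  is_derive t (1 : R) Y Y' -> is_derive t (1 : R) (fun s => B *m Y s) (B *m Y').
Proof.
move=> Yd; apply: is_derive_mx => i j.
have -> : (fun s => (B *m Y s) i j) = (fun s => \sum_c (B i c *: (fun s => Y s c j)) s).
  by apply/funext => s; rewrite mxE.
rewrite mxE; apply: is_derive_bigsum => c.
exact: is_deriveZ (is_derive_coord c j Yd).
Qed.

(** The two terms of the product rule are those of Cartan's formula: the base point moves
    with the velocity V, and each row of B Y varies by its image under the derivative of V. *)
Lemma is_derive_coef_wedge U V k (om : kform k U) (B : 'M[R]_(k, n))
    (gam : R -> 'rV[R]_n) (Y : R -> 'M[R]_n) s : U (gam s) -> differentiable V (gam s) ->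
  (forall be, differentiable (coef om be) (gam s)) ->
  is_derive s (1 : R) gam (V (gam s)) ->
  is_derive s (1 : R) Y (Y s *m jac V (gam s)) ->
  is_derive s (1 : R) (fun t => coef om (wedge (B *m Y t)) (gam t) : R)
    (coef (lie V om) (wedge (B *m Y s)) (gam s)).
Proof.
move=> Ug Vd od gd Yd.
have [gd1 gd2] := is_derive_differentiable gd.
pose D i := setrow (B *m Y s) i (row i (B *m Y s) *m jac V (gam s)).
pose w : kvec R k n := \sum_i wedge (D i).
have wI I : w I = \sum_i (wedge (D i) I : R) by rewrite /w sum_ffunE.
have Wd I : differentiable (fun t => wedge (B *m Y t) I : R) s /\
    forall v, ddir (fun t => wedge (B *m Y t) I : R) s v = (v *: w) I.
  have := is_derive_wedge I (is_derive_mulmx B Yd).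
  move=> /is_derive_differentiable[h1 h2]; split=> // v.
  rewrite ddirE h2 ffunE wI; congr (_ *: _); apply: eq_bigr => i _.
  by rewrite /D -row_mul -mulmxA.
have [Sd Sv] := @differentiable_pairing _ _ _ _ om _ gam (fun t => wedge (B *m Y t))
  (fun v => v *: w) s gd1 Wd od.
have -> : coef (lie V om) (wedge (B *m Y s)) (gam s)
    = 'D_(1 : R) (fun t => coef om (wedge (B *m Y t)) (gam t) : R) s.
  rewrite deriveE// -ddirE Sv scale1r [ddir gam s 1]ddirE gd2 scale1r lie_wedge// addrC.
  by congr (_ + _); rewrite /w (linear_sum_of _ _ (coef_linear om _)).
by apply: DeriveDef => //; exact/derivable1_diffP.
Qed.

Lemma is_derive_coef_kmap U V k (om : kform k U) (al : kvec R k n)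
    (gam : R -> 'rV[R]_n) (Y : R -> 'M[R]_n) s : U (gam s) -> differentiable V (gam s) ->
  (forall be, differentiable (coef om be) (gam s)) ->
  is_derive s (1 : R) gam (V (gam s)) ->
  is_derive s (1 : R) Y (Y s *m jac V (gam s)) ->
  is_derive s (1 : R) (fun t => coef om (kmap (Y t) al) (gam t) : R)
    (coef (lie V om) (kmap (Y s) al) (gam s)).
Proof.
move=> Ug Vd od gd Yd.
have kE (om' : kform k U) t : coef om' (kmap (Y t) al) (gam t)
    = \sum_(I : multi k n) (al I : R) *: (coef om' (wedge (basis_rows I *m Y t)) (gam t) : R^o).
  have cl := coef_linear om' (gam t).
  by rewrite /kmap /klin (linear_sum_of _ _ cl); apply: eq_bigr => I _; exact: (linearZ_of _ _ cl).
have -> : (fun t => coef om (kmap (Y t) al) (gam t) : R) = (fun t => \sum_(I : multi k n)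
    ((al I : R) *: (fun t => coef om (wedge (basis_rows I *m Y t)) (gam t) : R^o)) t).
  by apply/funext => t; rewrite kE.
rewrite kE; apply: is_derive_bigsum => I.
by apply: is_deriveZ; exact: is_derive_coef_wedge.
Qed.

Lemma continuous_coef_kmap U k (om : kform k U) (al : kvec R k n)
    (gam : R -> 'rV[R]_n) (Y : R -> 'M[R]_n) s v Y' :
  (forall be, {for gam s, continuous (coef om be)}) ->
  is_derive s (1 : R) gam v -> is_derive s (1 : R) Y Y' ->
  {for s, continuous (fun t => coef om (kmap (Y t) al) (gam t) : R)}.
Proof.
move=> oc gd Yd.
have -> : (fun t => coef om (kmap (Y t) al) (gam t) : R) = (fun t => \sum_(I : multi k n)
    \sum_(J : multi k n) ((al I : R) * (wedge (basis_rows I *m Y t) J : R))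
       * coef om (wedge (basis_rows J)) (gam t)).
  apply/funext => t; rewrite coef_basis exchange_big/=; apply: eq_bigr => J _.
  rewrite /kmap /klin sum_ffunE mulr_suml; apply: eq_bigr => I _.
  by rewrite ffunE.
apply: (@continuous_sum _ _ R) => I; apply: (@continuous_sum _ _ R) => J.
have h1 : {for s, continuous (fun t => wedge (basis_rows I *m Y t) J : R)}.
  exact: is_derive_continuous (is_derive_wedge J (is_derive_mulmx (basis_rows I) Yd)).
have h2 : {for s, continuous (fun t => coef om (wedge (basis_rows J)) (gam t) : R)}.
  exact: (@continuous_comp _ _ _ gam (coef om (wedge (basis_rows J))) s
    (is_derive_continuous gd) (oc _)).
apply: (@cvgM _ _ _ _ (fun t => (al I : R) * (wedge (basis_rows I *m Y t) J : R))) => //.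
by apply: cvgM => //; exact: cvg_cst.
Qed.

End AlongFlow.

(** Locked for the same reason as ddir. *)
HB.lock Definition dmx (R : realType) (m n : nat) (F : 'rV[R]_m -> 'rV[R]_n) (p : 'rV[R]_m) :
  'M[R]_(m, n) := lin1_mx ('d F p).

Section PushFlow.
Context {R : realType} {n k : nat}.
Variables (U : set 'rV[R]_n) (V : 'rV[R]_n -> 'rV[R]_n).
Hypotheses (Uo : open U) (VC : C1_on U V).
Implicit Types (s t b : R) (om : kform k U) (A : dchain k U).

Lemma dmxE m m' (F : 'rV[R]_m -> 'rV[R]_m') p (D : 'M[R]_(m, m')) :
  (forall u, 'd F p u = u *m D) -> dmx F p = D.
Proof. by move=> fD; rewrite unlock; apply/row_matrixP => i; rewrite !rowE mul_rV_lin1 fD. Qed.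

Lemma push_dirac_dmx j m m' (X : set 'rV[R]_m) (X' : set 'rV[R]_m')
    (F : 'rV[R]_m -> 'rV[R]_m') p (al : kvec R j m) : X p ->
  push_dirac X' F (dpoint X p al) = dpoint X' (F p) (kmap (dmx F p) al).
Proof. by rewrite unlock; exact: push_dirac_dpoint. Qed.

Lemma push_dirac_sum om m (U' : set 'rV[R]_m) (F : 'rV[R]_m -> 'rV[R]_n)
    (B : dchain k U') :
  om (push_dirac U F B) = \sum_(p <- fset_set (supp B))
    coef om (kmap (dmx F p) (B p)) (F p).
Proof.
rewrite (@linear_sum_dpoint _ _ _ U' R^o (fun B => om (push_dirac U F B))); last first.
  by move=> a x y; rewrite (push_dirac_linear _ F) linearP.
by apply: eq_big_seq => p /supp_in Up; rewrite push_dirac_dmx.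
Qed.

(** For the times near t this expresses the summand of a pushed chain at p by an integral
    curve and its variation. *)
Lemma flow_local p t b : 0 <= t <= b -> flow_dom V U b p ->
  exists (gam : R -> 'rV[R]_n) (Y : R -> 'M[R]_n),
  [/\ U (gam t), is_derive t (1 : R) gam (V (gam t)),
      is_derive t (1 : R) Y (Y t *m jac V (gam t)) &
      \forall s \near t, flow V U s p = gam s /\ dmx (flow V U s) p = Y s].
Proof.
move=> /andP[t0 tb] pb; have [s0 [s1 [gam [Y [s00 bs1 _ _ H]]]]] := flow_smooth Uo VC (le_trans t0 tb) pb.
have tin : s0 < t < s1 by rewrite (lt_le_trans s00)//= (le_lt_trans tb).
have [Ug gd Yd _ _] := H t tin; exists gam, Y; split=> //.
have : t \in `]s0, s1[ by rewrite in_itv/=.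
move=> /near_in_itvoo; apply: filterS => s; rewrite in_itv/= => /H[_ _ _ -> [dF _]]; split=> //.
exact: dmxE.
Qed.

(** The derivative of the flow in the point is the solution Y of the variation equation, so
    that every summand is the pairing of om with a k-vector carried along by the flow. *)
Lemma is_derive_push om A t b : 0 <= t <= b ->
  (forall be p, U p -> differentiable (coef om be) p) ->
  (forall p, supp A p -> flow_dom V U b p) ->
  is_derive t (1 : R) (fun s => om (push_dirac U (flow V U s) A) : R)
    (lie V om (push_dirac U (flow V U t) A)).
Proof.
move=> tb od Ab.
(* The summands keep the membership in the support, as the flow is known at its points only. *)
have -> : (fun s => om (push_dirac U (flow V U s) A) : R)
  = (fun s => \sum_(p <- fset_set (supp A)) if p \in fset_set (supp A) then
      coef om (kmap (dmx (flow V U s) p) (A p)) (flow V U s p) else 0).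
  by apply/funext => s; rewrite push_dirac_sum; apply: eq_big_seq => p ->.
rewrite push_dirac_sum.
have -> : \sum_(p <- fset_set (supp A))
      coef (lie V om) (kmap (dmx (flow V U t) p) (A p)) (flow V U t p)
  = \sum_(p <- fset_set (supp A)) if p \in fset_set (supp A) then
      coef (lie V om) (kmap (dmx (flow V U t) p) (A p)) (flow V U t p) else 0.
  by apply: eq_big_seq => p ->.
apply: is_derive_bigsum => p; case: ifPn => [pA|_]; last exact: is_derive_cst.
have pb : flow_dom V U b p.
  by apply: Ab; move: pA; rewrite in_fset_set ?inE//; exact: dchain_finite.
have [gam [Y [Ug gd Yd near_t]]] := flow_local tb pb.
have [ft Dt] := nbhs_singleton near_t; rewrite ft Dt.
have := is_derive_coef_kmap (A p) Ug (VC.1 _ Ug) (fun be => od be _ Ug) gd Yd.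
apply: near_eq_is_derive; apply: filterS near_t => s [-> ->]; reflexivity.
Qed.

Lemma near_eq_continuous (f g : R -> R) t : (\forall s \near t, f s = g s) ->
  {for t, continuous f} -> {for t, continuous g}.
Proof.
move=> fg; rewrite /prop_for /continuous_at (nbhs_singleton fg) => fc.
exact: cvg_trans (near_eq_cvg fg) fc.
Qed.

Lemma continuous_push om A t b : 0 <= t <= b ->
  (forall be p, U p -> {for p, continuous (coef om be)}) ->
  (forall p, supp A p -> flow_dom V U b p) ->
  {for t, continuous (fun s => om (push_dirac U (flow V U s) A) : R)}.
Proof.
move=> tb oc Ab.
have -> : (fun s => om (push_dirac U (flow V U s) A) : R)
  = (fun s => \sum_(p <- fset_set (supp A)) if p \in fset_set (supp A) then
      coef om (kmap (dmx (flow V U s) p) (A p)) (flow V U s p) else 0).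
  by apply/funext => s; rewrite push_dirac_sum; apply: eq_big_seq => p ->.
apply: (@continuous_sum _ R R) => p; case: (boolP (p \in fset_set (supp A))) => pA; last exact: cvg_cst.
have pb : flow_dom V U b p.
  by apply: Ab; move: pA; rewrite in_fset_set ?inE//; exact: dchain_finite.
have [gam [Y [Ug gd Yd near_t]]] := flow_local tb pb.
have [ft Dt] := nbhs_singleton near_t.
have c := @continuous_coef_kmap _ _ U k om (A p) gam Y t _ _ (fun be => oc be _ Ug) gd Yd.
have nt : \forall s \near t, coef om (kmap (Y s) (A p)) (gam s)
    = coef om (kmap (dmx (flow V U s) p) (A p)) (flow V U s p).
  by apply: filterS near_t => s [-> ->].
exact: near_eq_continuous nt c.
Qed.

(** The k-vector of the point mass at (p, t) has no time component, so that only the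
    derivative of theta in the point acts on it. *)
Lemma push_theta_dpoint p t b (al : kvec R k n) : 0 <= t <= b -> flow_dom V U b p -> U p ->
  push_dirac U (theta U V) (dpoint (setprod U [set: 'rV[R]_1]) (row_mx p t%:M)
    (kmap (row_mx 1%:M 0) al))
  = push_dirac U (flow V U t) (dpoint U p al).
Proof.
move=> /andP[t0 tb] pb Up.
have [s0 [s1 [gam [Y [s00 bs1 _ _ H]]]]] := flow_smooth Uo VC (le_trans t0 tb) pb.
have tin : s0 < t < s1 by rewrite (lt_le_trans s00)//= (le_lt_trans tb).
have [_ _ _ _ [dF dT]] := H t tin.
rewrite !push_dirac_dmx//; last exact: setprod_row_mx.
have -> : theta U V (row_mx p t%:M) = flow V U t p.
  by rewrite /theta /time row_mxKl row_mxKr mxE eqxx mulr1n.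
rewrite kmap_comp (dmxE dF); congr (dpoint U _ (kmap _ al)).
have -> : dmx (theta U V) (row_mx p t%:M) = col_mx (Y t) (dsubmx (dmx (theta U V) (row_mx p t%:M))).
  rewrite -[LHS]vsubmxK; congr col_mx.
  rewrite unlock; apply/row_matrixP => i.
  have -> : row i (usubmx (lin1_mx ('d (theta U V) (row_mx p t%:M))))
      = 'd (theta U V) (row_mx p t%:M) (row_mx (delta_mx 0 i) 0).
    apply/rowP => j; rewrite !mxE; congr ('d (theta U V) _ _ 0 j).
    apply/rowP => l; rewrite !mxE eqxx/=; case: (split_ordP l) => l' ->.
      by rewrite mxE eq_lshift.
    by rewrite mxE eq_rlshift.
  by rewrite dT -rowE.
by rewrite mul_row_col mul1mx mul0mx addr0.
Qed.

End PushFlow.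

(** * The chain of an interval *)

Section IntervalChain.
Context {R : realType}.
Implicit Types (a b c t : R).
Local Notation G1 := (1%:M : 'M[R]_1).
Local Notation line := [set: 'rV[R]_1].

Lemma sum_double (W : nmodType) (F : nat -> W) m :
  \sum_(j < m.*2) F j = \sum_(j < m) (F j.*2 + F j.*2.+1).
Proof.
elim: m => [|m IH]; first by rewrite !big_ord0.
by rewrite doubleS !big_ord_recr/= IH addrA.
Qed.

Definition tpoint t : dchain 1 line := dpoint line t%:M unit1.

Definition riemann_chain a b (i : nat) : dchain 1 line :=
  \sum_(j < 2 ^ i) ((b - a) / (2 ^ i)%:R) *: tpoint (a + j%:R * ((b - a) / (2 ^ i)%:R)).

Lemma vnorm_line c : vnorm G1 c%:M = `|c|.
Proof.
rewrite /vnorm /vdot mulmx1 tr_scalar_mx -scalar_mxM mxE eqxx mulr1n.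
by rewrite -expr2 sqrtr_sqr.
Qed.

Lemma tpoint_increment : exists2 D, 0 < D &
  forall t c, bnorm G1 1 1 line (tpoint (t + c) - tpoint t) <= D * `|c|.
Proof.
exists (mass G1 (unit1 (R := R)) + 1) => [|t c]; first by rewrite ltr_wpDl ?mass_ge0.
apply: (@le_trans _ _ (cost G1 ([:: c%:M], t%:M, unit1 (R := R)))).
  apply: bnorm_le_cost1 => //; apply/funext => q; rewrite DeltaE /= !fpointE subr_eq.
  transitivity (dval (tpoint (t + c)) q - dval (tpoint t) q); first by [].
  by rewrite !dval_dpoint// raddfD.
rewrite /cost/= big_seq1 vnorm_line mulrC ler_wpM2r//.
by rewrite lerDl.
Qed.

(** Halving the step moves half of the mass by half a step. *)
Lemma riemann_chain_step a b : exists D, forall i,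
  bnorm G1 1 1 line (riemann_chain a b i.+1 - riemann_chain a b i) <= D / 2 ^+ i.
Proof.
have [D D0 HD] := tpoint_increment.
exists (D * (b - a) ^+ 2 / 4) => i.
set h := (b - a) / (2 ^ i)%:R.
have p0 : (2 ^ i)%:R != 0 :> R by rewrite pnatr_eq0 expn_eq0.
have hE : (b - a) / (2 ^ i.+1)%:R = h / 2 by rewrite expnS natrM /h; field.
have half (x y : dchain 1 line) : (h / 2) *: x + (h / 2) *: y - h *: x = (h / 2) *: (y - x).
  have -> : h *: x = (h / 2) *: x + (h / 2) *: x by rewrite -scalerDl; congr (_ *: _); field.
  by rewrite scalerBr opprD addrA [_ + (h / 2) *: y]addrC addrK.
have -> : riemann_chain a b i.+1 - riemann_chain a b i
    = \sum_(j < 2 ^ i) (h / 2) *: (tpoint (a + j%:R * h + h / 2) - tpoint (a + j%:R * h)).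
  rewrite /riemann_chain hE expnS mul2n
    (sum_double (fun j => (h / 2) *: tpoint (a + j%:R * (h / 2)))) -sumrB.
  apply: eq_bigr => j _; rewrite -/h.
  have -> : (j.*2)%:R * (h / 2) = j%:R * h :> R by rewrite -muln2 natrM; field.
  have -> : (j.*2.+1)%:R * (h / 2) = j%:R * h + h / 2 :> R.
    by rewrite -addn1 natrD -muln2 natrM; field.
  by rewrite [a + (_ + _)]addrA half.
apply: le_trans (snorm_sum _ _ _) _.
apply: (@le_trans _ _ (\sum_(j < 2 ^ i) D * (h / 2) ^+ 2)).
  apply: ler_sum => j _; rewrite snormZ.
  apply: le_trans (ler_wpM2l (normr_ge0 _) (HD _ _)) _.
  by rewrite mulrCA -normrM -expr2 ger0_norm ?sqr_ge0.
rewrite sumr_const card_ord -[_ *+ (2 ^ i)]mulr_natr /h le_eqVlt; apply/orP; left; apply/eqP.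
by move: p0; rewrite natrX => p0; field.
Qed.

Lemma integral_of_derive (F g : R -> R) a b : a <= b ->
  (forall t, is_derive t (1 : R) F (g t)) -> continuous g ->
  Rintegral lebesgue_measure `[a, b] g = F b - F a.
Proof.
rewrite le_eqVlt => /orP[/eqP <-|ab] Fd gc; rewrite /Rintegral.
  by rewrite set_itv1 integral_set1 subrr.
rewrite (continuous_FTC2 ab (F := F))//.
- exact: continuous_subspaceT.
- split=> [t _||].
  + by have [] := Fd t.
  + apply: cvg_at_right_filter; exact: (is_derive_continuous (Fd a)).
  + apply: cvg_at_left_filter; exact: (is_derive_continuous (Fd b)).
- by move=> t _; rewrite derive1E; have [_ ->] := Fd t.
Qed.

Section Forms.
Variables (eta : kform 1 line).
Hypothesis etab : bform G1 1 eta.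

Let g t : R := eta (tpoint t).

Lemma form_line_continuous : continuous g.
Proof.
have [D D0 HD] := tpoint_increment; have [C C0 HC] := bform_le_bnorm (inner_product1 1) etab.
move=> t; apply: (@increment_continuous _ R g (C * D) 1) => //; first exact: mulr_gt0.
move=> c _; rewrite /g -(linearB eta); apply: le_trans (HC _) _.
by rewrite -mulrA ler_pM2l.
Qed.

Lemma riemann_chain_form a b i : eta (riemann_chain a b i)
  = \sum_(j < 2 ^ i) (b - a) / (2 ^ i)%:R * g (a + j%:R * ((b - a) / (2 ^ i)%:R)).
Proof. by rewrite linear_sum; apply: eq_bigr => j _; rewrite linearZ. Qed.

End Forms.

Lemma pow2_riemann_sum_cvg (f g : R -> R) a b : a <= b ->
  (forall t, a <= t <= b -> is_derive t (1 : R) f (g t)) ->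
  (forall t, a <= t <= b -> {for t, continuous g}) ->
  forall e, 0 < e -> exists m, forall i, (m <= i)%N ->
    `|\sum_(j < 2 ^ i) (b - a) / (2 ^ i)%:R * g (a + j%:R * ((b - a) / (2 ^ i)%:R))
      - (f b - f a)| < e.
Proof.
move=> ab fd gc e e0; have [m H] := riemann_sum_cvg ab fd gc e0.
exists m => i mi; have := H (2 ^ i).-1; rewrite prednK ?expn_gt0//; apply.
by rewrite -ltnS prednK ?expn_gt0//; exact: leq_ltn_trans mi (ltn_expl i (ltnSn 1)).
Qed.

Lemma riemann_chain_integral eta a b (K : bhat G1 1 1 line) : a <= b -> bform G1 1 eta ->
  converges_to (riemann_chain a b) K ->
  bint K eta = Rintegral lebesgue_measure `[a, b] (fun t => feval eta t%:M 1%:M).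
Proof.
move=> ab etab cK; have gc := form_line_continuous etab.
have [F [_ Fd]] := antiderivative gc.
rewrite (@integral_of_derive F (fun t => eta (tpoint t)))//.
have cE := bint_lim (inner_product1 1) etab cK.
have sE : (eta (riemann_chain a b i) : R) @[i --> \oo] --> F b - F a.
  apply/cvgrPdist_lt => e e0.
  have [m H] := pow2_riemann_sum_cvg ab (fun t _ => Fd t) (fun t _ => gc t) e0.
  by exists m => // i mi; rewrite distrC riemann_chain_form; exact: H.
exact: (cvg_unique _ cE sE).
Qed.

Lemma bform_of_bound n k r (G : 'M[R]_n) (U : set 'rV[R]_n) (om : kform k U) C : 0 <= C ->
  (forall A, `|om A| <= C * bnorm G r k U A) -> bform G r om.
Proof.
move=> C0 omC; apply: (@le_lt_trans _ _ C%:E); last exact: ltry.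
apply/bigmax_leP; split; first by rewrite lee_fin.
move=> j _; apply: ge_ereal_sup => _ [t [A [tj tU At t1 ->]]].
rewrite lee_fin -[C]mulr1 -t1; apply: le_trans (omC A) _; rewrite ler_wpM2l//.
by apply: bnorm_le_cost1 => //; rewrite tj -ltnS.
Qed.

(** Hahn-Banach provides enough forms to separate two chains. *)
Lemma chain_eq_of_bint n k r (G : 'M[R]_n) (U : set 'rV[R]_n) (K L : bhat G r k U) :
  inner_product G -> (forall om, bform G r om -> bint K om = bint L om) -> K = L.
Proof.
move=> GI KL; have [f [fx fp]] := hahn_banach_norming (cseminorm (bnorm G r k U)) (K - L).
pose eta0 (A : dchain k U) : R^o := f (cembed (bnorm G r k U) A).
have etal : linear eta0 by move=> a x y; rewrite /eta0 cembedD cembedZ linearP.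
pose eta := HB.pack_for {linear dchain k U -> R^o} eta0 (GRing.isLinear.Build R (dchain k U) R^o *:%R eta0 etal).
have etab : bform G r eta.
  apply: (@bform_of_bound _ _ _ _ _ _ 1) => // A; rewrite mul1r.
  by apply: le_trans (fp _) _; rewrite /= cnorm_cembed.
have E (M : bhat G r k U) : bint M eta = f M.
  have cM := converges_repr M; have cE := bint_lim GI etab cM.
  have sE : (eta (repr M i) : R) @[i --> \oo] --> f M.
    apply/cvgrPdist_lt => e e0.
    have [m H] := converges_dist cM e0; exists m => // i mi.
    rewrite distrC -[eta _]/(f (cembed _ _)) -linearB.
    exact: le_lt_trans (fp _) (H i mi).
  exact: (cvg_unique _ cE sE).
apply/eqP; rewrite -subr_eq0; apply/eqP; apply: cnorm_eq0.
by rewrite -[LHS]/(cseminorm _ _) -fx linearB -!E KL// subrr.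
Qed.

(** The Riemann sums converge to a chain with the integrals that define the chain of the
    interval, and forms separate chains. *)
Lemma riemann_chain_converges a b : a <= b ->
  converges_to (riemann_chain a b) (interval_chain a b).
Proof.
move=> ab; have [D HD] := riemann_chain_step a b.
have [K cK] := cauchy_converges (geometric_cauchy HD).
pose P (K : bhat G1 1 1 line) := forall eta : kform 1 line, bform G1 1 eta ->
  bint K eta = Rintegral lebesgue_measure `[a, b] (fun t => feval eta t%:M 1%:M).
have PK : P K by move=> eta etab; exact: riemann_chain_integral.
have PI : P (interval_chain a b) by exact: (xgetPex 0 (ex_intro P K PK)).
suff -> : interval_chain a b = K by [].
by apply: chain_eq_of_bint (inner_product1 1) _ => om omb; rewrite PI// PK.
Qed.

Lemma riemann_chain_node a b i (j : 'I_(2 ^ i)) : a <= b ->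
  a <= a + j%:R * ((b - a) / (2 ^ i)%:R) <= b.
Proof.
move=> ab; have p0 : 0 < (2 ^ i)%:R :> R by rewrite ltr0n expn_gt0.
have jp : j%:R <= (2 ^ i)%:R :> R by rewrite ler_nat ltnW.
have ba : 0 <= b - a by rewrite subr_ge0.
apply/andP; split; first by rewrite lerDl mulr_ge0// divr_ge0// ltW.
by rewrite -lerBrDl mulrCA ler_piMr// ler_pdivrMr// mul1r.
Qed.

Lemma supp_riemann_chain a b i q : a <= b -> supp (riemann_chain a b i) q ->
  exists2 t, a <= t <= b & q = t%:M.
Proof.
move=> ab; rewrite /supp/= /riemann_chain dval_sum => qs.
apply: contrapT => nq; move/negP: qs; apply; apply/eqP; apply: big1 => j _.
have -> : dval (((b - a) / (2 ^ i)%:R) *: tpoint (a + j%:R * ((b - a) / (2 ^ i)%:R))) q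
    = ((b - a) / (2 ^ i)%:R) *: dval (tpoint (a + j%:R * ((b - a) / (2 ^ i)%:R))) q by [].
rewrite /tpoint dval_dpoint//; case: eqP => [qE|_]; last by rewrite scaler0.
by exfalso; apply: nq; exists (a + j%:R * ((b - a) / (2 ^ i)%:R)) => //; exact: riemann_chain_node.
Qed.

End IntervalChain.

(** * The swept chain *)

Lemma subr_telescope (W : zmodType) (p u v u' v' : W) :
  p - (u' - v') = (p - (u - v)) + ((u - u') - (v - v')).
Proof.
rewrite !opprB -addrA; congr (_ + _); rewrite [u - u' + _]addrC !addrA.
by rewrite [v - u + v' - v]addrAC [v - u - v]addrAC subrr add0r [_ + u]addrAC addNr add0r.
Qed.

Section Cylinder.
Context {R : realType} {n k r : nat}.
Variables (G : 'M[R]_n) (U : set 'rV[R]_n).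
Hypotheses (GI : inner_product G) (r1 : (1 <= r)%N).
Implicit Types (a b t : R) (A : dchain k U) (J : bhat G r k U).
Local Notation G1 := (1%:M : 'M[R]_1).
Local Notation G12 := (gram_prod G G1).
Local Notation line := [set: 'rV[R]_1].
Local Notation UR := (setprod U line).

Let e := addn1 k.
Let cartc A (B : dchain 1 line) := cembed (bnorm G12 r (k.+1) UR) (cart_dirac e A B).

Lemma cart_interval_slice a b A : a <= b ->
  cnorm (cartc A (riemann_chain a b i) - cont_ext (cartc A) (interval_chain a b))
    @[i --> \oo] --> (0 : R).
Proof.
move=> ab; have [C C0 HC] := @cart_dirac_boundr R n 1 k 1 _ e U line G G1
  (inner_product1 1) r 1 A r1.
apply: (@cont_extP _ _ _ _ _ (cartc A) C) => [x y|x|].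
- by rewrite /cartc (linearB_of _ _ (cart_dirac_linearr e A)) cembedB.
- by rewrite /cartc cnorm_cembed; exact: HC.
- exact: riemann_chain_converges.
Qed.

(** The weights of the Riemann sum add up to b - a, and the product with a point mass is
    bounded uniformly in the point. *)
Lemma cart_riemann_bound a b : a <= b -> exists C, forall A i,
  bnorm G12 r (k.+1) UR (cart_dirac e A (riemann_chain a b i)) <= C * bnorm G r k U A.
Proof.
move=> ab; have [C C0 HC] := @cart_dirac_boundl R n 1 k 1 _ e U line G G1 GI r (unit1 (R := R)).
exists ((b - a) * C) => A i.
have cl := @cart_dirac_linearr R n 1 k 1 _ e U line A.
rewrite /riemann_chain (linear_sum_of _ _ cl).
apply: le_trans (snorm_sum _ _ _) _.
apply: (@le_trans _ _ (\sum_(j < 2 ^ i) (b - a) / (2 ^ i)%:R * (C * bnorm G r k U A))).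
  apply: ler_sum => j _; rewrite (linearZ_of _ _ cl) snormZ.
  rewrite ger0_norm ?divr_ge0 ?subr_ge0// ler_wpM2l ?divr_ge0 ?subr_ge0//.
  exact: HC.
rewrite sumr_const card_ord -[_ *+ (2 ^ i)]mulr_natl mulrA.
rewrite [(2 ^ i)%:R * _]mulrC divfK ?pnatr_eq0 ?expn_eq0//.
by rewrite mulrA.
Qed.

(** A diagonal sequence. The number N i depends on A i, and any larger m i will do, which
    leaves room for further requirements on m. *)
Lemma cart_interval_converges a b J (A : nat -> dchain k U) : a <= b -> converges_to A J ->
  exists N : nat -> nat, forall m : nat -> nat, (forall i, (N i <= m i)%N) ->
    converges_to (fun i => cart_dirac e (A i) (riemann_chain a b (m i)))
      (cart e r J (interval_chain a b) : bhat G12 r k.+1 UR).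
Proof.
move=> ab AJ; pose L A := cont_ext (cartc A) (interval_chain a b).
have sl A' d : 0 < d -> exists N, forall i, (N <= i)%N ->
    cnorm (cartc A' (riemann_chain a b i) - L A') < d.
  by move: d; apply/cvg0P; [move=> i; exact: cnorm_ge0|exact: cart_interval_slice].
have LB x y : L (x - y) = L x - L y.
  apply: cnorm_le0 => d d0; have d3 : 0 < d / 3 by rewrite divr_gt0.
  have [N1 H1] := sl (x - y) _ d3; have [N2 H2] := sl x _ d3; have [N3 H3] := sl y _ d3.
  pose i := maxn N1 (maxn N2 N3).
  have h1 := H1 i (leq_maxl _ _).
  have h2 := H2 i (leq_trans (leq_maxl _ _) (leq_maxr _ _)).
  have h3 := H3 i (leq_trans (leq_maxr _ _) (leq_maxr _ _)).
  have cE : cartc (x - y) (riemann_chain a b i)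
      = cartc x (riemann_chain a b i) - cartc y (riemann_chain a b i).
    by rewrite /cartc (linearB_of _ _ (cart_dirac_linearl e _)) cembedB.
  have -> : L (x - y) - (L x - L y) = (L (x - y) - cartc (x - y) (riemann_chain a b i))
      + ((cartc x (riemann_chain a b i) - L x) - (cartc y (riemann_chain a b i) - L y)).
    by rewrite cE; exact: subr_telescope.
  have T := cnorm_triangle (cartc x (riemann_chain a b i) - L x)
    (- (cartc y (riemann_chain a b i) - L y)).
  rewrite cnormN in T; apply: le_trans (cnorm_triangle _ _) _; rewrite cnormB_sym.
  apply: le_trans (lerD (ltW h1) (le_trans T (lerD (ltW h2) (ltW h3)))) _.
  by have -> : d / 3 + (d / 3 + d / 3) = d by field.
have [C HC] := cart_riemann_bound ab.
have Lbd x : cnorm (L x) <= C * bnorm G r k U x.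
  apply/ler_addgt0Pl => d d0; have [N H] := sl x d d0; have := H N (leqnn N).
  have := HC x N; rewrite -cnorm_cembed -/(cartc x _) => h1 h2.
  rewrite -[L x](subrK (cartc x (riemann_chain a b N))).
  apply: le_trans (cnorm_triangle _ _) _; rewrite cnormB_sym.
  exact: lerD (ltW h2) h1.
have LA := cont_extP LB Lbd AJ.
have [N HN] := choice (fun i => sl (A i) (i.+1%:R)^-1 (ltac:(by rewrite invr_gt0 ltr0n))).
exists N => m mN.
apply: (@cvg0_le _ _ (fun i => (i.+1%:R)^-1 + cnorm (L (A i) - cont_ext L J))) => [i|].
  rewrite cnorm_ge0/=; apply: le_trans (cnormB_le _ _ (L (A i))) _.
  by rewrite lerD2r ltW//; exact: HN.
by rewrite -[X in _ --> X]addr0; apply: cvgD LA; exact: cvg_harmonic.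
Qed.

Lemma cylinder_converges a b J (A : nat -> dchain k U) : a <= b -> converges_to A J ->
  exists N : nat -> nat, forall m : nat -> nat, (forall i, (N i <= m i)%N) ->
    converges_to (fun i => Edag_dirac G12 (e_time (n := n))
      (cart_dirac e (A i) (riemann_chain a b (m i)))) (cylinder J a b).
Proof.
move=> ab AJ; have [N H] := cart_interval_converges ab AJ; exists N => m /H cJ.
have [C C0 HC] := @Edag_bound R (n + 1) k G12 (e_time (n := n)) UR r
  (inner_product_prod GI (inner_product1 1)).
rewrite /converges_to.
apply: (@cont_extP _ _ _ _ _ (fun B => cembed (bnorm G12 r k UR) (Edag_dirac G12 (e_time (n := n)) B)) C _ _ _ _ cJ) => [x y|x].
- by rewrite (linearB_of _ _ (@Edag_dirac_linear _ _ _ G12 (e_time (n := n)) UR)) cembedB.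
- by rewrite cnorm_cembed.
Qed.

End Cylinder.

Section Sweep.
Context {R : realType} {n k : nat}.
Variables (G : 'M[R]_n) (U : set 'rV[R]_n) (V : 'rV[R]_n -> 'rV[R]_n).
Hypotheses (Uo : open U) (VC : C1_on U V).
Implicit Types (a b t : R) (A : dchain k U).
Local Notation G12 := (gram_prod G (1%:M : 'M[R]_1)).
Local Notation line := [set: 'rV[R]_1].
Local Notation UR := (setprod U line).

Lemma flow_dom_le t b : 0 <= t <= b -> flow_dom V U b `<=` flow_dom V U t.
Proof.
move=> /andP[t0 tb] p [gam [al [be [alb bbe g0 gs]]]]; exists gam, al, be; split=> //.
  by move: alb; rewrite !min_l// (le_trans t0).
by move: bbe; rewrite !max_r// ?(le_trans t0)//; exact: le_lt_trans.
Qed.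

(** The sign: contracting the time direction, which comes last, in al /\ e_time gives
    (-1)^k al. *)
Lemma push_slice A t b : 0 <= t <= b -> supp A `<=` flow_dom V U b ->
  push_dirac U (theta U V) (Edag_dirac G12 (e_time (n := n)) (cart_dirac (addn1 k) A (tpoint t)))
  = (-1) ^+ k *: push_dirac U (flow V U t) A.
Proof.
move=> tb Ab.
pose f A := push_dirac U (theta U V)
  (Edag_dirac G12 (e_time (n := n)) (cart_dirac (addn1 k) A (tpoint t))) : dchain k U.
have fl : linear f.
  by move=> c x y; rewrite /f cart_dirac_linearl Edag_dirac_linear push_dirac_linear.
pose g A : dchain k U := (-1) ^+ k *: push_dirac U (flow V U t) A.
have gl : linear g.
  by move=> c x y; rewrite /g push_dirac_linear scalerDr !scalerA mulrC.
rewrite -/(f A) -/(g A) (linear_sum_dpoint A fl) (linear_sum_dpoint A gl).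
apply: eq_big_seq => p pA; have Up := supp_in pA.
have pb : flow_dom V U b p.
  by apply: Ab; move: pA; rewrite in_fset_set ?inE//; exact: dchain_finite.
rewrite /f /g /tpoint cart_dirac_dpoint//.
have -> : Edag_dirac G12 (e_time (n := n)) (dpoint UR (row_mx p t%:M) (cross (addn1 k) (A p) unit1))
    = (-1) ^+ k *: dpoint UR (row_mx p t%:M) (kmap (row_mx 1%:M 0) (A p)).
  have URp : UR (row_mx p t%:M) by exact: setprod_row_mx.
  rewrite -dpointZ; apply: dchain_eq => z; rewrite Edag_dirac_val !dval_dpoint//.
  case: eqP => _; last exact: linear0_of (contr_linear _ _).
  exact: contr_cross.
rewrite (linearZ_of _ _ (push_dirac_linear _ _)).
by rewrite (push_theta_dpoint Uo VC (A p) tb pb Up).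
Qed.

Lemma form_sweep (eta : kform k U) A a b i : 0 <= a -> a <= b -> supp A `<=` flow_dom V U b ->
  eta (push_dirac U (theta U V) (Edag_dirac G12 (e_time (n := n))
    (cart_dirac (addn1 k) A (riemann_chain a b i))))
  = (-1) ^+ k * \sum_(j < 2 ^ i) (b - a) / (2 ^ i)%:R *
      eta (push_dirac U (flow V U (a + j%:R * ((b - a) / (2 ^ i)%:R))) A).
Proof.
move=> a0 ab Ab.
pose f (B : dchain 1 line) : R^o := eta (push_dirac U (theta U V)
  (Edag_dirac G12 (e_time (n := n)) (cart_dirac (addn1 k) A B))).
have fl : linear f.
  by move=> c x y; rewrite /f cart_dirac_linearr Edag_dirac_linear push_dirac_linear linearP.
rewrite -/(f _) /riemann_chain (linear_sum_of _ _ fl) mulr_sumr; apply: eq_bigr => j _.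
have /andP[aj jb] := riemann_chain_node j ab.
rewrite (linearZ_of _ _ fl) /f (@push_slice _ _ b)//; last by rewrite (le_trans a0).
rewrite [RHS]mulrCA -[LHS]/(_ * _); congr (_ * _); by rewrite linearZ.
Qed.

Lemma compact_prism (C : set 'rV[R]_n) a b : compact C ->
  compact [set z : 'rV[R]_(n + 1) | C (lsubmx z) /\ a <= time z <= b].
Proof.
move=> Cc; pose f (x : 'rV[R]_n * R) : 'rV[R]_(n + 1) := row_mx x.1 x.2%:M.
have fc : continuous f.
  move=> x; apply: (@lipschitz_continuous_at _ _ _ f 1) => y; rewrite mul1r.
  apply: norm_coordP => // i j; rewrite /f mxE [X in _ + X]mxE.
  case: (split_ordP j) => l ->; rewrite ?row_mxEl ?row_mxEr prod_normE/= le_max.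
    have -> : x.1 i l - y.1 i l = (x.1 - y.1) i l by rewrite !mxE.
    by rewrite ler_coord_norm.
  by rewrite !ord1 !mxE eqxx !mulr1n lexx orbT.
have := continuous_compact (continuous_subspaceT fc) (compact_setX Cc (@segment_compact R a b)).
congr compact; apply/seteqP; split=> z /=.
  move=> [[p t] [/= Cp]]; rewrite in_itv/= => tab <-.
  by rewrite /time /f row_mxKl row_mxKr mxE eqxx mulr1n.
move=> [Cz tz]; exists (lsubmx z, time z); first by split=> //=; rewrite in_itv.
rewrite /f/= -[RHS]hsubmxK; congr row_mx; apply/rowP => j.
by rewrite !ord1 mxE eqxx mulr1n.
Qed.

Lemma supp_sweep A a b i z : a <= b ->
  supp (Edag_dirac G12 (e_time (n := n)) (cart_dirac (addn1 k) A (riemann_chain a b i))) z ->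
  supp A (lsubmx z) /\ a <= time z <= b.
Proof.
move=> ab; rewrite /supp/= Edag_dirac_val cart_dirac_val => zs; split.
  apply: contra_neq zs => ->; rewrite (linear0_of (cross_linearl _ _)).
  exact: linear0_of (contr_linear _ _).
have /(supp_riemann_chain ab)[t tab zt] : supp (riemann_chain a b i) (rsubmx z).
  rewrite /supp/=; apply: contra_neq zs => ->; rewrite (linear0_of (cross_linearr _ _)).
  exact: linear0_of (contr_linear _ _).
by rewrite /time zt mxE eqxx mulr1n.
Qed.

End Sweep.

(** * The fundamental theorem *)

(* With E_v contracting the first vector with sign +1, and the time direction put
   last in J x (a, b), one has E_(e_(n+1)) (al /\ e_(n+1)) = (-1)^k al for a k-vector
   al, so that the swept chain is (-1)^k times the time integral of the chains J_t.
   The factor (-1)^k compensates for it. *)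
Theorem theorem10p2p1 (R : realType) (n k r : nat) (G : 'M[R]_n)
    (U : set 'rV[R]_n) (J : bhat G r k U) (V : 'rV[R]_n -> 'rV[R]_n)
    (om : kform k U) (t0 a b : R)
    (hG : inner_product G) (hU : open U) (hr : (1 <= r)%N)
    (hJ : compact_support J)
    (hV : vector_field G r U V)
    (hom : bform G r.+1 om)
    (ht0 : 0 < t0) (hdef : evolution_defined V J t0)
    (h0a : 0 <= a) (hab : a <= b) (hbt0 : b < t0)
    (hlie : bform G r (lie V om)) :
  bint (evolving V J b) om - bint (evolving V J a) om
  = (-1) ^+ k * bint (swept V J t0 a b) (lie V om).
Proof.
have VC : C1_on U V by apply: Cr_C1_on hr _; case: hV => -[].
have [push_def sweep_def] := hdef.
have b0 : 0 <= b by exact: le_trans hab.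
have omr : bform G r om by exact: bform_level (leqnSn r) hom.
have evolvingP t (A : nat -> dchain k U) : 0 <= t < t0 -> carried (flow_dom V U t) A ->
    converges_to A J ->
    (om (push_dirac U (flow V U t) (A i)) : R) @[i --> \oo] --> bint (evolving V J t) om.
  move=> /push_def pd cA AJ; apply: bint_lim => //.
  by have [_ H] := xgetPex 0 pd; exact: H.
(* The domains of the flow decrease with time, so that the sequence for the time b also
   serves the time a. *)
have [K [[A [[C [Cc Cb AC]] AJ]] _]] := push_def b (introT andP (conj b0 hbt0)).
have Ab i : supp (A i) `<=` flow_dom V U b by apply: subset_trans Cb.
have limb := evolvingP b A (introT andP (conj b0 hbt0)) (ex_intro _ C (And3 Cc Cb AC)) AJ.
have Ca : C `<=` flow_dom V U a.
  by apply: subset_trans Cb _; apply: flow_dom_le; rewrite h0a.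
have lima := evolvingP a A (introT andP (conj h0a (le_lt_trans hab hbt0)))
  (ex_intro _ C (And3 Cc Ca AC)) AJ.
have [N HN] := cylinder_converges hG hr hab AJ.
have od be p : U p -> differentiable (coef om be) p.
  by move=> Up; apply: (coef_differentiable hG hU hom).
have lc be p : U p -> {for p, continuous (coef (lie V om) be)}.
  by move=> Up; apply: (coef_continuous hG hU hlie).
(* The Riemann sums S i m converge to the increment D i as m grows. *)
pose S i m : R := \sum_(j < 2 ^ m) (b - a) / (2 ^ m)%:R *
  lie V om (push_dirac U (flow V U (a + j%:R * ((b - a) / (2 ^ m)%:R))) (A i)).
pose D i : R := om (push_dirac U (flow V U b) (A i)) - om (push_dirac U (flow V U a) (A i)).
have SD i : exists m, (N i <= m)%N /\ `|S i m - D i| < (i.+1%:R)^-1.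
  have [] := @pow2_riemann_sum_cvg _ (fun t => om (push_dirac U (flow V U t) (A i)))
    (fun t => lie V om (push_dirac U (flow V U t) (A i))) a b hab _ _ (i.+1%:R)^-1.
  - move=> t /andP[at_ tb]; apply: (@is_derive_push _ _ _ _ _ hU VC om _ _ b) => //.
    + by rewrite tb (le_trans h0a).
    + exact: Ab.
  - move=> t /andP[at_ tb]; apply: (@continuous_push _ _ _ _ _ hU VC (lie V om) _ _ b) => //.
    + by rewrite tb (le_trans h0a).
    + exact: Ab.
  - by rewrite invr_gt0 ltr0n.
  - move=> m H; exists (maxn (N i) m); split; first exact: leq_maxl.
    exact: H (leq_maxr _ _).
have [m Hm] := choice SD.
have cB := HN m (fun i => (Hm i).1).
have [sweepE sweepP] := xgetPex 0 (sweep_def a b h0a hab hbt0).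
have carB : carried (theta_dom U V t0) (fun i => Edag_dirac (gram_prod G 1%:M)
    (e_time (n := n)) (cart_dirac (addn1 k) (A i) (riemann_chain a b (m i)))).
  (* The product of C with the time interval, inside the domain of theta. *)
  exists [set z | C (lsubmx z) /\ a <= time z <= b]; split.
  - exact: compact_prism.
  - move=> z [Cz /andP[az zb]]; have z0 := le_trans h0a az.
    rewrite /theta_dom/= z0 (le_lt_trans zb hbt0); split=> //.
    by apply: (@flow_dom_le _ _ _ _ _ b) => //; [rewrite z0|exact: Cb].
  - by move=> i z /(supp_sweep hab)[/AC Cz tz].
have lims := bint_lim hG hlie (sweepP _ carB cB).
have limS : ((-1) ^+ k * S i (m i)) @[i --> \oo] --> bint (swept V J t0 a b) (lie V om).
  move: lims; rewrite -/(swept V J t0 a b).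
  have -> // : (fun i => lie V om (push_dirac U (theta U V) (Edag_dirac (gram_prod G 1%:M)
      (e_time (n := n)) (cart_dirac (addn1 k) (A i) (riemann_chain a b (m i))))))
    = (fun i => (-1) ^+ k * S i (m i)).
  by apply/funext => i; rewrite (form_sweep G hU VC _ _ h0a hab (Ab i)).
have limS' : S i (m i) @[i --> \oo] --> (-1) ^+ k * bint (swept V J t0 a b) (lie V om).
  have -> : (fun i => S i (m i)) = (fun i => (-1) ^+ k * ((-1) ^+ k * S i (m i))).
    by apply/funext => i; rewrite mulrA -exprD -signr_odd addnn odd_double expr0 mul1r.
  by apply: cvgM limS; exact: cvg_cst.
have limD : D i @[i --> \oo] --> (-1) ^+ k * bint (swept V J t0 a b) (lie V om).
  have -> : D = (fun i => S i (m i) - (S i (m i) - D i)).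
    by apply/funext => i; rewrite opprB addrC subrK.
  rewrite -[X in _ --> X]subr0; apply: cvgB limS' _.
  apply/norm_cvg0P; apply: cvg0_le (@cvg_harmonic R) => i.
  by rewrite normr_ge0/= ltW//; exact: (Hm i).2.
exact: (cvg_unique _ (cvgB limb lima) limD).
Qed.
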